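(* (Second-order necessary optimality conditions.) Let $(x^*,y^* )\in\mathbb{R}^n\times\mathbb{R}^m$ be a point around which $f,g,h$ are twice continuously differentiable and thrice continuously differentiable with respect to the variable $y$ and $F,G,H$ are twice continuously differentiable. Suppose that the lower level problem $(P_{x^*})$ satisfies the Jacobian uniqueness conditions at $(y^*,\mu^*,\xi^* )$ and that $(x^*,y^* )$ is a bi-local solution of (BP). Write $u^*=(x^*,y^*,\mu^*,\xi^* )$. Then the following hold. (i) If the MFCQ holds at $x^*$ for (SP), then $\Lambda(x^* )$ is a nonempty compact convex set and for every $d_x\in\mathcal{C}(x^* )$, $$\max_{(\lambda_H^*,\lambda_G^* )\in\Lambda(x^* )}\left\{d_x^T\nabla^2_{xx}L^{SP}(x^*;\lambda_H^*,\lambda_G^* )d_x\right\}\ge0.$$ (ii) If the MFCQ holds at $(x^*,y^*,\mu^*,\xi^* )$ for (FP), then $\Lambda(x^*,y^*,\mu^*,\xi^* )$ is a nonempty compact convex set and for every $d\in\mathcal{C}(x^*,y^*,\mu^*,\xi^* )$, $$\max_{\lambda^*\in\Lambda(x^*,y^*,\mu^*,\xi^* )}\left\{d^T\nabla^2_{uu}L^{FP}(u^*;\lambda^* )d\right\}\ge0.$$ Furthermore, (i) and (ii) are equivalent, in the sense that the condition in the conclusion of (i) holds if and only if the condition in the conclusion of (ii) holds.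
   Context: Data: $F,f:\mathbb{R}^n\times\mathbb{R}^m\to\mathbb{R}$, $H:\mathbb{R}^n\times\mathbb{R}^m\to\mathbb{R}^p$, $G:\mathbb{R}^n\times\mathbb{R}^m\to\mathbb{R}^q$, $h:\mathbb{R}^n\times\mathbb{R}^m\to\mathbb{R}^r$, $g:\mathbb{R}^n\times\mathbb{R}^m\to\mathbb{R}^s$. Let $\Phi=\{(x,y):H(x,y)=0,\ G(x,y)\le0\}$, $Y(x)=\{y\in\mathbb{R}^m:h(x,y)=0,\ g(x,y)\le0\}$, $I_G(x^*,y^* )=\{i:G_i(x^*,y^* )=0\}$. Problem $(P_x)$ is $\min_yf(x,y)$ s.t. $y\in Y(x)$, with solution set $S(x)$ and Lagrangian $\mathcal{L}(x;y,\mu,\xi)=f(x,y)+\mu^Th(x,y)+\xi^Tg(x,y)$. The bilevel problem (BP) is $\min F(x,y)$ s.t. $(x,y)\in\Phi$, $y\in S(x)$. $\mathcal{J}$ denotes Jacobians, $\nabla^2_{yx}\mathcal{L}$ is the $m\times n$ Jacobian in $x$ of $\nabla_y\mathcal{L}$ (with $y,\mu,\xi$ held fixed), $\boldsymbol{B}_\delta(z)$ is the closed ball $\{z':\|z'-z\|\le\delta\}$, $\mathbb{R}_+=[0,\infty)$, $\Pi_{\mathbb{R}^s_-}$ the Euclidean projection onto the nonpositive orthant of $\mathbb{R}^s$ (smooth near vectors with no zero component); $u\perp v$ means $u^Tv=0$. Bi-local (optimal) solution of (BP): a point $(x^*,y^* )$ with $(x^*,y^* )\in\Phi$ and $y^*\in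 Y(x^* )$ for which there exist $\delta_0>0$ and a function $\eta:(0,\delta_0]\to\mathbb{R}_+$ with $\eta(\delta)\to0$ as $\delta\to0$ such that for every $\delta\in(0,\delta_0]$: (a) $f(x^*,y^* )\le f(x^*,z)$ for all $z\in Y(x^* )\cap\boldsymbol{B}_{\eta(\delta)}(y^* )$; and (b) for every $(x,y)\in\Phi\cap[\boldsymbol{B}_\delta(x^* )\times\boldsymbol{B}_{\eta(\delta)}(y^* )]$ satisfying $y\in\operatorname{argmin}_z\{f(x,z):z\in Y(x)\cap\boldsymbol{B}_{\eta(\delta)}(y^* )\}$ one has $F(x^*,y^* )\le F(x,y)$. Jacobian uniqueness conditions of $(P_{x})$ at $(y,\mu,\xi)\in\mathbb{R}^m\times\mathbb{R}^r\times\mathbb{R}^s$: (a) KKT: $\nabla_y\mathcal{L}(x;y,\mu,\xi)=0$, $h(x,y)=0$, $\xi\ge0$, $g(x,y)\le0$, $\xi^Tg(x,y)=0$; (b) LICQ: the vectors $\nabla_yh_j(x,y)$, $j=1,\dots,r$, and $\nabla_yg_i(x,y)$, $i\in I_x(y):=\{i:g_i(x,y)=0\}$, are linearly independent; (c) strict complementarity: $\xi_i-g_i(x,y)>0$ for $i=1,\dots,s$; (d) second-order sufficiency: $\langle\nabla^2_{yy}\mathcal{L}(x;y,\mu,\xi)d_y,d_y\rangle>0$ for every nonzero $d_y$ in the critical cone $\{d_y\in\mathbb{R}^m:\mathcal{J}_yh(x,y)d_y=0,\ \nabla_yg_i(x,y)^Td_y\le0\ (i\in I_x(y)),\ \nabla_yf(x,y)^Td_y\le0\}$.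 Under the smoothness and Jacobian uniqueness hypotheses of the claim, Robinson's theorem and the second-order implicit function theorem are invoked to provide $\delta_1>0$, $\varepsilon_1>0$ and a twice continuously differentiable mapping $(y,\mu,\xi):\boldsymbol{B}_{\delta_1}(x^* )\to\boldsymbol{B}_{\varepsilon_1}(y^* )\times\boldsymbol{B}_{\varepsilon_1}(\mu^* )\times\boldsymbol{B}_{\varepsilon_1}(\xi^* )$ with value $(y^*,\mu^*,\xi^* )$ at $x^*$ such that the Jacobian uniqueness conditions of $(P_x)$ hold at $(y(x),\mu(x),\xi(x))$ for all $x\in\boldsymbol{B}_{\delta_1}(x^* )$. Problem (SP) (considered for $x$ near $x^*$, with this $y(\cdot)$): $\min_xF(x,y(x))$ s.t. $H(x,y(x))=0$, $G(x,y(x))\le0$. Problem (FP): $\min_{x,y,\mu,\xi}F(x,y)$ s.t. $H(x,y)=0$, $G(x,y)\le0$, $\nabla_y\mathcal{L}(x;y,\mu,\xi)=0$, $h(x,y)=0$, $g(x,y)-\Pi_{\mathbb{R}^s_-}(g(x,y)+\xi)=0$. Lagrangians: $L^{SP}(x;\lambda_H,\lambda_G)=F(x,y(x))+\lambda_H^TH(x,y(x))+\lambda_G^TG(x,y(x))$ and, for $u=(x,y,\mu,\xi)$, $\lambda=(\lambda_H,\lambda_G,\lambda_{\mathcal{L}},\lambda_h,\lambda_g)\in\mathbb{R}^p\times\mathbb{R}^q\times\mathbb{R}^m\times\mathbb{R}^r\times\mathbb{R}^s$, $$L^{FP}(u;\lambda)=F(x,y)+\lambda_H^TH(x,y)+\lambda_G^TG(x,y)+\lambda_{\mathcal{L}}^T\nabla_y\mathcal{L}(x;y,\mu,\xi)+\lambda_h^Th(x,y)+\lambda_g^T\big(g(x,y)-\Pi_{\mathbb{R}^s_-}(g(x,y)+\xi)\big).$$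 Multiplier sets: $\Lambda(x^* )$ is the set of $(\lambda_H,\lambda_G)$ with $\nabla_xL^{SP}(x^*;\lambda_H,\lambda_G)=0$, $H(x^*,y^* )=0$, $0\le\lambda_G\perp G(x^*,y^* )\le0$. $\Lambda(x^*,y^*,\mu^*,\xi^* )$ is the set of $\lambda$ with $\nabla_uL^{FP}(u^*;\lambda)=0$, $H(x^*,y^* )=0$, $0\le\lambda_G\perp G(x^*,y^* )\le0$, $\nabla_y\mathcal{L}(x^*;y^*,\mu^*,\xi^* )=0$, $h(x^*,y^* )=0$, $g(x^*,y^* )-\Pi_{\mathbb{R}^s_-}(g(x^*,y^* )+\xi^* )=0$. Critical cones (derivatives of $F,G,H$ at $(x^*,y^* )$): $\mathcal{C}(x^* )$ is the set of $d_x\in\mathbb{R}^n$ with $(\mathcal{J}_xH+\mathcal{J}_yH\,\mathcal{J}y(x^* ))d_x=0$, $(\nabla_xG_i^T+\nabla_yG_i^T\mathcal{J}y(x^* ))d_x\le0$ for $i\in I_G(x^*,y^* )$, and $(\nabla_xF^T+\nabla_yF^T\mathcal{J}y(x^* ))d_x\le0$. $\mathcal{C}(x^*,y^*,\mu^*,\xi^* )$ is the set of $d=(d_x,d_y,d_\mu,d_\xi)\in\mathbb{R}^{n+m+r+s}$ with $Ad=0$, $\nabla_xG_i^Td_x+\nabla_yG_i^Td_y\le0$ for $i\in I_G(x^*,y^* )$, and $\nabla_xF^Td_x+\nabla_yF^Td_y\le0$, where, with $W^*=\mathcal{J}\Pi_{\mathbb{R}^s_-}(g(x^*,y^* )+\xi^*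 )$ and all functions evaluated at $(x^*,y^*,\mu^*,\xi^* )$, $$A=\begin{bmatrix}\mathcal{J}_xH&\mathcal{J}_yH&0&0\\ \nabla^2_{yx}\mathcal{L}&\nabla^2_{yy}\mathcal{L}&\mathcal{J}_yh^T&\mathcal{J}_yg^T\\ \mathcal{J}_xh&\mathcal{J}_yh&0&0\\ (I-W^* )\mathcal{J}_xg&(I-W^* )\mathcal{J}_yg&0&-W^*\end{bmatrix}.$$ MFCQ: for a problem $\min\phi(z)$ s.t. $a(z)=0$, $b(z)\le0$ with data continuously differentiable around a feasible point $z^*$, the MFCQ holds at $z^*$ if (a) the gradients $\nabla a_j(z^* )$ of all equality constraints are linearly independent, and (b) there is a vector $d$ with $\nabla a_j(z^* )^Td=0$ for all $j$ and $\nabla b_i(z^* )^Td<0$ for all $i$ with $b_i(z^* )=0$.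
   Formalization: In the definition of bi-local solution η must be positive on (0,δ₀] (with η≡0 allowed the claim fails: f=(y−x)²/2, F=y at (0,0)); ''thrice continuously differentiable in y'' means the first y-derivatives of f,g,h are C² jointly in (x,y), as needed for the second derivatives of L^FP. *)

(* Defs.v *)
From mathcomp Require Export all_boot all_order all_algebra.
From mathcomp Require Export all_classical all_reals all_analysis.

Set Implicit Arguments.
Unset Strict Implicit.
Unset Printing Implicit Defensive.
Export Order.TTheory GRing.Theory Num.Theory numFieldNormedType.Exports.

Global Open Scope classical_set_scope.
Global Open Scope ring_scope.

(* Points and multipliers are row vectors, as in the library's ['J].
   Directions are column vectors, and Jacobians and Hessians have the usual
   (codomain) x (domain) shape, so that they act on directions on the left. *)

Section Euclidean.
Context {R : realType}.

Definition dotr k (u v : 'rV[R]_k) : R := \sum_i u 0 i * v 0 i.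

(* The library's norm on matrices is the sup norm. *)
Definition enorm k (v : 'rV[R]_k) : R := Num.sqrt (dotr v v).

Definition eball k (c : 'rV[R]_k) (e : R) : set 'rV[R]_k :=
  [set z | enorm (z - c) <= e].

Definition nneg k : set 'rV[R]_k := [set v | forall i, 0 <= v 0 i].
Definition npos k : set 'rV[R]_k := [set v | forall i, v 0 i <= 0].

Definition argmin (T : Type) (phi : T -> R) (A : set T) : set T :=
  [set z | A z /\ forall z', A z' -> phi z <= phi z'].

(* The maximum of [phi] over [A] is attained, and is nonnegative. *)
Definition max_ge0 (T : Type) (A : set T) (phi : T -> R) : Prop :=
  exists2 z, A z & (forall z', A z' -> phi z' <= phi z) /\ 0 <= phi z.

Definition eproj k (A : set 'rV[R]_k) (z : 'rV[R]_k) : 'rV[R]_k :=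
  get (argmin (fun w => enorm (z - w)) A).

End Euclidean.

Section Smoothness.
Context {R : realType}.

Definition grad N (phi : 'rV[R]_N -> R) (z : 'rV[R]_N) : 'rV[R]_N :=
  \row_j 'D_(delta_mx 0 j) phi z.

Definition jac N M (a : 'rV[R]_N -> 'rV[R]_M) (z : 'rV[R]_N) : 'M[R]_(M, N) :=
  ('J a z)^T.

Definition hess N (phi : 'rV[R]_N -> R) (z : 'rV[R]_N) : 'M[R]_N :=
  jac (grad phi) z.

(* [a] is k times continuously differentiable on a neighbourhood of [z].  The
   neighbourhood may depend on the directions, which is harmless on the
   finite-dimensional spaces [V] considered here: [D_v a] is linear in [v], so
   a finite basis of directions suffices. *)
Fixpoint Ck (k : nat) (V W : normedModType R) (a : V -> W) (z : V) : Prop :=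
  if k is k'.+1 then
    (\forall z' \near z, differentiable a z') /\ forall v, Ck k' ('D_v a) z
  else \forall z' \near z, {for z', continuous a}.

(* [a] is C^2 around [z] and its derivatives in the second variable are C^2
   as well, i.e., the third derivatives involving that variable at least once
   exist and are continuous. *)
Definition C2_C3y (V1 V2 W : normedModType R) (a : V1 * V2 -> W)
    (z : V1 * V2) : Prop :=
  Ck 2 a z /\ forall v : V2, Ck 2 ('D_((0, v)) a) z.

Definition MFCQ N P Q (a : 'rV[R]_N -> 'rV[R]_P) (b : 'rV[R]_N -> 'rV[R]_Q)
    (z : 'rV[R]_N) : Prop :=
  free [seq grad (fun w => a w 0 j) z | j : 'I_P] /\
  exists d : 'cV[R]_N,
    (forall j, (grad (fun w => a w 0 j) z *m d) 0 0 = 0) /\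
    (forall i, b z 0 i = 0 -> (grad (fun w => b w 0 i) z *m d) 0 0 < 0).

End Smoothness.

Section Bilevel.
Context {R : realType} {n m p q r s : nat}.
Variables (F f : 'rV[R]_n * 'rV[R]_m -> R).
Variables (H : 'rV[R]_n * 'rV[R]_m -> 'rV[R]_p).
Variables (G : 'rV[R]_n * 'rV[R]_m -> 'rV[R]_q).
Variables (h : 'rV[R]_n * 'rV[R]_m -> 'rV[R]_r).
Variables (g : 'rV[R]_n * 'rV[R]_m -> 'rV[R]_s).

Implicit Types (x : 'rV[R]_n) (y : 'rV[R]_m) (mu : 'rV[R]_r) (xi : 'rV[R]_s).

Definition upper_feasible : set ('rV[R]_n * 'rV[R]_m) :=
  [set z | H z = 0 /\ npos (G z)].

Definition lower_feasible x : set 'rV[R]_m :=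
  [set y | h (x, y) = 0 /\ npos (g (x, y))].

(* [eta] is required to be positive on (0, d0].  If [eta] could vanish
   identically, the lower-level balls would reduce to {ys} and carry no
   information: for [F (x, y) = y] and [f (x, y) = (y - x)^2 / 2], without
   constraints, the point (0, 0) would be a bi-local solution although 0 is
   not stationary for the reduced objective [x |-> F (x, y x) = x]. *)
Definition bilocal_solution (xs : 'rV[R]_n) (ys : 'rV[R]_m) : Prop :=
  [/\ upper_feasible (xs, ys),
      lower_feasible xs ys &
      exists (d0 : R) (eta : R -> R),
        [/\ 0 < d0,
            forall d : R, 0 < d <= d0 -> 0 < eta d,
            eta d @[d --> 0^'+] --> 0 &
            forall d : R, 0 < d <= d0 ->
              (forall z, (lower_feasible xs `&` eball ys (eta d)) z ->
                 f (xs, ys) <= f (xs, z)) /\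
              (forall x y, upper_feasible (x, y) ->
                 eball xs d x -> eball ys (eta d) y ->
                 argmin (fun z => f (x, z))
                   (lower_feasible x `&` eball ys (eta d)) y ->
                 F (xs, ys) <= F (x, y))]].

Definition lagr x y mu xi : R :=
  f (x, y) + dotr mu (h (x, y)) + dotr xi (g (x, y)).

Definition grad_y_lagr x y mu xi : 'rV[R]_m :=
  grad (fun y' => lagr x y' mu xi) y.

Definition hess_yy_lagr x y mu xi : 'M[R]_m :=
  hess (fun y' => lagr x y' mu xi) y.

Definition hess_yx_lagr x y mu xi : 'M[R]_(m, n) :=
  jac (fun x' => grad_y_lagr x' y mu xi) x.

Definition lower_critical_cone x y : set 'cV[R]_m :=
  [set d | [/\ jac (fun y' => h (x, y')) y *m d = 0,
      forall i, g (x, y) 0 i = 0 ->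
        (grad (fun y' => g (x, y') 0 i) y *m d) 0 0 <= 0 &
      (grad (fun y' => f (x, y')) y *m d) 0 0 <= 0]].

Definition jacobian_uniqueness x y mu xi : Prop :=
  [/\ [/\ grad_y_lagr x y mu xi = 0, h (x, y) = 0, nneg xi, npos (g (x, y)) &
          dotr xi (g (x, y)) = 0],
      free ([seq grad (fun y' => h (x, y') 0 j) y | j : 'I_r] ++
            [seq grad (fun y' => g (x, y') 0 i) y |
              i <- enum 'I_s & g (x, y) 0 i == 0]),
      forall i, 0 < xi 0 i - g (x, y) 0 i &
      forall d, lower_critical_cone x y d -> d != 0 ->
        0 < (d^T *m hess_yy_lagr x y mu xi *m d) 0 0].

Section AtPoint.
Variables (xs : 'rV[R]_n) (ys : 'rV[R]_m) (mus : 'rV[R]_r) (xis : 'rV[R]_s).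

Definition kkt_map (d1 e1 : R) (y : 'rV[R]_n -> 'rV[R]_m)
    (mu : 'rV[R]_n -> 'rV[R]_r) (xi : 'rV[R]_n -> 'rV[R]_s) : Prop :=
  [/\ 0 < d1, 0 < e1,
      [/\ y xs = ys, mu xs = mus & xi xs = xis] &
      forall x, eball xs d1 x ->
        [/\ [/\ eball ys e1 (y x), eball mus e1 (mu x) & eball xis e1 (xi x)],
            [/\ Ck 2 y x, Ck 2 mu x & Ck 2 xi x] &
            jacobian_uniqueness x (y x) (mu x) (xi x)]].

Section SP.
Variable y : 'rV[R]_n -> 'rV[R]_m.

Definition SP_MFCQ : Prop :=
  MFCQ (fun x => H (x, y x)) (fun x => G (x, y x)) xs.

Definition SP_lagr (l : 'rV[R]_p * 'rV[R]_q) x : R :=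
  F (x, y x) + dotr l.1 (H (x, y x)) + dotr l.2 (G (x, y x)).

Definition SP_multipliers : set ('rV[R]_p * 'rV[R]_q) :=
  [set l | [/\ grad (SP_lagr l) xs = 0, H (xs, ys) = 0, nneg l.2,
               dotr l.2 (G (xs, ys)) = 0 & npos (G (xs, ys))]].

Definition SP_critical_cone : set 'cV[R]_n :=
  [set d | [/\
    (jac (fun x' => H (x', ys)) xs +
       jac (fun y' => H (xs, y')) ys *m jac y xs) *m d = 0,
    forall i, G (xs, ys) 0 i = 0 ->
      ((grad (fun x' => G (x', ys) 0 i) xs +
          grad (fun y' => G (xs, y') 0 i) ys *m jac y xs) *m d) 0 0 <= 0 &
    ((grad (fun x' => F (x', ys)) xs +
        grad (fun y' => F (xs, y')) ys *m jac y xs) *m d) 0 0 <= 0]].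

Definition SP_multiplier_condition : Prop :=
  [/\ SP_multipliers !=set0, compact SP_multipliers &
      convex_set SP_multipliers].

Definition SP_second_order_condition : Prop :=
  forall d : 'cV[R]_n, SP_critical_cone d ->
    max_ge0 SP_multipliers
      (fun l => (d^T *m hess (SP_lagr l) xs *m d) 0 0).

End SP.

Section FP.
Local Notation dimU := (n + (m + (r + s)))%N.

Definition u_x (u : 'rV[R]_dimU) : 'rV[R]_n := lsubmx u.
Definition u_y (u : 'rV[R]_dimU) : 'rV[R]_m := lsubmx (rsubmx u).
Definition u_mu (u : 'rV[R]_dimU) : 'rV[R]_r := lsubmx (rsubmx (rsubmx u)).
Definition u_xi (u : 'rV[R]_dimU) : 'rV[R]_s := rsubmx (rsubmx (rsubmx u)).

Definition us : 'rV[R]_dimU := row_mx xs (row_mx ys (row_mx mus xis)).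

Definition comp_residual x y xi : 'rV[R]_s :=
  g (x, y) - eproj (@npos R s) (g (x, y) + xi).

Definition FP_eq (u : 'rV[R]_dimU) : 'rV[R]_(p + (m + (r + s))) :=
  row_mx (H (u_x u, u_y u))
    (row_mx (grad_y_lagr (u_x u) (u_y u) (u_mu u) (u_xi u))
      (row_mx (h (u_x u, u_y u)) (comp_residual (u_x u) (u_y u) (u_xi u)))).

Definition FP_ineq (u : 'rV[R]_dimU) : 'rV[R]_q := G (u_x u, u_y u).

Definition FP_MFCQ : Prop := MFCQ FP_eq FP_ineq us.

Definition FP_lagr
    (l : 'rV[R]_p * 'rV[R]_q * 'rV[R]_m * 'rV[R]_r * 'rV[R]_s)
    (u : 'rV[R]_dimU) : R :=
  let: (lH, lG, lL, lh, lg) := l in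
  let: (x, y, mu, xi) := (u_x u, u_y u, u_mu u, u_xi u) in
  F (x, y) + dotr lH (H (x, y)) + dotr lG (G (x, y)) +
  dotr lL (grad_y_lagr x y mu xi) + dotr lh (h (x, y)) +
  dotr lg (comp_residual x y xi).

Definition FP_multipliers :
    set ('rV[R]_p * 'rV[R]_q * 'rV[R]_m * 'rV[R]_r * 'rV[R]_s) :=
  [set l | let: (lH, lG, lL, lh, lg) := l in
    [/\ grad (FP_lagr l) us = 0,
        H (xs, ys) = 0,
        [/\ nneg lG, dotr lG (G (xs, ys)) = 0 & npos (G (xs, ys))],
        grad_y_lagr xs ys mus xis = 0 &
        h (xs, ys) = 0 /\ comp_residual xs ys xis = 0]].

Definition FP_matrix : 'M[R]_(p + (m + (r + s)), dimU) :=
  let JxH := jac (fun x' => H (x', ys)) xs in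
  let JyH := jac (fun y' => H (xs, y')) ys in
  let Jxh := jac (fun x' => h (x', ys)) xs in
  let Jyh := jac (fun y' => h (xs, y')) ys in
  let Jxg := jac (fun x' => g (x', ys)) xs in
  let Jyg := jac (fun y' => g (xs, y')) ys in
  let W := jac (eproj (@npos R s)) (g (xs, ys) + xis) in
  col_mx (row_mx JxH (row_mx JyH (row_mx 0 0)))
  (col_mx (row_mx (hess_yx_lagr xs ys mus xis)
             (row_mx (hess_yy_lagr xs ys mus xis) (row_mx Jyh^T Jyg^T)))
  (col_mx (row_mx Jxh (row_mx Jyh (row_mx 0 0)))
          (row_mx ((1%:M - W) *m Jxg)
             (row_mx ((1%:M - W) *m Jyg) (row_mx 0 (- W)))))).

Definition FP_critical_cone : set 'cV[R]_dimU :=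
  [set d | let dx := usubmx d in let dy := usubmx (dsubmx d) in
    [/\ FP_matrix *m d = 0,
        forall i, G (xs, ys) 0 i = 0 ->
          (grad (fun x' => G (x', ys) 0 i) xs *m dx +
             grad (fun y' => G (xs, y') 0 i) ys *m dy) 0 0 <= 0 &
        (grad (fun x' => F (x', ys)) xs *m dx +
           grad (fun y' => F (xs, y')) ys *m dy) 0 0 <= 0]].

Definition FP_multiplier_condition : Prop :=
  [/\ FP_multipliers !=set0, compact FP_multipliers &
      convex_set FP_multipliers].

Definition FP_second_order_condition : Prop :=
  forall d, FP_critical_cone d ->
    max_ge0 FP_multipliers
      (fun l => (d^T *m hess (FP_lagr l) us *m d) 0 0).

End FP.
End AtPoint.
End Bilevel.

(* Main.v *)
From HB Require Import structures.
From mathcomp Require Import ring lra.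
Require Import Defs.

Set Implicit Arguments.
Unset Strict Implicit.
Unset Printing Implicit Defensive.

(** The theorem reduces the bilevel problem to a smooth nonlinear program in
    the upper variable [x] alone, and then shows that this program and (FP) have
    the same second-order theory.

    Lower level.  At points [u = (x, y, mu, xi)] near [u*], strict complementarity
    keeps every component of [g + xi] away from 0, so that the projection is
    locally linear and the KKT conditions become a C^2 system [kkt_res u = 0].
    The second-order condition and LICQ make its derivative in [(y, mu, xi)]
    invertible ([kkt_res_unit]), so the implicit function theorem gives a C^2
    branch of KKT points ([kkt_map_exists]); the Jacobian uniqueness conditions
    are open along the zeros of [kkt_res] ([near_jacobian_uniqueness]).

    Reduction.  Near [u*] a KKT point minimises [f (x, .)] over all feasible
    points in a ball whose radius does not depend on [x] ([lower_growth]).  So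
    one ball of the definition of a bi-local solution already shows that [x*] is
    a local minimiser of [F (x, y x)] under the upper constraints
    ([reduced_local_min]).

    Necessary conditions.  For a nonlinear program under MFCQ, a critical
    direction [d] without a suitable multiplier would, by Motzkin's alternative,
    admit an acceleration [w] such that the arc [z + t d + t^2 w] lowers the
    objective and the active inequalities at second order; a Newton-type
    correction of size o(t^2) restores the equations and contradicts minimality
    ([second_order_multiplier]).  MFCQ also makes the multiplier set compact
    ([nlp_multipliers_compact]), so that the maximum is attained.  This is (i).

    Equivalence.  The constraint [kkt_res u = 0] of (FP) describes the graph of
    the branch.  Since its derivative in [(y, mu, xi)] is invertible, each
    multiplier of (SP) extends in exactly one way to a multiplier of (FP), by an
    affine map ([lift_multiplierP], [multiplier_lifts]); the critical directions
    of (FP) are the images of those of (SP) under the derivative of the branch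
    ([critical_cone_lift], [critical_cone_drop]); and the two Lagrangians agree
    along the graph while the one of (FP) is stationary at [u*], so the quadratic
    forms agree ([quadratic_reduced]).  MFCQ descends from (FP) to (SP)
    ([MFCQ_reduced]), whence (ii). *)

(** * C^k maps between normed modules *)

Section Ck_domain.
Context {R : realType}.

Section diff.
Variables V W : normedModType R.
Implicit Types a b : V -> W.

Lemma differentiable_near_eq a b z :
  (\forall z' \near z, a z' = b z') -> differentiable a z -> differentiable b z.
Proof.
move=> ab da.
have abz := nbhs_singleton ab.
have [ca ea] := (diff_locallyP z a).1 da.
have dE : b \o shift z = cst (b z) + 'd a z +o_ 0 id.
  apply/eqaddoP => e e0; move/eqaddoP/(_ e e0) : ea.
  have ab0 : \forall h \near 0, a (h + z) = b (h + z).
    by move: ab; rewrite (near_shift 0); apply: filterS => h; rewrite /= subr0.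
  by apply: filterS2 ab0 => h abh; rewrite !fctE /= abh abz.
apply/diff_locallyP; rewrite (diff_unique ca dE); split => //.
Qed.

Lemma derive_is_linear a z : differentiable a z ->
  forall (k : R) u v, 'D_(k *: u + v) a z = k *: 'D_u a z + 'D_v a z.
Proof. by move=> da k u v; rewrite !deriveE // linearP. Qed.

Lemma derive_dirZ a z (k : R) v : differentiable a z ->
  'D_(k *: v) a z = k *: 'D_v a z.
Proof. by move=> da; rewrite !deriveE // linearZ. Qed.

Lemma derive_dirD a z u v : differentiable a z ->
  'D_(u + v) a z = 'D_u a z + 'D_v a z.
Proof. by move=> da; rewrite !deriveE // linearD. Qed.

Lemma derive_sum_dir a z (I : Type) (r : seq I) (P : pred I) (v : I -> V) :
  differentiable a z ->
  'D_(\sum_(i <- r | P i) v i) a z = \sum_(i <- r | P i) 'D_(v i) a z.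
Proof.
move=> da; rewrite deriveE // raddf_sum; apply: eq_bigr => i _.
by rewrite deriveE.
Qed.

Lemma Ck_near_eq k : forall a b z,
  (\forall z' \near z, a z' = b z') -> Ck k a z -> Ck k b z.
Proof.
elim: k => [|k IH] a b z /near_join ab.
  apply: filterS2 ab => z' ab' ca.
  rewrite /prop_for /continuous_at -(nbhs_singleton ab').
  by apply: cvg_trans ca; apply: near_eq_cvg.
case=> da dva; split.
  by apply: filterS2 ab da => z' ab' /=; apply: differentiable_near_eq.
move=> v; apply: IH (dva v); apply: filterS ab => z' ab'.
exact: near_eq_derive.
Qed.

Lemma CkS k : forall a z, Ck k.+1 a z -> Ck k a z.
Proof.
elim: k => [|k IH] a z [da dva].
  by apply: filterS da => z'; apply: differentiable_continuous.
by split=> // v; apply: IH; apply: dva.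
Qed.

Lemma Ck_continuous k a z : Ck k a z -> {for z, continuous a}.
Proof.
elim: k => [|k IH]; first by move=> ca; apply: (nbhs_singleton ca).
by move=> /CkS/IH.
Qed.

Lemma Ck_near_differentiable k a z : Ck k.+1 a z ->
  \forall z' \near z, differentiable a z'.
Proof. by case. Qed.

Lemma Ck_differentiable k a z : Ck k.+1 a z -> differentiable a z.
Proof. by case=> da _; apply: nbhs_singleton da. Qed.

Lemma Ck_derive k a z v : Ck k.+1 a z -> Ck k ('D_v a) z.
Proof. by case=> _ /(_ v). Qed.

Lemma Ck0_continuous a z : continuous a -> Ck 0 a z.
Proof. by move=> ca; apply: nearW => z'; apply: ca. Qed.

Lemma Ck_cst k (w : W) z : Ck k (fun=> w : W) (z : V).
Proof.
elim: k w z => [|k IH] w z; first by apply: nearW => z'; apply: cvg_cst.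
split; first by apply: nearW => z'; apply: differentiable_cst.
move=> v; rewrite (_ : 'D_v _ = fun=> (0 : W)) //.
by apply/funext => z'; apply: derive_cst.
Qed.

Lemma CkD k : forall a b z, Ck k a z -> Ck k b z -> Ck k (fun x => a x + b x) z.
Proof.
elim: k => [|k IH] a b z.
  by apply: filterS2 => z' ca cb; apply: continuousD.
case=> da dva [db dvb]; split.
  by apply: filterS2 da db => z'; apply: differentiableD.
move=> v; apply: Ck_near_eq (IH _ _ _ (dva v) (dvb v)).
apply: filterS2 da db => z' da db.
by rewrite -deriveD //; apply: diff_derivable.
Qed.

Lemma Ck_sum k (I : Type) (r : seq I) (P : pred I) (F : I -> V -> W) z :
  (forall i, P i -> Ck k (F i) z) -> Ck k (fun x => \sum_(i <- r | P i) F i x) z.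
Proof.
move=> cF; elim: r => [|i r IH].
  rewrite (_ : (fun x => _) = fun=> 0); first exact: Ck_cst.
  by apply/funext => x; rewrite big_nil.
case Pi: (P i).
  rewrite (_ : (fun x => _) = fun x => F i x + \sum_(i <- r | P i) F i x).
    by apply: CkD IH; apply: cF.
  by apply/funext => x; rewrite big_cons Pi.
rewrite (_ : (fun x => _) = fun x => \sum_(i <- r | P i) F i x) //.
by apply/funext => x; rewrite big_cons Pi.
Qed.

End diff.

Lemma Ck_id k (V : normedModType R) (z : V) : Ck k (fun x => x) z.
Proof.
case: k => [|k]; first by apply: Ck0_continuous => x; apply: cvg_id.
split=> [|v]; first by apply: (@nearW _ (nbhs z)) => x.
rewrite (_ : 'D_v _ = fun=> v); first exact: Ck_cst.
by apply/funext => x; rewrite derive_id.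
Qed.

Section post.
Variables V W W' : normedModType R.

Lemma derive_post (L : {linear W -> W'}) (a : V -> W) z v : continuous L ->
  differentiable a z -> 'D_v (fun x => L (a x)) z = L ('D_v a z).
Proof.
move=> cL da; have dL : differentiable L (a z) by exact: linear_differentiable.
have dLa : differentiable (L \o a) z by exact: differentiable_comp.
by rewrite [LHS](deriveE _ dLa) deriveE // diff_comp //= diff_lin.
Qed.

Lemma Ck_post k (L : {linear W -> W'}) : continuous L ->
  forall (a : V -> W) z, Ck k a z -> Ck k (fun x => L (a x)) z.
Proof.
move=> cL; elim: k => [|k IH] a z.
  by apply: filterS => z' ca; apply: (continuous_comp ca); apply: cL.
case=> da dva; split.
  apply: filterS da => z' da; apply: (differentiable_comp da).
  exact: linear_differentiable.
move=> v; apply: Ck_near_eq (IH _ _ (dva v)).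
by apply: filterS da => z' da; rewrite derive_post.
Qed.

Lemma derive_pre (L : {linear V -> W}) (a : W -> W') z v :
  'D_v (fun x => a (L x)) z = 'D_(L v) a (L z).
Proof.
rewrite /derive; set q := (X in lim (X @ _)); set q' := (X in _ = lim (X @ _)).
by rewrite (_ : q = q') //; apply/funext => t; rewrite /q /q' /= linearP.
Qed.

Lemma derive_affine_pre (L : {linear V -> W}) (w : W) (a : W -> W') z v :
  'D_v (fun x => a (w + L x)) z = 'D_(L v) a (w + L z).
Proof.
rewrite /derive; set q := (X in lim (X @ _)); set q' := (X in _ = lim (X @ _)).
by rewrite (_ : q = q') //; apply/funext => t; rewrite /q /q' /= linearP addrCA.
Qed.

Lemma Ck_pre k (L : {linear V -> W}) : continuous L ->
  forall (a : W -> W') z, Ck k a (L z) -> Ck k (fun x => a (L x)) z.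
Proof.
move=> cL; elim: k => [|k IH] a z.
  move=> ca; have Lca := cL z _ ca.
  apply: (@filterS _ (nbhs z) _ _ _ _ Lca) => z' ca'.
  by apply: (@continuous_comp _ _ _ L a z') => //; apply: cL.
case=> da dva; split.
  have Lda := cL z _ da.
  apply: (@filterS _ (nbhs z) _ _ _ _ Lda) => z' da'.
  apply: (@differentiable_comp _ _ _ _ L a) => //.
  exact: linear_differentiable.
move=> v; rewrite (_ : 'D_v _ = fun x => 'D_(L v) a (L x)).
  by apply: (IH ('D_(L v) a)); apply: dva.
by apply/funext => x; rewrite derive_pre.
Qed.

End post.

Section scalar.
Variables V : normedModType R.
Implicit Types a b : V -> R.

Lemma CkM k : forall a b z, Ck k a z -> Ck k b z -> Ck k (fun x => a x * b x) z.
Proof.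
elim: k => [|k IH] a b z.
  by apply: filterS2 => z' ca cb; apply: continuousM.
move=> cka ckb; have [da dva] := cka; have [db dvb] := ckb; split.
  by apply: filterS2 da db => z'; apply: differentiableM.
move=> v; have C1 := IH _ _ _ (CkS cka) (dvb v).
have C2 := IH _ _ _ (CkS ckb) (dva v).
apply: Ck_near_eq (CkD C1 C2); near=> z'.
by rewrite [RHS]deriveM //; apply: diff_derivable; near: z'.
Unshelve. all: by end_near. Qed.

End scalar.
End Ck_domain.

(** * C^k maps and row vectors *)

Section finite_dimension.
Context {R : realType}.

Definition entry m n (i : 'I_m) (j : 'I_n) (M : 'M[R]_(m, n)) : R := M i j.

Fact entry_is_linear m n (i : 'I_m) (j : 'I_n) : linear (entry i j).
Proof. by move=> k u v; rewrite /entry !mxE. Qed.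

HB.instance Definition _ m n (i : 'I_m) (j : 'I_n) :=
  GRing.isLinear.Build R 'M[R]_(m, n) R _ (entry i j) (@entry_is_linear m n i j).

Lemma entry_continuous m n (i : 'I_m) (j : 'I_n) : continuous (entry i j).
Proof. exact: coord_continuous. Qed.

Lemma mx_entry_le m n (M : 'M[R]_(m, n)) i j : `|M i j| <= `|M|.
Proof.
rewrite [leRHS]/Num.Def.normr/= mx_normrE.
exact: (le_bigmax _ (fun ij : 'I_m * 'I_n => `|M ij.1 ij.2|) (i, j)).
Qed.

Lemma mx_norm_le m n (M : 'M[R]_(m, n)) (e : R) : 0 <= e ->
  (forall i j, `|M i j| <= e) -> `|M| <= e.
Proof.
move=> e0 Me; rewrite [leLHS]/Num.Def.normr/= mx_normrE.
by apply: bigmax_le => // -[i j] _; apply: Me.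
Qed.

Lemma rV_linear_continuous N (W : normedModType R)
  (L : {linear 'rV[R]_N -> W}) : continuous L.
Proof.
move=> z.
have LE : (L : _ -> _) = fun x => \sum_i entry 0 i x *: L (delta_mx 0 i).
  apply/funext => x; rewrite {1}(row_sum_delta x) linear_sum.
  by apply: eq_bigr => i _; rewrite linearZ.
have : Ck 0 (fun x => \sum_i entry 0 i x *: L (delta_mx 0 i)) z.
  apply: Ck_sum => i _; apply: Ck0_continuous => z'.
  by apply: (@cvgZr_tmp _ _ _ (nbhs z') _ (entry 0 i)); apply: entry_continuous.
by rewrite -LE => /Ck_continuous.
Qed.

Lemma derive_rV N (W : normedModType R) (a : 'rV[R]_N -> W) z v :
  differentiable a z -> 'D_v a z = \sum_i v 0 i *: 'D_(delta_mx 0 i) a z.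
Proof.
move=> da; rewrite {1}(row_sum_delta v) derive_sum_dir //.
by apply: eq_bigr => i _; rewrite !deriveE // linearZ.
Qed.

Lemma derive_entry (V : normedModType R) m n (a : V -> 'M[R]_(m, n)) z v i j :
  differentiable a z -> 'D_v a z i j = 'D_v (fun x => a x i j) z.
Proof.
move=> da; rewrite derive_mx ?mxE //; exact: diff_derivable.
Qed.

Lemma Ck_entry (V : normedModType R) k m n (a : V -> 'M[R]_(m, n)) z i j :
  Ck k a z -> Ck k (fun x => a x i j) z.
Proof. exact: (@Ck_post _ _ _ _ k (entry i j) (@entry_continuous _ _ i j) a z). Qed.

Lemma CkZl (V W : normedModType R) k (c : V -> R) (w : W) z :
  Ck k c z -> Ck k (fun x => c x *: w) z.
Proof.
have sl : linear ( *:%R^~ w : R -> W).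
  by move=> t u v; rewrite scalerDl scalerA.
pose sL := GRing.isLinear.Build _ _ _ _ _ sl.
pose L : {linear R -> W} := HB.pack ( *:%R ^~ w : R -> W) sL.
apply: (@Ck_post _ _ _ _ k L).
exact: scalel_continuous.
Qed.

Lemma Ck_rV (V : normedModType R) k P (a : V -> 'rV[R]_P) z :
  (forall j, Ck k (fun x => a x 0 j) z) -> Ck k a z.
Proof.
move=> ca.
rewrite (_ : a = fun x => \sum_j a x 0 j *: delta_mx 0 j); last first.
  by apply/funext => x; apply: row_sum_delta.
by apply: Ck_sum => j _; apply: CkZl.
Qed.

(** A finite basis of directions controls all of them, so only finitely many
    neighbourhoods have to be intersected. *)
Lemma Ck_near N (W : normedModType R) k : forall (a : 'rV[R]_N -> W) z,
  Ck k a z -> \forall z' \near z, Ck k a z'.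
Proof.
elim: k => [|k IH] a z; first by move=> /near_join.
move=> [/near_join da dva].
have dvai : \forall z' \near z, forall i, Ck k ('D_(delta_mx 0 i) a) z'.
  apply: (@filter_forall _ _ (fun i z' => Ck k ('D_(delta_mx 0 i) a) z') (nbhs z)).
  by move=> i; apply: IH (dva _).
apply: filterS2 da dvai => z' da dva'; split=> [//|v].
apply: (@Ck_near_eq _ _ _ k (fun x => \sum_i v 0 i *: 'D_(delta_mx 0 i) a x)).
  by apply: filterS da => x dax; rewrite -derive_rV.
apply: Ck_sum => i _.
by apply: (@Ck_post _ _ _ _ k ( *:%R (v 0 i))) => //; apply: scaler_continuous.
Qed.

Lemma derive_comp_rV (V : normedModType R) N (b : V -> 'rV[R]_N)
    (a : 'rV[R]_N -> R) z v : differentiable b z -> differentiable a (b z) ->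
  'D_v (fun x => a (b x)) z =
    \sum_i 'D_v (fun x => b x 0 i) z * 'D_(delta_mx 0 i) a (b z).
Proof.
move=> db da; rewrite [LHS](deriveE _ (differentiable_comp db da)) diff_comp //.
rewrite /= -!deriveE // derive_rV //.
by apply: eq_bigr => i _; rewrite derive_entry.
Qed.

(** The chain rule writes ['D_v (a \o b)] as a sum of products of ['D_v b_i]
    and [('D_(e_i) a) \o b], which are C^k when [a] and [b] are C^(k+1). *)
Lemma Ck_comp1 (V : normedModType R) N k : forall (b : V -> 'rV[R]_N)
  (a : 'rV[R]_N -> R) z, Ck k b z -> Ck k a (b z) -> Ck k (fun x => a (b x)) z.
Proof.
elim: k => [|k IH] b a z.
  move=> cb ca; have cab := nbhs_singleton cb _ ca.
  have : \forall z' \near z, {for b z', continuous a} by exact: cab.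
  apply: filterS2 cb => z' cbz caz.
  by apply: (@continuous_comp _ _ _ b a z').
move=> ckb cka; have [db dvb] := ckb; have [da dva] := cka.
have cb : b x @[x --> z] --> b z by exact: Ck_continuous ckb.
have dab : \forall z' \near z, differentiable a (b z') by exact: cb da.
split.
  apply: filterS2 db dab => z' dbz daz.
  exact: (@differentiable_comp _ _ _ _ b a).
move=> v.
apply: (@Ck_near_eq _ _ _ k (fun x =>
   \sum_i 'D_v (fun x => b x 0 i) x * 'D_(delta_mx 0 i) a (b x))).
  by apply: filterS2 db dab => z' dbz daz; rewrite -derive_comp_rV.
apply: Ck_sum => i _; apply: CkM.
  by apply: Ck_derive; apply: Ck_entry.
by apply: (IH b ('D_(delta_mx 0 i) a)); [apply: CkS | apply: dva].
Qed.

Lemma Ck_comp (V : normedModType R) N P k (b : V -> 'rV[R]_N)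
  (a : 'rV[R]_N -> 'rV[R]_P) z :
  Ck k b z -> Ck k a (b z) -> Ck k (fun x => a (b x)) z.
Proof.
move=> cb ca; apply: Ck_rV => j.
by apply: (@Ck_comp1 _ _ k b (fun y => a y 0 j)) => //; apply: Ck_entry.
Qed.

Lemma Ck_row_mx (V : normedModType R) k P Q (a : V -> 'rV[R]_P)
    (b : V -> 'rV[R]_Q) z :
  Ck k a z -> Ck k b z -> Ck k (fun x => row_mx (a x) (b x)) z.
Proof.
move=> ca cb; apply: Ck_rV => j; case: (split_ordP j) => i ->.
  rewrite (_ : (fun x => _) = fun x => a x 0 i); first exact: Ck_entry.
  by apply/funext => x; rewrite row_mxEl.
rewrite (_ : (fun x => _) = fun x => b x 0 i); first exact: Ck_entry.
by apply/funext => x; rewrite row_mxEr.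
Qed.

Lemma Ck_linear N (W : normedModType R) k (L : {linear 'rV[R]_N -> W}) z :
  Ck k L z.
Proof.
have cL := @rV_linear_continuous _ _ L.
elim: k => [|k IH]; first exact: Ck0_continuous.
split; first by apply: (@nearW _ (nbhs z)) => z'; apply: linear_differentiable.
move=> v; rewrite (_ : 'D_v L = fun=> L v); first exact: Ck_cst.
apply/funext => z'; rewrite deriveE; last exact: linear_differentiable.
by rewrite diff_lin.
Qed.

End finite_dimension.

(** * Mean values and strict differentiability *)

(* Joins the norm and the completeness of matrices, both of which the fixed
   point theorem requires. *)
HB.instance Definition _ (R : realType) m n := NormedModule.on 'M[R]_(m, n).

Section mean_value.
Context {R : realType}.
Implicit Types V W : normedModType R.

Lemma near_normP V (z : V) (P : V -> Prop) :
  (\forall x \near z, P x) <->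
  exists2 d : R, 0 < d & forall x, `|x - z| < d -> P x.
Proof.
split=> [/nbhs_normP[d d0 Pd]|[d d0 Pd]].
  by exists d => // x xz; apply: Pd; rewrite /ball_ /= distrC.
by apply/nbhs_normP; exists d => // x; rewrite /ball_ /= distrC; apply: Pd.
Qed.

Lemma continuous_normP V W (a : V -> W) (z : V) :
  {for z, continuous a} <-> forall e : R, 0 < e ->
  exists2 d : R, 0 < d & forall x, `|x - z| < d -> `|a x - a z| <= e.
Proof.
split=> [/cvgrPdist_le ca e /ca /near_normP[d d0 H]|H].
  by exists d => // x /H; rewrite distrC.
apply/cvgrPdist_le => e /H[d d0 {}H]; apply/near_normP; exists d => // x /H.
by rewrite distrC.
Qed.

Lemma diff_estimate V W (a : V -> W) z : differentiable a z ->
  forall e : R, 0 < e -> exists2 d : R, 0 < d &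
    forall h, `|h| < d -> `|a (z + h) - a z - 'D_h a z| <= e * `|h|.
Proof.
move=> da e e0.
have [_ /eqaddoP/(_ e e0)/near_normP[d d0 H]] := (diff_locallyP z a).1 da.
exists d => // h hd; have := H h; rewrite subr0 => /(_ hd).
by rewrite !fctE /= opprD addrA [h + z]addrC -deriveE.
Qed.

Lemma is_derive_line V W (a : V -> W) (z v : V) (t : R) :
  differentiable a (z + t *: v) ->
  is_derive t 1 (fun t => a (z + t *: v)) ('D_v a (z + t *: v)).
Proof.
move=> da.
have sl : linear ( *:%R^~ v : R -> V).
  by move=> k u u'; rewrite scalerDl scalerA.
pose sL := GRing.isLinear.Build _ _ _ _ _ sl.
pose L : {linear R -> V} := HB.pack ( *:%R ^~ v : R -> V) sL.
have cL : continuous L by exact: scalel_continuous.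
apply: DeriveDef; last by rewrite (derive_affine_pre L) /= scale1r.
apply: diff_derivable.
apply: (@differentiable_comp _ _ _ _ (fun t => z + L t) a) => //.
Qed.

Lemma mean_value_line V (phi : V -> R) (z v : V) :
  (forall t : R, 0 <= t <= 1 -> differentiable phi (z + t *: v)) ->
  exists2 t : R, 0 < t < 1 & phi (z + v) - phi z = 'D_v phi (z + t *: v).
Proof.
move=> dphi.
have [||t t01] := @MVT R (fun t => phi (z + t *: v))
  (fun t => 'D_v phi (z + t *: v)) 0 1 ltr01.
- move=> t; rewrite in_itv /= => /andP[t0 t1]; apply: is_derive_line.
  by apply: dphi; rewrite !ltW.
- apply: derivable_within_continuous => t; rewrite in_itv /= => t01.
  by have [] := is_derive_line (dphi t t01).
rewrite scale1r scale0r addr0 subr0 mulr1 => E; exists t => //.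
Qed.

End mean_value.

Section strict_differentiability.
Context {R : realType}.

(** Unlike plain differentiability, strict differentiability estimates [a] on
    pairs of points, as the contraction arguments below need.  The derivative
    is a matrix acting on row vectors, like ['J]. *)
Definition strict_diff N P (a : 'rV[R]_N -> 'rV[R]_P) (z : 'rV[R]_N)
    (A : 'M[R]_(N, P)) : Prop :=
  forall e : R, 0 < e -> exists2 d : R, 0 < d & forall x y,
    `|x - z| < d -> `|y - z| < d -> `|a x - a y - (x - y) *m A| <= e * `|x - y|.

Lemma mulmx_norm_le m n p (M : 'M[R]_(m, n)) (A : 'M[R]_(n, p)) :
  `|M *m A| <= n%:R * `|M| * `|A|.
Proof.
apply: mx_norm_le => [|i j]; first by rewrite !mulr_ge0.
rewrite mxE (le_trans (ler_norm_sum _ _ _)) //.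
have -> : n%:R * `|M| * `|A| = \sum_(k < n) `|M| * `|A|.
  by rewrite sumr_const card_ord -[RHS]mulr_natl mulrA.
by apply: ler_sum => k _; rewrite normrM ler_pM // mx_entry_le.
Qed.


Lemma segment_norm_lt (V : normedModType R) (x y z : V) (t d : R) :
  0 <= t <= 1 -> `|x - z| < d -> `|y - z| < d ->
  `|y + t *: (x - y) - z| < d.
Proof.
move=> /andP[t0 t1] xd yd.
have -> : y + t *: (x - y) - z = t *: (x - z) + (1 - t) *: (y - z).
  rewrite addrAC scalerBl scale1r.
  rewrite (_ : x - y = (x - z) - (y - z)); last by rewrite opprB addrA subrK.
  by rewrite scalerBr addrCA.
rewrite (le_lt_trans (ler_normD _ _)) // !normrZ !ger0_norm ?subr_ge0 //.
have [->|t0'] := eqVneq t 0; first by rewrite mul0r add0r subr0 mul1r.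
have tp : 0 < t by rewrite lt_neqAle eq_sym t0'.
have -> : d = t * d + (1 - t) * d by ring.
by rewrite ltr_leD ?ltr_pM2l // ler_wpM2l ?subr_ge0 // ltW.
Qed.

(** The derivatives in the basis directions are continuous and determine all
    others, with a loss of a factor [N]. *)
Lemma Ck1_derive_close N P (a : 'rV[R]_N -> 'rV[R]_P) z : Ck 1 a z ->
  forall e : R, 0 < e -> exists2 d : R, 0 < d & forall x, `|x - z| < d ->
    differentiable a x /\ forall v, `|'D_v a x - 'D_v a z| <= e * `|v|.
Proof.
move=> C1a e e0.
have [da dva] := C1a.
pose e' := e / N.+1%:R.
have e'0 : 0 < e' by rewrite divr_gt0.
have H1 : \forall x \near z, forall i,
    `|'D_(delta_mx 0 i) a z - 'D_(delta_mx 0 i) a x| <= e'.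
  apply: (@filter_forall _ _ (fun i x => `|'D_(delta_mx 0 i) a z - 'D_(delta_mx 0 i) a x| <= e') (nbhs z)) => i.
  have /cvgrPdist_le := nbhs_singleton (dva (delta_mx 0 i)).
  exact.
have /near_normP[d d0 dP] : \forall x \near z, differentiable a x /\
    forall i, `|'D_(delta_mx 0 i) a z - 'D_(delta_mx 0 i) a x| <= e'.
  exact: filterI.
exists d => // x /dP[dax Dx]; split=> // v.
rewrite !derive_rV //; last exact: nbhs_singleton da.
rewrite -sumrB (le_trans (ler_norm_sum _ _ _)) //.
have -> : e * `|v| = \sum_(i < N.+1) `|v| * e'.
  by rewrite sumr_const card_ord -mulr_natr /e'; field.
rewrite big_ord_recr /= -[leLHS]addr0 lerD //; last by rewrite mulr_ge0 // ltW.
apply: ler_sum => k _.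
by rewrite -scalerBr normrZ ler_pM // ?mx_entry_le // distrC.
Qed.

(** The mean value theorem on the segment from [y] to [x], in each component. *)
Lemma Ck1_strict_diff N P (a : 'rV[R]_N -> 'rV[R]_P) z :
  Ck 1 a z -> strict_diff a z ('J a z).
Proof.
move=> C1a e e0.
have [d d0 dP] := Ck1_derive_close C1a e0.
exists d => // x y xd yd.
apply: mx_norm_le => [|i j]; first by rewrite mulr_ge0 // ltW.
rewrite ord1 {i}.
have [t|t t01] := @mean_value_line _ _ (fun x => a x 0 j) y (x - y).
  move=> t01; have [dat _] := dP _ (segment_norm_lt t01 xd yd).
  apply: (@differentiable_comp _ _ _ _ a (fun M : 'rV_P => M 0 j : R)) => //.
  exact: differentiable_coord.
have t01' : 0 <= t <= 1 by case/andP: t01 => ? ?; rewrite !ltW.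
have [dat Dt] := dP _ (segment_norm_lt t01' xd yd).
rewrite subrKC -derive_entry // => E.
have -> : (a x - a y - (x - y) *m 'J a z) 0 j =
    ('D_(x - y) a (y + t *: (x - y)) - 'D_(x - y) a z) 0 j.
  by rewrite [RHS]mxE -E -deriveEjacobian ?mxE ?mxE //; apply: Ck_differentiable C1a.
exact: le_trans (mx_entry_le _ _ _) (Dt _).
Qed.

Lemma strict_diff_lipschitz N P (a : 'rV[R]_N -> 'rV[R]_P) z A :
  strict_diff a z A -> exists2 k : R, 0 < k & exists2 d : R, 0 < d &
    forall x y, `|x - z| < d -> `|y - z| < d -> `|a x - a y| <= k * `|x - y|.
Proof.
move=> /(_ 1 ltr01)[d d0 Hd]; exists (1 + N%:R * `|A|).
  by rewrite ltr_pwDl // mulr_ge0.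
exists d => // x y xd yd.
rewrite -(subrK ((x - y) *m A) (a x - a y)) mulrDl.
rewrite (le_trans (ler_normD _ _)) // lerD //; first exact: Hd.
by rewrite (le_trans (mulmx_norm_le _ _)) // mulrAC.
Qed.

End strict_differentiability.

Section newton.
Context {R : realType}.

(** [c |-> c - Psi c] contracts the ball of radius [2 * `|Psi 0|] into itself;
    its fixed point is the zero. *)
Lemma approximate_identity_zero P (Psi : 'rV[R]_P -> 'rV[R]_P) (rho : R) :
  (forall c c', `|c| <= rho -> `|c'| <= rho ->
     `|Psi c - Psi c' - (c - c')| <= 2^-1 * `|c - c'|) ->
  2 * `|Psi 0| <= rho ->
  exists2 c, `|c| <= 2 * `|Psi 0| & Psi c = 0.
Proof.
move=> Psi_contr Psi0.
pose U : set 'rV[R]_P := [set c | `|c| <= 2 * `|Psi 0|].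
have rho0 : 0 <= rho by apply: le_trans Psi0; rewrite mulr_ge0.
pose T c := c - Psi c.
have TE c c' : T c - T c' = - (Psi c - Psi c' - (c - c')).
  rewrite /T [RHS]opprB !opprB -!addrA; congr (c + _).
  by rewrite addrC addrAC [RHS]addrC.
have Tc c c' : U c -> U c' -> `|T c - T c'| <= 2^-1 * `|c - c'|.
  rewrite /U /= => Uc Uc'; rewrite TE normrN; apply: Psi_contr.
    exact: le_trans Psi0.
  exact: le_trans Psi0.
have U0 : U 0 by rewrite /U /= normr0 mulr_ge0.
have TU : set_fun U U T.
  move=> c Uc; have := Tc c 0 Uc U0.
  rewrite {2}/T sub0r opprK subr0 => TcP.
  rewrite /U /= -(addrK (Psi 0) (T c)) (le_trans (ler_normD _ _)) // normrN.
  move: Uc TcP; rewrite /U /=; set p0 := `|Psi 0|; set c0 := `|c|.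
  set x := `| _ + _|; lra.
pose fT := isFun.Build _ _ U U T TU.
pose fT' : {fun U >-> U} := HB.pack T fT.
have cT : is_contraction fT'.
  exists (2^-1)%:nng; split => /=; first by lra.
  by move=> [c c'] [/= Uc Uc']; apply: Tc.
have clU : closed U.
  apply: (@preimage_closed _ _ (fun c : 'rV[R]_P => `|c|) [set x | x <= 2 * `|Psi 0|]).
    by move=> x _; apply: norm_continuous.
  exact: closed_le.
have [|c Uc cE] := banach_fixed_point cT clU; first by exists 0.
exists c => //; move/eqP: cE; rewrite /= /T eq_sym subr_eq addrC -subr_eq subrr.
by move/eqP.
Qed.

End newton.

(** * Solving equations near an approximate solution *)

Section corrections.
Context {R : realType}.

Lemma norm_row_mx_le m n1 n2 (a : 'M[R]_(m, n1)) (b : 'M[R]_(m, n2)) e :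
  `|a| <= e -> `|b| <= e -> `|row_mx a b| <= e.
Proof.
move=> ae be; apply: mx_norm_le => [|i j]; first exact: le_trans ae.
case: (split_ordP j) => k ->; rewrite ?row_mxEl ?row_mxEr.
  exact: le_trans (mx_entry_le _ _ _) ae.
exact: le_trans (mx_entry_le _ _ _) be.
Qed.

(** Graves' theorem: [B] is a right inverse of the derivative, so [c |-> a (x
    + c *m B) - a z] is a perturbation of the identity, and its zero gives a
    correction of [x] of the order of the defect [a x - a z]. *)
Lemma strict_diff_correction N P (a : 'rV[R]_N -> 'rV[R]_P) z
    (A : 'M[R]_(N, P)) (B : 'M[R]_(P, N)) :
  strict_diff a z A -> B *m A = 1%:M ->
  exists2 k : R, 0 < k & exists2 d : R, 0 < d & forall x, `|x - z| < d ->
    exists2 x', `|x' - x| <= k * `|a x - a z| & a x' = a z.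
Proof.
move=> sa BA.
pose b : R := P%:R * `|B| + 1.
have b0 : 0 < b by rewrite ltr_pwDr // mulr_ge0.
have Bb (c : 'rV[R]_P) : `|c *m B| <= b * `|c|.
  apply: le_trans (mulmx_norm_le _ _) _.
  by rewrite mulrAC ler_wpM2r // lerDl.
have [|d1 d10 sad] := sa (2^-1 / b); first by rewrite divr_gt0.
have [k k0 [d2 d20 la]] := strict_diff_lipschitz sa.
pose rho : R := d1 / 2 / b.
have rho0 : 0 < rho by rewrite !divr_gt0.
pose d3 := Num.min (d1 / 2) d2; pose d := Num.min d3 (rho / (2 * k)).
exists (b * 2); first by rewrite mulr_gt0.
exists d.
  by rewrite /d /d3 !lt_min d20 !divr_gt0 // mulr_gt0.
move=> x; rewrite /d /d3 !lt_min -andbA => /and3P[xd1 xd2 xd].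
pose Psi c := a (x + c *m B) - a z.
have near_z c : `|c| <= rho -> `|x + c *m B - z| < d1.
  move=> cr; rewrite addrAC (le_lt_trans (ler_normD _ _)) //.
  have : `|c *m B| <= d1 / 2.
    apply: le_trans (Bb c) _; rewrite mulrC -ler_pdivlMr //.
  lra.
have [c c' cr cr'||c cb cE] := @approximate_identity_zero R P Psi rho.
- rewrite /Psi opprB addrA subrK.
  have -> : c - c' = (x + c *m B - (x + c' *m B)) *m A.
    by rewrite opprD addrACA subrr add0r -mulmxBl -mulmxA BA mulmx1.
  apply: le_trans (sad _ _ (near_z _ cr) (near_z _ cr')) _.
  rewrite opprD addrACA subrr add0r -mulmxBl -mulmxA BA mulmx1.
  rewrite -mulrA ler_wpM2l // mulrC ler_pdivrMr // mulrC; exact: Bb.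
- rewrite /Psi mul0mx addr0.
  have := la x z xd2; rewrite subrr normr0 => /(_ d20) H.
  rewrite (@le_trans _ _ (2 * (k * `|x - z|))) // ?ler_pM2l //.
  by rewrite mulrA mulrC -ler_pdivlMr ?mulr_gt0 // ltW.
exists (x + c *m B).
  rewrite addrAC subrr add0r (le_trans (Bb c)) // -mulrA ler_pM2l //.
  by move: cb; rewrite /Psi mul0mx addr0.
by move/eqP: cE; rewrite /Psi subr_eq0 => /eqP.
Qed.

End corrections.

Section implicit_function.
Context {R : realType} {n N : nat}.
Implicit Types (K : 'rV[R]_(n + N) -> 'rV[R]_N).

(** With [B] the inverse of the partial derivative, [c |-> K (row_mx x (v0 + c
    *m B))] is a perturbation of the identity for each [x] near [x0].
    Comparing the zeros at two parameters by the same contraction estimate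
    gives continuity at every nearby [x], which the differentiability of [v]
    around [x0] requires. *)
Lemma implicit_function_exists K x0 v0 A :
  strict_diff K (row_mx x0 v0) A -> dsubmx A \in unitmx ->
  K (row_mx x0 v0) = 0 ->
  exists v, [/\ v x0 = v0, \forall x \near x0, K (row_mx x (v x)) = 0 &
    \forall x \near x0, {for x, continuous v}].
Proof.
move=> sK uA K0; set u0 := row_mx x0 v0 in sK K0.
pose B := invmx (dsubmx A).
pose b : R := N%:R * `|B| + 1.
have b0 : 0 < b by rewrite ltr_pwDr // mulr_ge0.
have Bb (c : 'rV[R]_N) : `|c *m B| <= b * `|c|.
  apply: le_trans (mulmx_norm_le _ _) _.
  by rewrite mulrAC ler_wpM2r // lerDl.
have [|d1 d10 sKd] := sK (2^-1 / b); first by rewrite divr_gt0.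
have [k k0 [d2 d20 lK]] := strict_diff_lipschitz sK.
pose rho : R := Num.min d1 d2 / 2 / b.
have d120 : 0 < Num.min d1 d2 by rewrite lt_min d10.
have rho0 : 0 < rho by rewrite !divr_gt0.
pose d := Num.min (Num.min d1 d2) (rho / (2 * k)).
have d0 : 0 < d by rewrite /d lt_min d120 divr_gt0 // mulr_gt0.
have near_u x c : `|x - x0| < d -> `|c| <= rho ->
    `|row_mx x (v0 + c *m B) - u0| < Num.min d1 d2.
  rewrite /d lt_min => /andP[xd _] cr; rewrite opp_row_mx add_row_mx addrAC subrr add0r.
  apply: (@le_lt_trans _ _ (Num.max `|x - x0| (Num.min d1 d2 / 2))).
    apply: norm_row_mx_le; first by rewrite le_max lexx.
    rewrite le_max; apply/orP; right.
    by rewrite (le_trans (Bb c)) // mulrC -ler_pdivlMr.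
  by rewrite gt_max xd /= ltr_pdivrMr // ltr_pMr // ltr1n.
pose Psi x c := K (row_mx x (v0 + c *m B)).
have PsiL x c c' : `|x - x0| < d -> `|c| <= rho -> `|c'| <= rho ->
    `|Psi x c - Psi x c' - (c - c')| <= 2^-1 * `|c - c'|.
  move=> xd cr cr'; have := near_u x c xd cr; have := near_u x c' xd cr'.
  rewrite !lt_min => /andP[u1 _] /andP[u2 _].
  have E : row_mx x (v0 + c *m B) - row_mx x (v0 + c' *m B) = row_mx 0 ((c - c') *m B).
    by rewrite opp_row_mx add_row_mx subrr opprD addrACA subrr add0r mulmxBl.
  have := sKd _ _ u2 u1; rewrite E.
  rewrite -[A in row_mx _ _ *m A]vsubmxK mul_row_col mul0mx add0r -mulmxA mulVmx //.
  rewrite mulmx1 => /le_trans; apply; rewrite -mulrA ler_wpM2l // mulrC ler_pdivrMr //.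
  apply: norm_row_mx_le; first by rewrite normr0 mulr_ge0 // ltW.
  by rewrite mulrC.
have Psi0 x : `|x - x0| < d -> 2 * `|Psi x 0| <= rho.
  move=> xd; have := near_u x 0 xd; rewrite normr0 => /(_ (ltW rho0)).
  rewrite lt_min => /andP[_ u2]; have := lK _ u0 u2.
  rewrite subrr normr0 K0 subr0 => /(_ d20); rewrite -/(Psi x 0).
  rewrite opp_row_mx add_row_mx mul0mx addr0 subrr => H.
  have H' : `|row_mx (x - x0) (0 : 'rV[R]_N)| <= `|x - x0|.
    by apply: norm_row_mx_le; rewrite ?normr0.
  rewrite (@le_trans _ _ (2 * (k * `|x - x0|))) //.
    by rewrite ler_pM2l // (le_trans H) // ler_pM2l.
  rewrite mulrA mulrC -ler_pdivlMr ?mulr_gt0 // ltW //.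
  by move: xd; rewrite /d lt_min => /andP[].
have /choice[c cP] : forall x, exists c, `|x - x0| < d ->
    [/\ `|c| <= rho, `|c| <= 2 * `|Psi x 0| & Psi x c = 0].
  move=> x; have [xd|] := boolP (`|x - x0| < d); last by exists 0.
  have [c cb cE] := approximate_identity_zero (fun c c' => PsiL x c c' xd) (Psi0 x xd).
  by exists c => _; split => //; apply: le_trans cb (Psi0 x xd).
exists (fun x => v0 + c x *m B); split.
- have [|_ c0 _] := cP x0; first by rewrite subrr normr0.
  have : `|c x0| <= 0 by move: c0; rewrite /Psi mul0mx addr0 K0 normr0 mulr0.
  by rewrite normr_le0 => /eqP ->; rewrite mul0mx addr0.
- by apply/near_normP; exists d => // x /cP[].
apply/near_normP; exists d => // x xd.
apply/continuous_normP => e e0.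
pose e' := e / (b * 2 * k).
have e'0 : 0 < e' by rewrite divr_gt0 // !mulr_gt0.
exists (Num.min e' (d - `|x - x0|)); first by rewrite lt_min e'0 subr_gt0.
move=> x'; rewrite lt_min => /andP[/ltW x'e x'd0].
have x'd : `|x' - x0| < d.
  rewrite -(subrK x x') -addrA (le_lt_trans (ler_normD _ _)) //.
  by rewrite -ltrBrDr.
rewrite distrC.
have [cr _ Pc] := cP x xd; have [cr' _ Pc'] := cP x' x'd.
rewrite opprD addrACA subrr add0r -mulmxBl (le_trans (Bb _)) //.
have : `|c x - c x'| <= 2 * (k * e').
  have H1 := PsiL x' _ _ x'd cr cr'.
  have H2 : `|Psi x' (c x)| <= k * e'.
    have := near_u x' _ x'd cr; have := near_u x _ xd cr.
    rewrite !lt_min => /andP[_ u2] /andP[_ u2'].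
    have := lK _ _ u2' u2; rewrite -/(Psi x (c x)) Pc subr0 => /le_trans; apply.
    rewrite ler_pM2l // opp_row_mx add_row_mx subrr.
    by apply: norm_row_mx_le => //; rewrite normr0 ltW.
  rewrite Pc' subr0 distrC in H1.
  have := ler_normD (c x - c x' - Psi x' (c x)) (Psi x' (c x)).
  rewrite subrK; move: H1 H2.
  set w := `|_ - Psi _ _|; set w' := `|c x - _|; set w'' := `|Psi _ _|; lra.
move=> H; rewrite (@le_trans _ _ (b * (2 * (k * e')))) ?ler_pM2l //.
by rewrite /e' le_eqVlt; apply/orP; left; apply/eqP; field; rewrite !gt_eqF.
Qed.

End implicit_function.

(** * Smoothness of implicit functions *)

Section frechet.
Context {R : realType} {N P : nat}.
Implicit Types (a : 'rV[R]_N -> 'rV[R]_P).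

Lemma diff_of_estimate a z (A : 'M[R]_(N, P)) :
  (forall e : R, 0 < e -> exists2 d : R, 0 < d &
    forall h, `|h| < d -> `|a (z + h) - a z - h *m A| <= e * `|h|) ->
  differentiable a z.
Proof.
move=> H.
have cA : continuous (mulmxr A : 'rV[R]_N -> 'rV[R]_P).
  exact: rV_linear_continuous.
have dE : a \o shift z = cst (a z) + mulmxr A +o_ 0 id.
  apply/eqaddoP => e /H[d d0 Hd].
  apply/(@near_normP R 'rV[R]_N 0); exists d => // h.
  by rewrite subr0 => /Hd; rewrite !fctE /= opprD addrA [h + z]addrC.
apply/diff_locallyP; rewrite (diff_unique cA dE); split=> //.
Qed.

End frechet.

Section determinant.
Context {R : realType}.
Variable V : normedModType R.

Lemma Ck_prod k (I : Type) (r : seq I) (F : I -> V -> R) z :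
  (forall i, Ck k (F i) z) -> Ck k (fun x => \prod_(i <- r) F i x) z.
Proof.
move=> cF; elim: r => [|i r IH].
  rewrite (_ : (fun x => _) = fun=> 1); first exact: Ck_cst.
  by apply/funext => x; rewrite big_nil.
rewrite (_ : (fun x => _) = fun x => F i x * \prod_(i <- r) F i x).
  exact: CkM.
by apply/funext => x; rewrite big_cons.
Qed.

Lemma Ck_det k N (M : V -> 'M[R]_N) z :
  (forall i j, Ck k (fun x => M x i j) z) -> Ck k (fun x => \det (M x)) z.
Proof.
move=> cM; apply: Ck_sum => s _; apply: CkM; first exact: Ck_cst.
exact: Ck_prod.
Qed.

Lemma near_unitmx N (M : V -> 'M[R]_N) z :
  (forall i j, Ck 0 (fun x => M x i j) z) -> M z \in unitmx ->
  \forall x \near z, M x \in unitmx.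
Proof.
move=> cM; rewrite unitmxE unitfE => dM.
have /continuous_normP H := Ck_continuous (Ck_det cM).
have [|d d0 {}H] := H (`|\det (M z)| / 2); first by rewrite divr_gt0 ?normr_gt0.
apply/near_normP; exists d => // x /H; rewrite unitmxE unitfE.
move=> H'; apply/eqP => Mx0; move: H'; rewrite Mx0 sub0r normrN.
by have := dM; rewrite -normr_gt0; set w := `|_|; lra.
Qed.

(** Cramer's rule. *)
Lemma Ck0_invmx N (M : V -> 'M[R]_N) z :
  (forall i j, Ck 0 (fun x => M x i j) z) -> M z \in unitmx ->
  forall i j, Ck 0 (fun x => invmx (M x) i j) z.
Proof.
move=> cM uM i j; have uMx := near_unitmx cM uM.
have cadj : Ck 0 (fun x => \adj (M x) i j) z.
  rewrite (_ : (fun x => _) = fun x => (-1) ^+ (j + i) * \det (row' j (col' i (M x)))).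
    apply: CkM; first exact: Ck_cst.
    apply: Ck_det => i' j'.
    rewrite (_ : (fun x => _) = fun x => M x (lift j i') (lift i j')) //.
    by apply/funext => x; rewrite !mxE.
  by apply/funext => x; rewrite mxE.
have cinv : Ck 0 (fun x => (\det (M x))^-1) z.
  apply: filterS2 uMx (Ck_det cM) => x; rewrite unitmxE unitfE => dx cx.
  exact: cvgV.
apply: Ck_near_eq (CkM cinv cadj); apply: filterS uMx => x uMx.
by rewrite /invmx uMx [RHS]mxE.
Qed.

End determinant.

Section implicit_differentiability.
Context {R : realType} {n N : nat}.

Lemma derive_partial (K : 'rV[R]_(n + N) -> 'rV[R]_N) u (w : 'rV[R]_N) :
  differentiable K u -> 'D_(row_mx 0 w) K u = w *m dsubmx ('J K u).
Proof.
move=> dK; rewrite deriveEjacobian // -{1}['J K u]vsubmxK mul_row_col.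
by rewrite mul0mx add0r.
Qed.

(** Linearising [K = 0] between [x] and [x + h] and inverting the partial
    derivative gives [w = - h *m Jx *m B + o(`|h| + `|w|)] for the increment
    [w] of [v].  This first bounds [`|w|] by a multiple of [`|h|], which then
    turns the remainder into [o(`|h|)]. *)
Lemma implicit_differentiable (K : 'rV[R]_(n + N) -> 'rV[R]_N)
    (v : 'rV[R]_n -> 'rV[R]_N) x :
  differentiable K (row_mx x (v x)) ->
  dsubmx ('J K (row_mx x (v x))) \in unitmx ->
  (\forall x' \near x, K (row_mx x' (v x')) = 0) ->
  {for x, continuous v} -> differentiable v x.
Proof.
set u := row_mx x (v x) => dK uK K0 cv.
have Ku0 : K u = 0 by exact: nbhs_singleton K0.
pose B := invmx (dsubmx ('J K u)); pose Jx := usubmx ('J K u).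
pose b : R := N%:R * `|B| + 1.
have b0 : 0 < b by rewrite ltr_pwDr // mulr_ge0.
have Bb (c : 'rV[R]_N) : `|c *m B| <= b * `|c|.
  apply: le_trans (mulmx_norm_le _ _) _.
  by rewrite mulrAC ler_wpM2r // lerDl.
pose m := n%:R * `|Jx *m B|.
have m0 : 0 <= m by rewrite mulr_ge0.
have Jm (h : 'rV[R]_n) : `|h *m (Jx *m B)| <= m * `|h|.
  by apply: le_trans (mulmx_norm_le _ _) _; rewrite mulrAC.
apply: (@diff_of_estimate _ _ _ v x (- (Jx *m B))) => e e0.
pose e1 := Num.min (2^-1 / b) (e / (b * (2 * m + 2))).
have m2 : 0 < 2 * m + 2 by lra.
have e10 : 0 < e1 by rewrite /e1 lt_min !divr_gt0 // mulr_gt0.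
have [d d0 Kd] := diff_estimate dK e10.
have [d1 d10 K0d] := (near_normP _ _).1 K0.
have [d2 d20 cvd] := (continuous_normP _ _).1 cv (d / 2) (divr_gt0 d0 (ltr0Sn _ 1)).
exists (Num.min d (Num.min d1 d2)); first by rewrite !lt_min d0 d10.
move=> h; rewrite !lt_min => /and3P[hd hd1 hd2].
set w := v (x + h) - v x.
have wd : `|w| < d.
  apply: le_lt_trans (cvd (x + h) _) _; first by rewrite addrAC subrr add0r.
  by rewrite ltr_pdivrMr // ltr_pMr // ltr1n.
pose M := Num.max `|h| `|w|.
have nM : `|row_mx h w| <= M by apply: norm_row_mx_le; rewrite le_max lexx ?orbT.
have Md : `|row_mx h w| < d by apply: le_lt_trans nM _; rewrite gt_max hd.
have := Kd _ Md; rewrite deriveEjacobian //.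
have -> : u + row_mx h w = row_mx (x + h) (v (x + h)).
  by rewrite /u add_row_mx /w subrKC.
rewrite K0d; last by rewrite addrAC subrr add0r.
rewrite Ku0 subrr sub0r normrN -['J K u]vsubmxK mul_row_col -/Jx => H1.
have H2 : `|h *m (Jx *m B) + w| <= b * (e1 * M).
  have -> : h *m (Jx *m B) + w = (h *m Jx + w *m dsubmx ('J K u)) *m B.
    by rewrite mulmxDl -!mulmxA mulmxV // mulmx1.
  by rewrite (le_trans (Bb _)) // ler_pM2l // (le_trans H1) // ler_pM2l.
have M0 : 0 <= M by rewrite le_max normr_ge0.
have H3 : b * (e1 * M) <= 2^-1 * M.
  rewrite mulrA ler_wpM2r // mulrC -ler_pdivlMr // ge_min lexx //.
have wM : `|w| <= (2 * m + 1) * `|h|.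
  have := ler_normB (h *m (Jx *m B) + w) (h *m (Jx *m B)).
  rewrite addrAC subrr add0r => H4; have := Jm h.
  have mh : 0 <= m * `|h| by rewrite mulr_ge0.
  have := normr_ge0 h; have : M = `|h| \/ M = `|w| by rewrite /M; case: leP; [right|left].
  by case=> ME; rewrite ME in H2 H3; lra.
rewrite mulmxN opprK addrC (le_trans H2) //.
have MM : M <= (2 * m + 2) * `|h|.
  rewrite ge_max; have mh : 0 <= m * `|h| by rewrite mulr_ge0.
  have h0 := normr_ge0 h.
  by apply/andP; split; lra.
have E1 : e1 <= e / (b * (2 * m + 2)) by rewrite ge_min lexx orbT.
rewrite mulrA (@le_trans _ _ (b * e1 * ((2 * m + 2) * `|h|))) //.
  by rewrite ler_pM2l // mulr_gt0.
rewrite mulrA ler_wpM2r //.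
move: E1; rewrite ler_pdivlMr ?mulr_gt0 // => E1; rewrite (le_trans _ E1) //.
by rewrite [leRHS]mulrA [e1 * b]mulrC.
Qed.

End implicit_differentiability.

Section chain.
Context {R : realType}.

Lemma derive_comp (V W W' : normedModType R) (b : V -> W) (a : W -> W') z v :
  differentiable b z -> differentiable a (b z) ->
  'D_v (fun x => a (b x)) z = 'D_('D_v b z) a (b z).
Proof.
move=> db da; rewrite [LHS](deriveE _ (differentiable_comp db da)) diff_comp //.
by rewrite /= -!deriveE.
Qed.

Lemma derive_of_line (V W : normedModType R) (a : V -> W) z v l :
  (forall t : R, a (z + t *: v) = a z + t *: l) -> 'D_v a z = l.
Proof.
move=> az; apply: cvg_lim => //.
apply: cvg_near_cst; near=> t.
have t0 : t != 0 by near: t; exact: nbhs_dnbhs_neq.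
by rewrite /= [_ + z]addrC az addrAC subrr add0r scalerA mulVf // scale1r.
Unshelve. all: by end_near. Qed.

Lemma differentiable_row_mx (V : normedModType R) P Q (a : V -> 'rV[R]_P)
    (b : V -> 'rV[R]_Q) z : differentiable a z -> differentiable b z ->
  differentiable (fun x => row_mx (a x) (b x)) z.
Proof.
move=> da db.
rewrite (_ : (fun x => _) = fun x => mulmxr (row_mx 1%:M 0) (a x) +
                                     mulmxr (row_mx 0 1%:M) (b x)); last first.
  apply/funext => x; rewrite /= !mul_mx_row !mulmx1 !mulmx0 add_row_mx.
  by rewrite addr0 add0r.
apply: differentiableD.
  apply: (@differentiable_comp _ _ _ _ a (mulmxr (row_mx 1%:M 0))) => //.
  by apply/linear_differentiable/rV_linear_continuous.
apply: (@differentiable_comp _ _ _ _ b (mulmxr (row_mx 0 1%:M))) => //.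
by apply/linear_differentiable/rV_linear_continuous.
Qed.

Lemma Ck_le (V W : normedModType R) (a : V -> W) z j k :
  (j <= k)%N -> Ck k a z -> Ck j a z.
Proof.
move=> /subnK <-; elim: (k - j)%N => [//|i IH].
by rewrite addSn => /CkS.
Qed.

Lemma derive_row_mx (V : normedModType R) P Q (a : V -> 'rV[R]_P)
    (b : V -> 'rV[R]_Q) z v : differentiable a z -> differentiable b z ->
  'D_v (fun x => row_mx (a x) (b x)) z = row_mx ('D_v a z) ('D_v b z).
Proof.
move=> da db; apply: cvg_lim => //=.
have ca : derivable a z v by exact: diff_derivable.
have cb : derivable b z v by exact: diff_derivable.
apply/cvgrPdist_le => e e0.
move/cvgrPdist_le: ca => /(_ e e0) ca; move/cvgrPdist_le: cb => /(_ e e0) cb.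
near=> t; rewrite opp_row_mx add_row_mx scale_row_mx opp_row_mx add_row_mx.
by apply: norm_row_mx_le; near: t.
Unshelve. all: by end_near. Qed.

End chain.

Section implicit_smooth.
Context {R : realType} {n N : nat}.

(** The derivative [w = 'D_e v] is itself defined implicitly: it solves
    ['D_(row_mx e w) K = 0] on the graph of [v], an equation that is linear in
    [w] with the same partial derivative as [K].  Induction on [k] therefore
    applies to [w]. *)
Lemma Ck_implicit k : forall (K : 'rV[R]_(n + N) -> 'rV[R]_N)
    (v : 'rV[R]_n -> 'rV[R]_N) x0,
  Ck k.+1 K (row_mx x0 (v x0)) ->
  dsubmx ('J K (row_mx x0 (v x0))) \in unitmx ->
  (\forall x \near x0, K (row_mx x (v x)) = 0) ->
  (\forall x \near x0, {for x, continuous v}) -> Ck k.+1 v x0.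
Proof.
elim: k => [|k IH] K v x0 CK uK K0 cv.
  pose c x := row_mx x (v x).
  have cv0 : Ck 0 v x0 by [].
  have Cc : Ck 0 c x0.
    by apply: Ck_row_mx => //; apply: Ck_id.
  have cc : c x @[x --> x0] --> c x0 by exact: Ck_continuous Cc.
  have dKc : \forall x \near x0, differentiable K (c x).
    exact: cc (Ck_near_differentiable CK).
  (* In the base case 'D_e v is minus the partial derivative of K along e
     times the inverse of its derivative M in the last N variables. *)
  pose M x : 'M[R]_N := \matrix_(i, j) ('D_(row_mx 0 (delta_mx 0 i)) K (c x)) 0 j.
  have CM i j : Ck 0 (fun x => M x i j) x0.
    rewrite (_ : (fun x => _) =
        fun x => ('D_(row_mx 0 (delta_mx 0 i)) K (c x)) 0 j); last first.
      by apply/funext => x; rewrite mxE.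
    apply: Ck_entry; apply: (@Ck_comp _ _ _ _ 0 c ('D_(row_mx 0 (delta_mx 0 i)) K)) => //.
    exact: Ck_derive.
  have ME x : differentiable K (c x) -> M x = dsubmx ('J K (c x)).
    move=> dK; apply/row_matrixP => i; rewrite [RHS]rowE -derive_partial //.
    by apply/rowP => j; rewrite !mxE.
  have uM : M x0 \in unitmx by rewrite ME //; apply: nbhs_singleton dKc.
  have uMx := near_unitmx CM uM.
  have dv : \forall x \near x0, differentiable v x.
    apply: filterS2 (near_join K0) (filterI cv (filterI dKc uMx)).
    move=> x K0x [cvx [dKx uMxx]]; rewrite ME // in uMxx.
    exact: (@implicit_differentiable _ _ _ K v x dKx uMxx K0x cvx).
  split => // e.
  apply: (@Ck_near_eq _ _ _ 0
     (fun x => - ('D_(row_mx e 0) K (c x) *m invmx (M x)))).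
    apply: filterS2 (near_join K0) (filterI dv (filterI dKc uMx)).
    move=> x K0x [dvx [dKx uMxx]].
    have := near_eq_derive e K0x; rewrite derive_cst.
    rewrite (@derive_comp _ _ _ _ c K) //; last first.
      by apply: differentiable_row_mx.
    rewrite derive_row_mx // derive_id.
    have -> : row_mx e ('D_e v x) = row_mx e 0 + row_mx 0 ('D_e v x).
      by rewrite add_row_mx addr0 add0r.
    rewrite -{1}[row_mx e 0]scale1r derive_is_linear // scale1r.
    rewrite derive_partial // -ME // addrC => /eqP; rewrite addr_eq0 => /eqP E.
    by rewrite -mulNmx -E mulmxK.
  apply: Ck_rV => j.
  rewrite (_ : (fun x => _) = fun x => \sum_i (-1) *
     (('D_(row_mx e 0) K (c x)) 0 i * invmx (M x) i j)); last first.
    by apply/funext => x; rewrite !mxE -sumrN; apply: eq_bigr => i _; rewrite mulN1r.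
  apply: Ck_sum => i _; apply: CkM; first exact: Ck_cst.
  apply: CkM; last exact: Ck0_invmx.
  apply: Ck_entry; apply: (@Ck_comp _ _ _ _ 0 c ('D_(row_mx e 0) K)) => //.
  exact: Ck_derive.
have C1v : Ck k.+1 v x0 by apply: IH (CkS CK) uK K0 cv.
have [dv Dv] := C1v; split=> // e.
pose c x := row_mx x (v x).
have Cc : Ck k.+1 c x0 by apply: Ck_row_mx => //; apply: Ck_id.
have cc : c x @[x --> x0] --> c x0 by exact: Ck_continuous Cc.
have dKc : \forall x \near x0, differentiable K (c x).
  exact: cc (Ck_near_differentiable CK).
(* The equation for w = 'D_e v, written with x and w as independent
   variables. *)
pose K1 (u : 'rV[R]_(n + N)) : 'rV[R]_N := 'D_(row_mx e 0) K (c (lsubmx u)) +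
  \sum_i rsubmx u 0 i *: 'D_(row_mx 0 (delta_mx 0 i)) K (c (lsubmx u)).
have K1E x w : differentiable K (c x) ->
    K1 (row_mx x w) = 'D_(row_mx e w) K (c x).
  move=> dK; rewrite /K1 row_mxKl row_mxKr.
  have -> : row_mx e w = 1 *: row_mx e 0 + row_mx 0 w.
    by rewrite scale1r add_row_mx addr0 add0r.
  rewrite derive_is_linear // scale1r; congr (_ + _).
  rewrite {2}(row_sum_delta w).
  have -> : row_mx 0 (\sum_j w 0 j *: delta_mx 0 j) =
      \sum_j w 0 j *: row_mx (0 : 'rV[R]_n) (delta_mx 0 j : 'rV[R]_N).
    apply/rowP => i; rewrite summxE; case: (split_ordP i) => l ->.
      by rewrite row_mxEl mxE big1 // => j _; rewrite mxE row_mxEl mxE mulr0.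
    rewrite row_mxEr summxE; apply: eq_bigr => j _.
    by rewrite [RHS]mxE row_mxEr mxE.
  rewrite derive_sum_dir //; apply: eq_bigr => i _.
  by rewrite !deriveE // linearZ.
pose w := 'D_e v.
have CK1 : Ck k.+1 K1 (row_mx x0 (w x0)).
  have CDK e1 : Ck k.+1 (fun u : 'rV[R]_(n + N) => 'D_e1 K (c (lsubmx u))) (row_mx x0 (w x0)).
    apply: (@Ck_comp _ _ _ _ k.+1 (fun u : 'rV[R]_(n + N) => c (lsubmx u)) ('D_e1 K)).
      apply: (@Ck_comp _ _ _ _ k.+1 (fun u : 'rV[R]_(n + N) => lsubmx u) c).
        exact: (Ck_linear _ lsubmx).
      by rewrite row_mxKl.
    by rewrite row_mxKl; apply: Ck_derive.
  apply: CkD => //; apply: Ck_rV => j.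
  rewrite (_ : (fun u => _) = fun u : 'rV[R]_(n + N) => \sum_i u 0 (rshift n i) *
     ('D_(row_mx 0 (delta_mx 0 i)) K (c (lsubmx u))) 0 j); last first.
    apply/funext => u; rewrite summxE; apply: eq_bigr => i _.
    by rewrite mxE mxE.
  apply: Ck_sum => i _; apply: CkM; last exact: Ck_entry.
  exact: (Ck_linear _ (entry 0 (rshift n i))).
apply: (IH K1 w x0 CK1).
- suff E : dsubmx ('J K1 (row_mx x0 (w x0))) = dsubmx ('J K (row_mx x0 (v x0))).
    by rewrite E; exact: uK.
  have dK0 : differentiable K (row_mx x0 (v x0)) by exact: nbhs_singleton dKc.
  have dK1 : differentiable K1 (row_mx x0 (w x0)) by exact: Ck_differentiable CK1.
  apply/row_matrixP => i; rewrite [LHS]rowE [RHS]rowE.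
  apply: etrans (esym (derive_partial (delta_mx 0 i) dK1)) _.
  apply: etrans _ (derive_partial (delta_mx 0 i) dK0).
  apply: derive_of_line => t; rewrite scale_row_mx add_row_mx scaler0 addr0.
  have dK := nbhs_singleton dKc.
  rewrite !K1E //.
  have -> : row_mx e (w x0 + t *: delta_mx 0 i) =
     t *: row_mx 0 (delta_mx 0 i) + row_mx e (w x0).
    by rewrite scale_row_mx add_row_mx scaler0 add0r addrC.
  by rewrite derive_is_linear // addrC.
- apply: filterS2 (near_join K0) (filterI dv dKc) => x K0x [dvx dKx].
  rewrite K1E //.
  have := near_eq_derive e K0x; rewrite derive_cst.
  rewrite (@derive_comp _ _ _ _ c K) //; last exact: differentiable_row_mx.
  by rewrite derive_row_mx // derive_id.
- exact: (Ck_le (leq0n k) (Dv e)).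
Qed.

End implicit_smooth.

(** * The inner product and theorems of the alternative *)

Section dotr_theory.
Context {R : realType}.
Variable k : nat.
Implicit Types u v w : 'rV[R]_k.

Lemma dotrE u v : dotr u v = (u *m v^T) 0 0.
Proof. by rewrite mxE; apply: eq_bigr => i _; rewrite mxE. Qed.

Lemma dotrC u v : dotr u v = dotr v u.
Proof. by apply: eq_bigr => i _; rewrite mulrC. Qed.

Lemma dotrDl u v w : dotr (u + v) w = dotr u w + dotr v w.
Proof. by rewrite !dotrE mulmxDl mxE. Qed.

Lemma dotrZl (c : R) u v : dotr (c *: u) v = c * dotr u v.
Proof. by rewrite !dotrE -scalemxAl mxE. Qed.

Lemma dotrDr u v w : dotr w (u + v) = dotr w u + dotr w v.
Proof. by rewrite !(dotrC w) dotrDl. Qed.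

Lemma dotrZr (c : R) u v : dotr v (c *: u) = c * dotr v u.
Proof. by rewrite !(dotrC v) dotrZl. Qed.

Lemma dotrNr u v : dotr v (- u) = - dotr v u.
Proof. by rewrite -scaleN1r dotrZr mulN1r. Qed.

Lemma dotrNl u v : dotr (- u) v = - dotr u v.
Proof. by rewrite !(dotrC _ v) dotrNr. Qed.

Lemma dotr0l u : dotr 0 u = 0.
Proof. by rewrite dotrE mul0mx mxE. Qed.

Lemma dotr0r u : dotr u 0 = 0.
Proof. by rewrite dotrC dotr0l. Qed.

Lemma dotr_ge0 u : 0 <= dotr u u.
Proof. by apply: sumr_ge0 => i _; rewrite -expr2 sqr_ge0. Qed.

Lemma dotr_eq0 u : dotr u u = 0 -> u = 0.
Proof.
move=> /eqP; rewrite psumr_eq0 => [/allP u0|i _]; last by rewrite -expr2 sqr_ge0.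
apply/rowP => i; rewrite mxE; have := u0 i (mem_index_enum _).
by rewrite mulf_eq0 orbb => /eqP.
Qed.

Lemma dotr_terms_eq0 u v : (forall i, u 0 i * v 0 i <= 0) -> dotr u v = 0 ->
  forall i, u 0 i * v 0 i = 0.
Proof.
move=> uv /eqP; rewrite -oppr_eq0 -sumrN psumr_eq0 => [/allP uv0 i|i _].
  by have := uv0 i (mem_index_enum _); rewrite oppr_eq0 => /eqP.
by rewrite oppr_ge0.
Qed.

End dotr_theory.

Section closed_sets.
Context {R : realType} {N : nat}.

Lemma closed_preimage_eq0 (f : 'rV[R]_N -> R) : continuous f ->
  closed [set x | f x = 0].
Proof.
move=> cf; apply: (@preimage_closed _ _ f [set x | x = 0]) => [x _|].
  exact: cf.
exact: closed_eq.
Qed.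

Lemma closed_preimage_ge0 (f : 'rV[R]_N -> R) : continuous f ->
  closed [set x | 0 <= f x].
Proof.
move=> cf; apply: (@preimage_closed _ _ f [set x | 0 <= x]) => [x _|].
  exact: cf.
exact: closed_ge.
Qed.

Lemma closed_forall (I : Type) (S : I -> set 'rV[R]_N) :
  (forall i, closed (S i)) -> closed [set x | forall i, S i x].
Proof.
move=> cS; rewrite (_ : [set x | _] = \bigcap_i S i).
  by apply: closed_bigI => i _.
by apply/seteqP; split => x /= H i; [move=> _|]; apply: H.
Qed.

Lemma compact_rV (S : set 'rV[R]_N) (M : R) :
  (forall x, S x -> forall i, `|x 0 i| <= M) -> closed S -> compact S.
Proof.
move=> SM; apply: bounded_closed_compact.
exists (Num.max M 0); split; first by rewrite num_real.
move=> r; rewrite gt_max => /andP[Mr r0] x Sx; apply: mx_norm_le => [|i j].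
  exact: ltW.
by rewrite ord1 (le_trans (SM x Sx j)) // ltW.
Qed.

End closed_sets.

Section alternative.
Context {R : realType}.

(** Gives the variational inequality of the nearest point in [gordan]. *)
Lemma quadratic_slope_ge0 (b c : R) :
  (forall t : R, 0 <= t <= 1 -> 0 <= 2 * t * b + t ^+ 2 * c) -> 0 <= b.
Proof.
move=> H; rewrite leNgt; apply/negP => b0.
have c0 : 0 <= c by have := H 1; rewrite ler01 lexx expr1n => /(_ isT); lra.
pose t := - b / (c - b).
have cb : 0 < c - b by lra.
have tE : t * (c - b) = - b by rewrite /t divfK // gt_eqF.
have t0 : 0 < t by rewrite /t divr_gt0 // oppr_gt0.
have t1 : t <= 1 by rewrite /t ler_pdivrMr //; lra.
have := H t; rewrite ltW //= => /(_ t1).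
have -> : 2 * t * b + t ^+ 2 * c = t * (t * (c - b) + (2 + t) * b) by ring.
rewrite tE leNgt pmulr_rlt0 //.
suff -> : - b + (2 + t) * b < 0 by [].
have : t * b < 0 by rewrite pmulr_rlt0.
by move=> tb; lra.
Qed.

(** The vectors [l *m C], for [l] in the simplex over [p], form a compact
    convex set.  Its point [q] of least norm satisfies [dotr q (row i C) >=
    dotr q q] for [i] in [p], so [- q^T] would solve the strict system if [q]
    were nonzero. *)
Lemma gordan k N (C : 'M[R]_(k, N)) (p : pred 'I_k) :
  ~ (exists u : 'cV[R]_N, forall i, p i -> (C *m u) i 0 < 0) ->
  exists l : 'rV[R]_k, [/\ nneg l, forall i, ~~ p i -> l 0 i = 0,
    \sum_i l 0 i = 1 & l *m C = 0].
Proof.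
move=> Cu.
pose S : set 'rV[R]_k := [set l | nneg l /\
  ((forall i, (if p i then 0 else l 0 i) = 0) /\ (\sum_i l 0 i) - 1 = 0)].
have SP l : S l <-> [/\ nneg l, forall i, ~~ p i -> l 0 i = 0 & \sum_i l 0 i = 1].
  split=> [[l0 [lp /eqP]]|[l0 lp l1]].
    rewrite subr_eq0 => /eqP l1; split => // i pi.
    by have := lp i; rewrite (negbTE pi).
  split=> //; split; last by rewrite l1 subrr.
  by move=> i; case: ifPn => // /lp.
have [i0 pi0] : exists i, p i.
  apply: contrapT => np; apply: Cu; exists 0 => i pi.
  by exfalso; apply: np; exists i.
have Sd i : p i -> S (delta_mx 0 i).
  move=> pi; apply/SP; split.
  - by move=> j; rewrite mxE /= ler0n.
  - by move=> j pj; rewrite mxE; case: (eqVneq j i) pj => [->|_ _]; rewrite ?pi ?andbF.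
  - rewrite (bigD1 i) //= mxE !eqxx big1 ?addr0 // => j ji.
    by rewrite mxE (negbTE ji) andbF.
have cS : compact S.
  apply: (@compact_rV _ _ _ 1).
    move=> l /SP[l0 _ l1] i; rewrite ger0_norm // -l1 (bigD1 i) //= lerDl.
    by apply: sumr_ge0 => j _; apply: l0.
  apply: closedI; first by apply: closed_forall => i;
    apply: closed_preimage_ge0; apply: coord_continuous.
  apply: closedI.
    apply: closed_forall => i; apply: closed_preimage_eq0.
    case: (p i) => x; [exact: Ck_continuous (Ck_cst 0 0 x)|exact: coord_continuous].
  apply: closed_preimage_eq0 => x.
  have : Ck 0 (fun l : 'rV[R]_k => \sum_i l 0 i + - 1) x.
    apply: CkD; last exact: Ck_cst.
    by apply: Ck_sum => i _; apply: Ck_entry; apply: Ck_id.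
  exact: Ck_continuous.
pose phi (l : 'rV[R]_k) := dotr (l *m C) (l *m C).
have [||l Sl lmin] := @EVT_min_rV R k phi S _ cS.
- by exists (delta_mx 0 i0); apply: Sd.
- apply: continuous_subspaceT => x.
  have : Ck 0 phi x.
    have CC i : Ck 0 (fun l : 'rV[R]_k => (l *m C) 0 i) x.
      apply: (@Ck_entry _ _ _ _ _ (fun l : 'rV[R]_k => l *m C)).
      exact: (Ck_linear _ (mulmxr C)).
    by apply: Ck_sum => i _; apply: CkM.
  exact: Ck_continuous.
have {}Sl := set_mem Sl.
have [l0 lp l1] := (SP l).1 Sl.
have [E|/eqP E] := eqVneq (l *m C) 0; first by exists l.
exfalso; apply: Cu; exists (- (l *m C)^T) => i pi.
set q := l *m C in E *.
have qq : 0 < dotr q q.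
  rewrite lt_neqAle dotr_ge0 andbT eq_sym; apply/eqP => /dotr_eq0; exact: E.
have -> : (C *m (- q^T)) i 0 = - dotr q (row i C).
  by rewrite mulmxN mxE mxE dotrC dotrE !mxE; congr (- _);
     apply: eq_bigr => j _; rewrite !mxE.
rewrite oppr_lt0 (lt_le_trans qq) // -subr_ge0.
have -> : dotr q (row i C) - dotr q q = dotr q (row i C - q).
  by rewrite dotrDr dotrNr.
apply: (@quadratic_slope_ge0 _ (dotr (row i C - q) (row i C - q))) => t /andP[t0 t1].
have St : S (l + t *: (delta_mx 0 i - l)).
  have -> : l + t *: (delta_mx 0 i - l) = (1 - t) *: l + t *: delta_mx 0 i.
    by rewrite scalerBr scalerBl scale1r addrA addrAC.
  have [d0 dp d1] := (SP _).1 (Sd i pi).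
  apply/SP; split.
  - by move=> j; rewrite 3!mxE addr_ge0 // mulr_ge0 // subr_ge0.
  - by move=> j pj; rewrite 3!mxE lp // dp // !mulr0 addr0.
  - have E' j : ((1 - t) *: l + t *: delta_mx 0 i) 0 j =
        (1 - t) * l 0 j + t * (delta_mx 0 i : 'rV[R]_k) 0 j by rewrite !mxE.
    rewrite (eq_bigr _ (fun j _ => E' j)) big_split /= -!mulr_sumr l1 d1 !mulr1.
    by rewrite subrK.
have := lmin _ (mem_set St); rewrite /phi mulmxDl -scalemxAl mulmxBl -rowE -/q.
move: (row i C - q) => v; rewrite dotrDl !dotrDr.
rewrite !dotrZl !dotrZr [dotr v q]dotrC -subr_ge0.
by congr (_ <= _); ring.
Qed.

(** [gordan] after eliminating the equations [A *m w = - alpha]: the solutions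
    are [Z *m y - B *m alpha], with [Z] a projector on the kernel of [A], and
    one more unknown [tau > 0] makes the inhomogeneous inequalities
    homogeneous.  The conclusion [l != 0], stronger than [(l, mu) != 0], uses
    the independence of the rows of [A]. *)
Lemma motzkin k N P (C : 'M[R]_(k, N)) (beta : 'cV[R]_k) (p : pred 'I_k)
    (A : 'M[R]_(P, N)) (alpha : 'cV[R]_P) :
  row_free A ->
  ~ (exists w : 'cV[R]_N, A *m w = - alpha /\
       forall i, p i -> (C *m w) i 0 < - beta i 0) ->
  exists (l : 'rV[R]_k) (mu : 'rV[R]_P),
    [/\ nneg l, forall i, ~~ p i -> l 0 i = 0, l != 0, l *m C + mu *m A = 0 &
        0 <= (l *m beta + mu *m alpha) 0 0].
Proof.
move=> /row_freeP[B AB] Cw.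
pose Z : 'M[R]_N := 1%:M - B *m A.
have AZ : A *m Z = 0 by rewrite mulmxBr mulmx1 mulmxA AB mul1mx subrr.
pose beta' := beta - C *m B *m alpha.
pose D : 'M[R]_(k + 1, N + 1) := block_mx (C *m Z) beta' 0 (- 1%:M).
pose p' (i : 'I_(k + 1)) := if fintype.split i is inl j then p j else true.
have [[u Du]|l [l0 lp l1 lD]] := @gordan _ _ D p'.
  apply: Cw.
  have uE := vsubmxK u; set y := usubmx u in uE; set tau := dsubmx u in uE.
  have tau0 : 0 < tau 0 0.
    have := Du (rshift k 0); rewrite /p' (unsplitK (inr _)) => /(_ isT).
    by rewrite -uE mul_block_col mul0mx add0r mulNmx mul1mx col_mxEd mxE oppr_lt0.
  exists (Z *m ((tau 0 0)^-1 *: y) - B *m alpha); split.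
    by rewrite mulmxBr !mulmxA AZ mul0mx sub0r AB mul1mx.
  move=> i pi.
  have := Du (lshift 1 i); rewrite /p' (unsplitK (inl _)) => /(_ pi).
  rewrite -uE mul_block_col col_mxEu mxE.
  have -> : (beta' *m tau) i 0 = tau 0 0 * beta' i 0.
    by rewrite mxE big_ord1 mulrC.
  have -> : (C *m (Z *m ((tau 0 0)^-1 *: y) - B *m alpha)) i 0 =
     (tau 0 0)^-1 * (C *m Z *m y) i 0 - (C *m B *m alpha) i 0.
    by rewrite mulmxBr -!scalemxAr !mulmxA mxE [X in X + _]mxE [X in _ + X]mxE.
  rewrite /beta' [(beta - _) i 0]mxE [X in beta i 0 + X]mxE.
  set v := (C *m Z *m y) i 0; set b := beta i 0; set c := (C *m B *m alpha) i 0.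
  move=> H; rewrite ltrBlDr mulrC ltr_pdivrMr //; move: H.
  by rewrite mulrDr mulrDl; lra.
have lE := hsubmxK l; set m := lsubmx l in lE; set lt := rsubmx l in lE.
have m0 : nneg m by move=> i; rewrite mxE.
have lt0 : 0 <= lt 0 0 by rewrite mxE.
move: lD; rewrite -lE mul_row_block mulmx0 addr0 mulmxN mulmx1.
rewrite -row_mx0 => /eq_row_mx[mCZ /eqP]; rewrite subr_eq0 => /eqP mb.
exists m, (- (m *m C *m B)); split => //.
- move=> i pi; rewrite mxE; apply: lp.
  by rewrite /p' (unsplitK (inl _)).
- apply/eqP => m00; move: l1; rewrite -lE big_split_ord /= big_ord1 row_mxEr -mb m00.
  rewrite mul0mx mxE addr0 big1 => [|i _]; last by rewrite row_mxEl mxE.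
  by move/eqP; rewrite eq_sym oner_eq0.
- by rewrite mulNmx -mCZ mulmxBr mulmx1 mulmxBr !mulmxA.
- by rewrite mulNmx -!mulmxA -mulmxBr mulmxA mb.
Qed.

End alternative.

(** * Gradients, Hessians and Taylor expansions *)

Section gradients.
Context {R : realType}.

Fact dotr_is_linear k (l : 'rV[R]_k) : linear (dotr l : 'rV[R]_k -> R).
Proof. by move=> c u v; rewrite dotrDr dotrZr. Qed.

HB.instance Definition _ k (l : 'rV[R]_k) :=
  GRing.isLinear.Build R 'rV[R]_k R _ (dotr l) (@dotr_is_linear k l).

Lemma derive_dotr (V : normedModType R) k (l : 'rV[R]_k) (a : V -> 'rV[R]_k) z v :
  differentiable a z -> 'D_v (fun x => dotr l (a x)) z = dotr l ('D_v a z).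
Proof. by move=> da; apply: derive_post => //; apply: rV_linear_continuous. Qed.

Lemma Ck_dotr (V : normedModType R) k j (l : 'rV[R]_k) (a : V -> 'rV[R]_k) z :
  Ck j a z -> Ck j (fun x => dotr l (a x)) z.
Proof. exact: (@Ck_post _ _ _ _ j (dotr l) (@rV_linear_continuous _ _ _ _)). Qed.

Variable N : nat.
Implicit Types (phi : 'rV[R]_N -> R) (z : 'rV[R]_N).

Lemma grad_mulmx phi z (d : 'cV[R]_N) : differentiable phi z ->
  (grad phi z *m d) 0 0 = 'D_(d^T) phi z.
Proof.
move=> dphi; rewrite derive_rV // mxE; apply: eq_bigr => i _.
by rewrite !mxE [RHS]mulrC.
Qed.

Lemma jac_mulmx P (a : 'rV[R]_N -> 'rV[R]_P) z (d : 'cV[R]_N) :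
  differentiable a z -> jac a z *m d = ('D_(d^T) a z)^T.
Proof. by move=> da; rewrite deriveEjacobian // trmx_mul trmxK. Qed.

Lemma row_jac P (a : 'rV[R]_N -> 'rV[R]_P) z i : differentiable a z ->
  row i (jac a z) = grad (fun x => a x 0 i) z.
Proof.
move=> da; apply/rowP => j; rewrite [RHS]mxE -derive_entry //.
by rewrite deriveEjacobian // -rowE !mxE.
Qed.

Lemma Ck_grad phi z k : Ck k.+1 phi z -> Ck k (grad phi) z.
Proof.
move=> Cphi; apply: Ck_rV => j.
rewrite (_ : (fun x => _) = 'D_(delta_mx 0 j) phi); first exact: Ck_derive.
by apply/funext => x; rewrite mxE.
Qed.

Lemma hess_mulmx phi z (d : 'cV[R]_N) : Ck 2 phi z ->
  (d^T *m hess phi z *m d) 0 0 = 'D_(d^T) ('D_(d^T) phi) z.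
Proof.
move=> Cphi; have dg := Ck_differentiable (Ck_grad Cphi).
have dphi := Ck_near_differentiable Cphi.
rewrite /hess -mulmxA jac_mulmx // -dotrE.
rewrite -derive_dotr //; apply: near_eq_derive; apply: filterS dphi => x dx.
rewrite -grad_mulmx // dotrC dotrE; congr ((_ *m _) 0 0).
by rewrite trmxK.
Qed.

End gradients.

Section taylor.
Context {R : realType} {N : nat}.
Implicit Types (phi : 'rV[R]_N -> R) (z d w : 'rV[R]_N).

Lemma Ck1_strict_diff_scalar phi z : Ck 1 phi z -> forall e : R, 0 < e ->
  exists2 r : R, 0 < r & forall x y, `|x - z| < r -> `|y - z| < r ->
    `|phi x - phi y - 'D_(x - y) phi z| <= e * `|x - y|.
Proof.
move=> Cphi e e0; pose a x : 'rV[R]_1 := phi x *: delta_mx 0 0.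
have Ca : Ck 1 a z by exact: CkZl.
have [r r0 H] := Ck1_strict_diff Ca e0; exists r => // x y xr yr.
apply: le_trans (H x y xr yr); apply: le_trans (mx_entry_le _ 0 0).
have da := Ck_differentiable Ca.
rewrite -deriveEjacobian // !mxE derive_entry // !eqxx !mulr1.
have -> // : 'D_(x - y) (fun x => a x 0 0) z = 'D_(x - y) phi z.
by congr ('D_(x - y) _ z); apply/funext => t; rewrite !mxE !eqxx mulr1.
Qed.

Lemma is_derive_quadratic (A T s : R) :
  is_derive s 1 (fun s => s * A + s ^+ 2 / 2 * T) (A + s * T).
Proof.
have := is_derive_poly (A *: 'X + (T / 2) *: 'X^2) s.
rewrite derivD !derivZ derivX derivXn !hornerE /=.
have -> : (horner (A *: 'X + (T / 2) *: 'X^2) : R -> R) =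
   fun s => s * A + s ^+ 2 / 2 * T.
  by apply/funext => t; rewrite !hornerE /=; field.
have -> // : A + T / 2 * (s + s) = A + s * T by field.
Qed.

(** The mean value theorem is applied to [phi] minus its quadratic model along
    the line; the derivative of this difference is small because ['D_d phi] is
    differentiable at [z]. *)
Lemma taylor_line phi z d : Ck 2 phi z -> forall e : R, 0 < e ->
  exists2 r : R, 0 < r & forall t : R, 0 < t < r ->
    `|phi (z + t *: d) - phi z - t * 'D_d phi z
       - t ^+ 2 / 2 * 'D_d ('D_d phi) z| <= e * t ^+ 2.
Proof.
move=> Cphi e e0; set T := 'D_d ('D_d phi) z.
have [r1 r10 dphi] := (near_normP _ _).1 (Ck_near_differentiable Cphi).
have dpsi : differentiable ('D_d phi) z := Ck_differentiable (Ck_derive d Cphi).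
have n1 : 0 < `|d| + 1 by rewrite ltr_pwDr.
have [r2 r20 Hpsi] := diff_estimate dpsi (divr_gt0 e0 n1).
exists (Num.min r1 r2 / (`|d| + 1)); first by rewrite divr_gt0 // lt_min r10.
move=> t /andP[t0]; rewrite ltr_pdivlMr // => tr.
have td c : 0 <= c <= t -> `|c *: d| < Num.min r1 r2.
  move=> /andP[c0 ct]; rewrite normrZ ger0_norm //.
  by apply: le_lt_trans tr; rewrite ler_pM // lerDl.
pose k s := phi (z + s *: d) - (s * 'D_d phi z + s ^+ 2 / 2 * T).
have dk s : 0 <= s <= t ->
    is_derive s 1 k ('D_d phi (z + s *: d) - ('D_d phi z + s * T)).
  move=> st; have := td s st; rewrite lt_min => /andP[sr1 _].
  have ds : differentiable phi (z + s *: d).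
    by apply: dphi; rewrite addrAC subrr add0r.
  exact: is_deriveB (is_derive_line ds) (is_derive_quadratic _ _ _).
have [||c] := @MVT R k (fun s => 'D_d phi (z + s *: d) - ('D_d phi z + s * T)) 0 t t0.
- by move=> s; rewrite in_itv /= => /andP[s0 st]; apply: dk; rewrite !ltW.
- apply: derivable_within_continuous => s; rewrite in_itv /= => st.
  by have [] := dk s st.
rewrite in_itv /= subr0 => /andP[c0 ct].
rewrite /k scale0r addr0 expr0n /= !mul0r addr0 subr0 => E.
have -> : phi (z + t *: d) - phi z - t * 'D_d phi z - t ^+ 2 / 2 * T =
  ('D_d phi (z + c *: d) - ('D_d phi z + c * T)) * t.
  by rewrite -E; ring.
rewrite normrM (ger0_norm (ltW t0)) expr2 mulrA ler_pM2r //.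
have /andP[_ cr2] : (`|c *: d| < r1) && (`|c *: d| < r2).
  by rewrite -lt_min; apply: td; rewrite !ltW.
have := Hpsi _ cr2.
rewrite (derive_dirZ c d dpsi) -/T opprD addrA => /le_trans; apply.
rewrite normrZ (ger0_norm (ltW c0)) mulrAC ler_pdivrMr //.
rewrite -!mulrA ler_pM2l // ler_pM ?(ltW c0) // ?(ltW ct) // lerDl //.
Qed.

End taylor.

(** * Expansions along parabolic arcs *)

Section parabolic_arc.
Context {R : realType} {N : nat}.
Variables (z d w : 'rV[R]_N).
Implicit Types (phi : 'rV[R]_N -> R).

Definition arc (t : R) : 'rV[R]_N := z + t *: d + t ^+ 2 *: w.

(** The coefficient of [t ^+ 2] in the expansion of [phi] along the arc. *)
Definition second_coef phi : R := 'D_w phi z + 2^-1 * 'D_d ('D_d phi) z.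

(** [P] holds in a thin horn around the arc, of width [o(t ^+ 2)].  One
    parameter [dl] bounds both [t] and the width.  The width leaves room for
    the correction that restores the equality constraints. *)
Definition near_arc (P : R -> 'rV[R]_N -> Prop) : Prop :=
  \forall dl \near 0^'+, forall t x, 0 < t < dl ->
    `|x - arc t| <= dl * t ^+ 2 -> P t x.

Lemma near_arc_dist (r : R) : 0 < r -> near_arc (fun t x => `|x - z| < r).
Proof.
move=> r0; pose M := `|d| + `|w| + 1.
have M0 : 0 < M by rewrite ltr_pwDr // addr_ge0.
near=> dl => t x /andP[t0 tdl] xt.
have dl0 : 0 < dl by exact: lt_trans t0 tdl.
have dl1 : dl <= 1 by near: dl; apply: nbhs_right_le.
have dlr : dl <= r / M by near: dl; apply: nbhs_right_le; rewrite divr_gt0.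
have t1 : t <= 1 by rewrite (le_trans (ltW tdl)).
have -> : x - z = (x - arc t) + (t *: d + t ^+ 2 *: w).
  by rewrite /arc -(addrA z) (opprD z) (addrA x) subrK.
rewrite (le_lt_trans (ler_normD _ _)) //.
rewrite (@le_lt_trans _ _ (t * M)) //; last first.
  by rewrite -ltr_pdivlMr // (lt_le_trans tdl).
have tt : t ^+ 2 <= t by rewrite expr2 ler_piMr // ltW.
have H1 : `|t *: d + t ^+ 2 *: w| <= t * `|d| + t * `|w|.
  rewrite (le_trans (ler_normD _ _)) // !normrZ (ger0_norm (ltW t0)) lerD2l.
  have t20 : 0 <= t ^+ 2 by rewrite exprn_ge0 // ltW.
  by rewrite -expr2 ler_wpM2r.
have H2 : `|x - arc t| <= t.
  rewrite (le_trans xt) // (le_trans _ tt) // ler_piMl // exprn_ge0 // ltW //.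
rewrite /M !mulrDr mulr1 addrC.
exact: lerD.
Unshelve. all: by end_near. Qed.

Lemma near_arc_expansion phi (e : R) : Ck 2 phi z -> 0 < e ->
  near_arc (fun t x =>
    `|phi x - phi z - t * 'D_d phi z - t ^+ 2 * second_coef phi| <= e * t ^+ 2).
Proof.
move=> Cphi e0.
have dphi : differentiable phi z by exact: Ck_differentiable Cphi.
have e4 : 0 < e / 4 by rewrite divr_gt0.
have [k k0 dk] := linear_lipschitz (diff_continuous dphi).
have W0 : 0 < `|w| + 1 by rewrite ltr_pwDr.
have [r1 r10 Hs] := Ck1_strict_diff_scalar (CkS Cphi) (divr_gt0 e4 W0).
have [r2 r20 Ht] := taylor_line d Cphi e4.
have D0 : 0 < `|d| + 1 by rewrite ltr_pwDr.
have := near_arc_dist r10; rewrite /near_arc => Hd.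
near=> dl => t x tdl' xt; have /andP[t0 tdl] := tdl'.
have dl0 : 0 < dl by exact: lt_trans t0 tdl.
have dl1 : dl <= 1 by near: dl; apply: nbhs_right_le.
have dlr2 : dl <= r2 by near: dl; apply: nbhs_right_le.
have dlk : dl <= e / 4 / k by near: dl; apply: nbhs_right_le; rewrite divr_gt0.
have dlr1 : dl <= r1 / (`|d| + 1).
  by near: dl; apply: nbhs_right_le; rewrite divr_gt0.
have xr1 : `|x - z| < r1.
  by move: t x tdl' xt {t0 tdl}; near: dl; exact: Hd.
have t2 : 0 <= t ^+ 2 by rewrite exprn_ge0 // ltW.
set y := z + t *: d.
have yr1 : `|y - z| < r1.
  rewrite /y addrAC subrr add0r normrZ (ger0_norm (ltW t0)).
  apply: (@le_lt_trans _ _ (t * (`|d| + 1))).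
    by rewrite ler_wpM2l ?ltW // ltrDl.
  by rewrite -ltr_pdivlMr // (lt_le_trans tdl).
have H1 := Ht t; rewrite t0 (lt_le_trans tdl dlr2) in H1; have {}H1 := H1 isT.
have H2 := Hs x y xr1 yr1.
have xy : x - y = (x - arc t) + t ^+ 2 *: w.
  by rewrite /arc -/y (opprD y) (addrA x) subrK.
have nxy : `|x - y| <= t ^+ 2 * (`|w| + 1).
  rewrite xy (le_trans (ler_normD _ _)) // normrZ (ger0_norm t2) mulrDr mulr1 addrC.
  rewrite lerD2l (le_trans xt) // ler_piMl //.
have {}H2 : `|phi x - phi y - 'D_(x - y) phi z| <= e / 4 * t ^+ 2.
  apply: (le_trans H2); rewrite mulrAC ler_pdivrMr //.
  by rewrite -(mulrA (e / 4)) ler_pM2l.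
have Dxy : 'D_(x - y) phi z = 'D_(x - arc t) phi z + t ^+ 2 * 'D_w phi z.
  by rewrite xy (derive_dirD _ _ dphi) (derive_dirZ _ _ dphi).
have H3 : `|'D_(x - arc t) phi z| <= e / 4 * t ^+ 2.
  rewrite deriveE // (le_trans (dk _)) // (@le_trans _ _ (k * (dl * t ^+ 2))) //.
    by rewrite ler_pM2l.
  by rewrite mulrA ler_wpM2r // mulrC -ler_pdivlMr.
move: H1 H2 H3; rewrite Dxy -/y /second_coef.
set D := 'D_(x - arc t) phi z; set q := t ^+ 2.
rewrite !ler_norml => /andP[H1 H1'] /andP[H2 H2'] /andP[H3 H3'].
have q0 : 0 <= e * q by rewrite mulr_ge0 // ltW.
have E4 : e / 4 * q = e * q / 4 by ring.
rewrite !E4 in H1 H1' H2 H2' H3 H3'.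
have E2 : q * ('D_w phi z + 2^-1 * 'D_d ('D_d phi) z) =
  q * 'D_w phi z + q / 2 * 'D_d ('D_d phi) z by ring.
rewrite E2; apply/andP; split; lra.
Unshelve. all: by end_near. Qed.

(** The first nonzero coefficient of the expansion of [phi] along the arc
    decides the sign. *)
Lemma near_arc_neg phi : Ck 2 phi z -> phi z <= 0 ->
  (phi z = 0 -> 'D_d phi z <= 0) ->
  (phi z = 0 -> 'D_d phi z = 0 -> second_coef phi < 0) ->
  near_arc (fun _ x => phi x < 0).
Proof.
move=> Cphi p0 p1 p2; set T := second_coef phi in p2.
have H1 := near_arc_expansion Cphi ltr01.
have [pz|pz] := eqVneq (phi z) 0; last first.
  have pz0 : 0 < - phi z by rewrite oppr_gt0 lt_neqAle pz.
  set D := 'D_d phi z.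
  have [nD nD0 DnD] : exists2 nD : R, 0 <= nD & D <= nD by exists `|D| => //; apply: ler_norm.
  have [nT nT0 TnT] : exists2 nT : R, 0 <= nT & T <= nT by exists `|T| => //; apply: ler_norm.
  pose M := nD + nT + 1.
  have M0 : 0 < M by rewrite ltr_pwDr // addr_ge0.
  rewrite /near_arc in H1 *; near=> dl => t x tdl xt; have /andP[t0 tdl'] := tdl.
  have dl1 : dl <= 1 by near: dl; apply: nbhs_right_le.
  have dlM : dl <= - phi z / M by near: dl; apply: nbhs_right_le; rewrite divr_gt0.
  have : `|phi x - phi z - t * 'D_d phi z - t ^+ 2 * T| <= 1 * t ^+ 2.
    by move: t x tdl xt {t0 tdl'}; near: dl; exact: H1.
  have t1 : t <= 1 by rewrite (le_trans (ltW tdl')).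
  have t2 : t ^+ 2 <= t by rewrite expr2 ler_piMr // ltW.
  have t20 : 0 <= t ^+ 2 by rewrite exprn_ge0 // ltW.
  rewrite mul1r ler_norml => /andP[_ H].
  have : t * M < - phi z by rewrite -ltr_pdivlMr // (lt_le_trans tdl').
  have : t * D <= t * nD by rewrite ler_pM2l.
  have : t ^+ 2 * T <= t * nT.
    by rewrite (@le_trans _ _ (t ^+ 2 * nT)) ?ler_wpM2l ?ler_wpM2r.
  rewrite -/D in H; move=> h1 h2; rewrite /M !mulrDr mulr1 => h3; lra.
have {p1} := p1 pz; rewrite le_eqVlt => /orP[/eqP d0|d0].
  have T0 := p2 pz d0.
  have := near_arc_expansion Cphi (e := - T / 2); rewrite divr_gt0 ?oppr_gt0 //.
  move=> /(_ isT) H2.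
  rewrite /near_arc in H2 *; near=> dl => t x tdl xt; have /andP[t0 tdl'] := tdl.
  have : `|phi x - phi z - t * 'D_d phi z - t ^+ 2 * T| <= - T / 2 * t ^+ 2.
    by move: t x tdl xt {t0 tdl'}; near: dl; exact: H2.
  rewrite pz d0 mulr0 !subr0 ler_norml => /andP[_ H].
  have : t ^+ 2 * T < 0 by rewrite pmulr_rlt0 // exprn_gt0.
  have E : - T / 2 * t ^+ 2 = - (t ^+ 2 * T) / 2 by ring.
  rewrite E in H => ?; lra.
rewrite /near_arc in H1 *; near=> dl => t x tdl xt; have /andP[t0 tdl'] := tdl.
have T1 : 0 < `|T| + 1 by rewrite ltr_pwDr.
have dlT : dl <= - 'D_d phi z / (`|T| + 1).
  by near: dl; apply: nbhs_right_le; rewrite divr_gt0 // oppr_gt0.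
have : `|phi x - phi z - t * 'D_d phi z - t ^+ 2 * T| <= 1 * t ^+ 2.
  by move: t x tdl xt {t0 tdl'}; near: dl; exact: H1.
rewrite pz subr0 mul1r ler_norml => /andP[_ H].
have H3 : t * (`|T| + 1) < - 'D_d phi z by rewrite -ltr_pdivlMr // (lt_le_trans tdl').
have H4 : t * (t * (`|T| + 1)) < t * - 'D_d phi z by rewrite ltr_pM2l.
have H5 : t ^+ 2 * T <= t ^+ 2 * `|T| by rewrite ler_wpM2l ?ler_norm // exprn_ge0 // ltW.
have -> : phi x = (phi x - t * 'D_d phi z - t ^+ 2 * T) + t * 'D_d phi z + t ^+ 2 * T by ring.
move: H4; rewrite (_ : t * (t * _) = t ^+ 2 * `|T| + t ^+ 2); last by ring.
rewrite mulrN => ?; lra.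
Unshelve. all: by end_near. Qed.

Lemma near_arc_forall (I : finType) (P : I -> R -> 'rV[R]_N -> Prop) :
  (forall i, near_arc (P i)) -> near_arc (fun t x => forall i, P i t x).
Proof.
move=> H.
have : \forall dl \near 0^'+, forall i t x, 0 < t < dl ->
    `|x - arc t| <= dl * t ^+ 2 -> P i t x by apply: filter_forall => i; exact: H.
by apply: filterS => dl Hdl t x tdl xt i; apply: Hdl.
Qed.

Lemma near_arcI (P Q : R -> 'rV[R]_N -> Prop) :
  near_arc P -> near_arc Q -> near_arc (fun t x => P t x /\ Q t x).
Proof.
rewrite /near_arc => HP HQ; near=> dl => t x tdl xt; split.
  by move: t x tdl xt; near: dl.
by move: t x tdl xt; near: dl.
Unshelve. all: by end_near. Qed.

Lemma near_arc_ex (P : R -> 'rV[R]_N -> Prop) : near_arc P ->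
  exists2 dl : R, 0 < dl & forall t x, 0 < t < dl ->
    `|x - arc t| <= dl * t ^+ 2 -> P t x.
Proof.
move=> HP; have : \forall dl \near (0:R)^'+, 0 < dl by exact: nbhs_right_gt.
by move=> /(filterI HP)/filter_ex[dl [Hdl dl0]]; exists dl.
Qed.

End parabolic_arc.

(** * Second-order necessary conditions for nonlinear programs *)

Section free_families.
Context {K : fieldType} {V : vectType K}.

Lemma span_map_sum (I : eqType) (F : I -> V) (s : seq I) v : uniq s ->
  v \in <<[seq F i | i <- s]>>%VS -> exists k : I -> K, v = \sum_(i <- s) k i *: F i.
Proof.
elim: s v => [|x s IH] v /=.
  by rewrite span_nil memv0 => _ /eqP ->; exists (fun=> 0); rewrite big_nil.
move=> /andP[xs us]; rewrite span_cons => /memv_addP[_ /vlineP[c ->]].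
move=> [w /(IH _ us)[k ->] ->]; exists (fun j => if j == x then c else k j).
rewrite big_cons eqxx; congr (_ + _).
by apply: eq_big_seq => j js; case: eqP => // jx; rewrite -jx js in xs.
Qed.

Lemma free_mapP (I : eqType) (F : I -> V) (s : seq I) : uniq s ->
  free [seq F i | i <- s] <->
  forall k : I -> K, \sum_(i <- s) k i *: F i = 0 -> forall i, i \in s -> k i = 0.
Proof.
elim: s => [|x s IH] /=; first by rewrite nil_free; split.
move=> /andP[xs us]; rewrite free_cons; split.
  move=> /andP[Fx /(IH us).1 fs] k; rewrite big_cons => E.
  have kx : k x = 0.
    apply/eqP; apply/negPn/negP => kx0; move/negP: Fx; apply.
    rewrite -[F x](scalerK kx0) rpredZ //.
    move/eqP: E; rewrite addr_eq0 => /eqP ->; rewrite rpredN.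
    rewrite big_seq; apply: rpred_sum => i si; apply: rpredZ.
    by apply: memv_span; apply: map_f.
  move: E; rewrite kx scale0r add0r => /fs ks i.
  by rewrite inE => /orP[/eqP ->|/ks].
move=> H; apply/andP; split; last first.
  apply/(IH us) => k ks i si.
  have := H (fun j => if j == x then 0 else k j); rewrite big_cons eqxx scale0r add0r.
  rewrite (_ : \sum_(j <- s) _ = \sum_(j <- s) k j *: F j); last first.
    apply: eq_big_seq => j js; case: eqP => // jx.
    by rewrite -jx js in xs.
  move=> /(_ ks i); rewrite inE si orbT => /(_ isT); case: eqP => // ix.
  by rewrite -ix si in xs.
apply/negP => /(span_map_sum us)[k E].
have := H (fun j => if j == x then -1 else k j); rewrite big_cons eqxx scaleN1r.
rewrite (_ : \sum_(j <- s) _ = F x); last first.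
  rewrite E; apply: eq_big_seq => j js; case: eqP => // jx.
  by rewrite -jx js in xs.
rewrite addNr => /(_ erefl x); rewrite mem_head eqxx => /(_ isT)/eqP.
by rewrite oppr_eq0 oner_eq0.
Qed.

End free_families.

Section free_rows.
Context {R : realType} {N P : nat}.

Lemma free_rows (M : 'M[R]_(P, N)) (F : 'I_P -> 'rV[R]_N) :
  (forall i, row i M = F i) -> free [seq F j | j : 'I_P] -> row_free M.
Proof.
move=> MF; rewrite /image_mem => /(free_mapP _ (enum_uniq _)).1 H.
apply: inj_row_free => v; rewrite mulmx_sum_row => E.
apply/rowP => i; rewrite mxE; apply: (H (fun i => v 0 i)); last by rewrite mem_enum.
by rewrite big_enum /= -[RHS]E; apply: eq_bigr => j _; rewrite MF.
Qed.

Lemma rows_free (M : 'M[R]_(P, N)) (F : 'I_P -> 'rV[R]_N) :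
  (forall i, row i M = F i) -> row_free M -> free [seq F j | j : 'I_P].
Proof.
move=> MF fM; rewrite /image_mem; apply/(free_mapP _ (enum_uniq _)) => k.
rewrite big_enum /= => E i _.
have : \row_j k j *m M = 0.
  by rewrite mulmx_sum_row -[RHS]E; apply: eq_bigr => j _; rewrite MF mxE.
rewrite -[RHS](mul0mx _ M) => /(row_free_inj fM)/rowP/(_ i).
by rewrite !mxE.
Qed.

End free_rows.

Lemma mulmx_jac (R : realType) N P (a : 'rV[R]_N -> 'rV[R]_P) z l :
  differentiable a z ->
  l *m jac a z = \row_j dotr l ('D_(delta_mx 0 j) a z).
Proof.
move=> da; apply/rowP => j; rewrite [RHS]mxE deriveEjacobian // -rowE /jac.
move: ('J a z) => J; rewrite mxE; apply: eq_bigr => i _.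
by rewrite !mxE.
Qed.

Section second_order_necessary_conditions.
Context {R : realType} {N P Q : nat}.
Variables (phi : 'rV[R]_N -> R) (a : 'rV[R]_N -> 'rV[R]_P)
  (b : 'rV[R]_N -> 'rV[R]_Q) (z : 'rV[R]_N).
Hypotheses (Cphi : Ck 2 phi z) (Ca : Ck 2 a z) (Cb : Ck 2 b z).

Definition nlp_lagr (l : 'rV[R]_P * 'rV[R]_Q) x : R :=
  phi x + dotr l.1 (a x) + dotr l.2 (b x).

Definition nlp_multipliers : set ('rV[R]_P * 'rV[R]_Q) :=
  [set l | [/\ grad (nlp_lagr l) z = 0, nneg l.2 & dotr l.2 (b z) = 0]].

Let dphi : differentiable phi z := Ck_differentiable Cphi.
Let da : differentiable a z := Ck_differentiable Ca.
Let db : differentiable b z := Ck_differentiable Cb.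

Lemma Ck_nlp_lagr l : Ck 2 (nlp_lagr l) z.
Proof. exact: CkD (CkD Cphi (Ck_dotr l.1 Ca)) (Ck_dotr l.2 Cb). Qed.

Lemma derive_nlp_lagr l v x : differentiable phi x -> differentiable a x ->
  differentiable b x -> 'D_v (nlp_lagr l) x =
    'D_v phi x + dotr l.1 ('D_v a x) + dotr l.2 ('D_v b x).
Proof.
move=> dphix dax dbx; rewrite -!derive_dotr //.
have d1 : derivable (fun x => dotr l.1 (a x)) x v.
  apply: diff_derivable; apply: (@differentiable_comp _ _ _ _ a (dotr l.1)) => //.
  exact/linear_differentiable/rV_linear_continuous.
have d2 : derivable (fun x => dotr l.2 (b x)) x v.
  apply: diff_derivable; apply: (@differentiable_comp _ _ _ _ b (dotr l.2)) => //.
  exact/linear_differentiable/rV_linear_continuous.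
have d0 : derivable phi x v by exact: diff_derivable.
by rewrite -!deriveD //; apply: derivableD.
Qed.

Lemma grad_nlp_lagr_at l x : differentiable phi x -> differentiable a x ->
  differentiable b x ->
  grad (nlp_lagr l) x = grad phi x + l.1 *m jac a x + l.2 *m jac b x.
Proof.
move=> dphix dax dbx; rewrite !mulmx_jac //; apply/rowP => j.
by rewrite mxE derive_nlp_lagr // !mxE.
Qed.

Lemma grad_nlp_lagr l :
  grad (nlp_lagr l) z = grad phi z + l.1 *m jac a z + l.2 *m jac b z.
Proof.
exact: grad_nlp_lagr_at.
Qed.

Lemma quadratic_nlp_lagr l (d : 'cV[R]_N) :
  (d^T *m hess (nlp_lagr l) z *m d) 0 0 =
  'D_(d^T) ('D_(d^T) phi) z + dotr l.1 ('D_(d^T) ('D_(d^T) a) z)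
    + dotr l.2 ('D_(d^T) ('D_(d^T) b) z).
Proof.
rewrite (hess_mulmx d (Ck_nlp_lagr l)).
set v := d^T.
have d0 := Ck_differentiable (Ck_derive v Cphi).
have d1 := Ck_differentiable (Ck_derive v Ca).
have d2 := Ck_differentiable (Ck_derive v Cb).
have E : \forall x \near z, 'D_v (nlp_lagr l) x =
    'D_v phi x + dotr l.1 ('D_v a x) + dotr l.2 ('D_v b x).
  have n0 := Ck_near_differentiable Cphi.
  have n1 := Ck_near_differentiable Ca.
  have n2 := Ck_near_differentiable Cb.
  apply: filterS2 n0 (filterI n1 n2) => x dx [d1x d2x].
  exact: derive_nlp_lagr.
rewrite (near_eq_derive v E).
have e1 : derivable (fun x => dotr l.1 ('D_v a x)) z v.
  apply: diff_derivable; apply: (@differentiable_comp _ _ _ _ ('D_v a) (dotr l.1)) d1 _.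
  exact/linear_differentiable/rV_linear_continuous.
have e2 : derivable (fun x => dotr l.2 ('D_v b x)) z v.
  apply: diff_derivable; apply: (@differentiable_comp _ _ _ _ ('D_v b) (dotr l.2)) d2 _.
  exact/linear_differentiable/rV_linear_continuous.
have e0 : derivable ('D_v phi) z v by exact: diff_derivable.
rewrite -(derive_dotr l.1 v d1) -(derive_dotr l.2 v d2).
rewrite -(deriveD e0 e1) -(deriveD _ e2) //; exact: derivableD.
Qed.

Hypothesis mfcq : MFCQ a b z.

Let row_free_a : row_free (jac a z).
Proof.
case: mfcq => fa _; apply: free_rows fa => i; exact: row_jac.
Qed.

(** [motzkin] is applied to [grad phi] and to the active inequalities whose
    derivative along [d] vanishes, with the second derivatives along [d] as
    right-hand sides.  A solution [w] of the strict system would give a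
    feasible descent arc; the alternative yields Fritz John multipliers, whose
    weight on the objective MFCQ makes positive. *)
Lemma second_order_multiplier (d : 'cV[R]_N) :
  a z = 0 -> npos (b z) ->
  (\forall x \near z, a x = 0 -> npos (b x) -> phi z <= phi x) ->
  jac a z *m d = 0 ->
  (forall i, b z 0 i = 0 -> (grad (fun x => b x 0 i) z *m d) 0 0 <= 0) ->
  (grad phi z *m d) 0 0 <= 0 ->
  exists2 l, nlp_multipliers l & 0 <= (d^T *m hess (nlp_lagr l) z *m d) 0 0.
Proof.
move=> az bz locmin ad bd phid.
have [_ [d0 [ad0 bd0]]] := mfcq.
set v := d^T in ad bd phid *.
have dbi i : differentiable (fun x => b x 0 i) z := Ck_differentiable (Ck_entry 0 i Cb).
have Dad : 'D_v a z = 0.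
  by have := jac_mulmx d da; rewrite ad => /(congr1 trmx); rewrite trmx0 trmxK.
have Dbd i : b z 0 i = 0 -> 'D_v (fun x => b x 0 i) z <= 0.
  by move=> /bd; rewrite grad_mulmx.
have Dphid : 'D_v phi z <= 0 by rewrite -grad_mulmx.
pose C : 'M[R]_(1 + Q, N) := col_mx (grad phi z) (jac b z).
pose beta : 'cV[R]_(1 + Q) := 2^-1 *:
  col_mx ('D_v ('D_v phi) z)%:M ('D_v ('D_v b) z)^T.
pose alpha : 'cV[R]_P := 2^-1 *: ('D_v ('D_v a) z)^T.
pose p (i : 'I_(1 + Q)) := if fintype.split i is inr j then
  (b z 0 j == 0) && ('D_v (fun x => b x 0 j) z == 0) else true.
have [[w [aw cw]]|l [mu [l0 lp ln0 lC lb]]] := @motzkin R _ _ _ C beta p _ alpha row_free_a.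
  exfalso; pose w' := w^T.
  (* The arc with acceleration w' lowers phi and keeps b negative. *)
  have Hphi : near_arc z v w' (fun _ x => phi x - phi z < 0).
    pose psi x := phi x + - phi z.
    have Cpsi : Ck 2 psi z by apply: CkD Cphi (Ck_cst 2 _ z).
    have dpsi u x : differentiable phi x -> 'D_u psi x = 'D_u phi x.
      move=> dx; rewrite [LHS]deriveD ?derive_cst ?addr0 //.
        exact: diff_derivable.
    have ndpsi u : \forall x \near z, 'D_u psi x = 'D_u phi x.
      by apply: filterS (Ck_near_differentiable Cphi) => x; apply: dpsi.
    apply: (near_arc_neg Cpsi); rewrite ?/psi ?subrr //.
      by move=> _; rewrite -/psi dpsi.
    move=> _ _; rewrite -/psi /second_coef dpsi // (near_eq_derive _ (ndpsi v)).
    have := cw (lshift Q 0); rewrite /p (unsplitK (inl _)) => /(_ isT).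
    rewrite /C mul_col_mx col_mxEu grad_mulmx // /beta mxE col_mxEu mxE eqxx mulr1n.
    by rewrite -subr_lt0 opprK.
  have Hb : near_arc z v w' (fun _ x => forall i, b x 0 i < 0).
    apply: near_arc_forall => i.
    apply: (near_arc_neg (phi := fun x => b x 0 i) (Ck_entry 0 i Cb) (bz i) (Dbd i)).
    move=> bi Di; have := cw (rshift 1 i); rewrite /p (unsplitK (inr _)) bi Di !eqxx.
    move=> /(_ isT); rewrite /C mul_col_mx col_mxEd jac_mulmx // -/w' mxE.
    rewrite derive_entry // /beta mxE col_mxEd mxE.
    rewrite derive_entry; last exact: Ck_differentiable (Ck_derive v Cb).
    rewrite (_ : 'D_v (fun x => 'D_v b x 0 i) z = 'D_v ('D_v (fun x => b x 0 i)) z).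
      by rewrite -subr_lt0 opprK.
    apply: near_eq_derive; apply: filterS (Ck_near_differentiable Cb) => x dx.
    by rewrite derive_entry.
  (* On the arc, a vanishes up to o(t^2), and can be corrected within the
     horn. *)
  have [B AB] := row_freeP row_free_a.
  have BA : B^T *m 'J a z = 1%:M by rewrite -[LHS]trmxK trmx_mul trmxK AB trmx1.
  have [k k0 [r r0 Hk]] := strict_diff_correction (Ck1_strict_diff (CkS Ca)) BA.
  have [rho rho0 Hrho] := (near_normP _ _).1 locmin.
  have [dl dl0 Hdl] := near_arc_ex (near_arcI (near_arcI Hphi Hb)
      (near_arc_dist z v w' rho0)).
  have e0 : 0 < dl / k by rewrite divr_gt0.
  have Ha : near_arc z v w' (fun t x => forall j, `|a x 0 j| <= dl / k * t ^+ 2).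
    apply: near_arc_forall => j.
    have := near_arc_expansion v w' (Ck_entry 0 j Ca) e0.
    apply: filterS => dl' H t x tdl xt; have := H t x tdl xt.
    rewrite /second_coef -(derive_entry v 0 j da) -(derive_entry w' 0 j da) Dad az.
    have -> : 'D_v ('D_v (fun x => a x 0 j)) z = 'D_v ('D_v a) z 0 j.
      rewrite [RHS]derive_entry; last exact: Ck_differentiable (Ck_derive v Ca).
      apply: near_eq_derive; apply: filterS (Ck_near_differentiable Ca) => y dy.
      by rewrite derive_entry.
    have := congr1 (fun M : 'cV_P => M j 0) aw; rewrite /= jac_mulmx // -/w'.
    rewrite 4!mxE => ->; rewrite addNr mulr0.
    by rewrite [(0 : 'rV_P) 0 j]mxE mulr0 !subr0.
  have [dl' dl'0 Hdl'] := near_arc_ex (near_arcI Ha (near_arc_dist z v w' r0)).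
  pose t := Num.min dl dl' / 2.
  have m0 : 0 < Num.min dl dl' by rewrite lt_min dl0.
  have t0 : 0 < t by rewrite divr_gt0.
  have tm : t < Num.min dl dl' by rewrite ltr_pdivrMr // ltr_pMr // ltr1n.
  have /andP[tdl tdl'] : (t < dl) && (t < dl') by rewrite -lt_min.
  have t2 : 0 <= t ^+ 2 by rewrite exprn_ge0 // ltW.
  have [||ax xr] := Hdl' t (arc z v w' t); first by rewrite t0.
    by rewrite subrr normr0 mulr_ge0 // ltW.
  have [x xk xa] := Hk _ xr; rewrite az subr0 in xk xa.
  have [||[[px bx] xrho]] := Hdl t x; first by rewrite t0.
    apply: (le_trans xk); rewrite mulrC -ler_pdivlMr // mulrAC.
    apply: mx_norm_le => [|i j]; first by rewrite mulr_ge0 // ltW.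
    by rewrite ord1.
  have := Hrho x xrho xa; rewrite -subr_ge0 leNgt px => /(_ _)/negP; apply => //.
  by move=> i; rewrite ltW.
have lE := hsubmxK l; set l1 := lsubmx l in lE; set l2 := rsubmx l in lE.
have l10 : 0 <= l1 0 0 by rewrite mxE.
have l20 : nneg l2 by move=> i; rewrite mxE.
have l2b i : ~~ ((b z 0 i == 0) && ('D_v (fun x => b x 0 i) z == 0)) -> l2 0 i = 0.
  by move=> bi; rewrite mxE; apply: lp; rewrite /p (unsplitK (inr _)).
have l1g : l1 *m grad phi z = l1 0 0 *: grad phi z.
  by rewrite {1}[l1]mx11_scalar mul_scalar_mx.
move: lC; rewrite -lE mul_row_col l1g => lC.
(* The MFCQ direction d0 excludes a zero weight on the objective. *)
have l1p : 0 < l1 0 0.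
  rewrite lt_neqAle l10 andbT eq_sym; apply/eqP => l100.
  move/eqP: ln0; apply; rewrite -lE.
  have -> : l1 = 0 by rewrite [l1]mx11_scalar l100 raddf0.
  suff -> : l2 = 0 by rewrite row_mx0.
  move: lC; rewrite l100 scale0r add0r => /(congr1 (fun M => (M *m d0) 0 0)).
  rewrite mulmxDl -!mulmxA mul0mx jac_mulmx // [jac a z *m _](jac_mulmx _ da).
  have -> : 'D_(d0^T) a z = 0.
    apply/rowP => j; rewrite derive_entry // -grad_mulmx ?ad0 ?mxE //.
    exact: Ck_differentiable (Ck_entry 0 j Ca).
  rewrite trmx0 mulmx0 addr0 [RHS]mxE -dotrE => S0.
  apply/rowP => i; rewrite [RHS]mxE.
  have Dbi j : b z 0 j = 0 -> 'D_(d0^T) b z 0 j < 0.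
    by move=> bj; rewrite derive_entry // -grad_mulmx //; apply: bd0.
  have S0le j : l2 0 j * 'D_(d0^T) b z 0 j <= 0.
    have [/andP[/eqP bj _]|/l2b ->] := boolP ((b z 0 j == 0) && ('D_v (fun x => b x 0 j) z == 0)).
      by rewrite mulr_ge0_le0 // ltW // Dbi.
    by rewrite mul0r.
  have /eqP := dotr_terms_eq0 S0le S0 i; rewrite mulf_eq0 => /orP[/eqP //|/eqP Di].
  apply: l2b; apply/negP => /andP[/eqP bi _].
  by have := Dbi i bi; rewrite Di ltxx.
pose c := (l1 0 0)^-1.
have c0 : 0 < c by rewrite invr_gt0.
exists (c *: mu, c *: l2); first split => /=.
- rewrite grad_nlp_lagr /= -!scalemxAl -addrA -scalerDr.
  rewrite -[grad phi z](scalerK (lt0r_neq0 l1p)) -scalerDr addrA.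
  by rewrite [X in _ *: X]addrAC lC scaler0.
- by move=> i; rewrite mxE mulr_ge0 // ltW.
- rewrite dotrZl [dotr _ _]big1 ?mulr0 // => i _.
  have [/andP[/eqP -> _]|/l2b ->] := boolP ((b z 0 i == 0) && ('D_v (fun x => b x 0 i) z == 0)).
    by rewrite mulr0.
  by rewrite mul0r.
rewrite quadratic_nlp_lagr /= -/v !dotrZl.
move: lb; rewrite -lE /beta /alpha -!scalemxAr -scalerDr mxE pmulr_rge0 ?invr_gt0 //.
rewrite mul_row_col mxE [X in X + _]mxE -!dotrE.
have -> : (l1 *m ('D_v ('D_v phi) z)%:M) 0 0 = l1 0 0 * 'D_v ('D_v phi) z.
  by rewrite {1}[l1]mx11_scalar -scalar_mxM mxE eqxx mulr1n.
move=> H; rewrite -(pmulr_rge0 _ l1p) !mulrDr !mulrA mulfV ?lt0r_neq0 // !mul1r.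
by rewrite addrAC.
Qed.

End second_order_necessary_conditions.

(** * The multiplier set of a nonlinear program *)

Section convexity.
Context {R : realType}.

Lemma convex_setP (M : lmodType R) (A : set M) : convex_set A <->
  forall x y (t : R), 0 <= t <= 1 -> A x -> A y -> A (t *: x + (1 - t) *: y).
Proof.
split=> [cA x y t /andP[t0 t1] Ax Ay|cA x y t /set_mem Ax /set_mem Ay].
  have := cA x y (Itv01 t0 t1) (mem_set Ax) (mem_set Ay).
  by move/set_mem.
apply/mem_set; apply: cA => //; apply/andP; split.
  exact: ge0.
exact: le1.
Qed.

Definition affine_map (M M' : lmodType R) (T : M -> M') : Prop :=
  forall x y (t : R), T (t *: x + (1 - t) *: y) = t *: T x + (1 - t) *: T y.

Lemma convex_image (M M' : lmodType R) (T : M -> M') (A : set M) :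
  affine_map T -> convex_set A -> convex_set (T @` A).
Proof.
move=> aT /convex_setP cA; apply/convex_setP => _ _ t t01 [x Ax <-] [y Ay <-].
by exists (t *: x + (1 - t) *: y); [apply: cA|rewrite aT].
Qed.

End convexity.

Section maximum.
Context {R : realType}.

Lemma compact_max_ge0 (T : topologicalType) (A : set T) (phi : T -> R) :
  compact A -> continuous phi -> (exists2 z, A z & 0 <= phi z) -> max_ge0 A phi.
Proof.
move=> cA cphi [z Az z0].
have [|||c Ac cmax] := @compact_EVT_max T R phi A.
- by exists z.
- exact: cA.
- exact: continuous_subspaceT.
exists c; first exact: set_mem.
split; first by move=> z' Az'; apply/cmax/mem_set.
exact/(le_trans z0)/cmax/mem_set.
Qed.

End maximum.

Section multiplier_set.
Context {R : realType} {N P Q : nat}.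
Variables (phi : 'rV[R]_N -> R) (a : 'rV[R]_N -> 'rV[R]_P)
  (b : 'rV[R]_N -> 'rV[R]_Q) (z : 'rV[R]_N).
Hypotheses (Cphi : Ck 2 phi z) (Ca : Ck 2 a z) (Cb : Ck 2 b z).

Lemma nlp_multipliers_convex : convex_set (nlp_multipliers phi a b z).
Proof.
apply/convex_setP => l l' t /andP[t0 t1] [gl ln lb] [gl' ln' lb'].
have dphi := Ck_differentiable Cphi; have da := Ck_differentiable Ca.
have db := Ck_differentiable Cb.
split => /=.
- rewrite grad_nlp_lagr //= !mulmxDl -!scalemxAl.
  move: gl gl'; rewrite !grad_nlp_lagr // => gl gl'.
  have -> : grad phi z = t *: grad phi z + (1 - t) *: grad phi z.
    by rewrite -scalerDl addrC subrK scale1r.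
  rewrite [t *: _ + _ + _]addrACA -!scalerDr [_ + _ + (_ + _)]addrACA -!scalerDr.
  by rewrite gl gl' !scaler0 addr0.
- by move=> i; rewrite 3!mxE addr_ge0 // mulr_ge0 // subr_ge0.
- by rewrite dotrDl !dotrZl lb lb' !mulr0 addr0.
Qed.

Lemma quadratic_nlp_lagr_continuous (d : 'cV[R]_N) :
  continuous (fun l => (d^T *m hess (nlp_lagr phi a b l) z *m d) 0 0).
Proof.
rewrite (_ : (fun l => _) = fun l : 'rV[R]_P * 'rV[R]_Q =>
  'D_(d^T) ('D_(d^T) phi) z + dotr ('D_(d^T) ('D_(d^T) a) z) l.1
    + dotr ('D_(d^T) ('D_(d^T) b) z) l.2); last first.
  by apply/funext => l; rewrite quadratic_nlp_lagr // !(dotrC _ l.1) !(dotrC _ l.2).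
move=> l.
have c1 : continuous (dotr ('D_(d^T) ('D_(d^T) a) z)) by exact: rV_linear_continuous.
have c2 : continuous (dotr ('D_(d^T) ('D_(d^T) b) z)) by exact: rV_linear_continuous.
apply: (@continuousD _ _ _ (fun l : 'rV[R]_P * 'rV[R]_Q => _ + dotr _ l.1) (fun l => dotr _ l.2)).
  apply: (@continuousD _ _ _ (fun=> _) (fun l : 'rV[R]_P * 'rV[R]_Q => dotr _ l.1)).
    exact: cvg_cst.
  by apply: continuous_comp; [exact: cvg_fst|exact: c1].
by apply: continuous_comp; [exact: cvg_snd|exact: c2].
Qed.

Hypotheses (mfcq : MFCQ a b z) (bz : npos (b z)).

(** Pairing stationarity with the MFCQ direction [d] leaves only the active
    inequality multipliers, each with a negative coefficient, which bounds
    them.  The equality multipliers are an affine function of these since the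
    rows of [jac a z] are independent. *)
Lemma nlp_multipliers_compact : compact (nlp_multipliers phi a b z).
Proof.
have dphi := Ck_differentiable Cphi; have da := Ck_differentiable Ca.
have db := Ck_differentiable Cb.
have [fa [d [ad bd]]] := mfcq.
have rfa : row_free (jac a z) by apply: free_rows fa => i; exact: row_jac.
have [A' aA'] := row_freeP rfa.
have dbi i : differentiable (fun x => b x 0 i) z := Ck_differentiable (Ck_entry 0 i Cb).
(* The right inverse A' of jac a z solves stationarity for the equality
   multipliers. *)
pose mult (lG : 'rV[R]_Q) : 'rV[R]_P := - ((grad phi z + lG *m jac b z) *m A').
pose S : set 'rV[R]_Q := [set lG | nneg lG /\
  (dotr (b z) lG = 0 /\ forall j,
     (grad phi z + lG *m jac b z + mult lG *m jac a z) 0 j = 0)].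
have Cmult x : Ck 0 mult x.
  have cL : continuous (mulmxr (- A') : 'rV[R]_N -> 'rV[R]_P) by exact: rV_linear_continuous.
  rewrite (_ : mult = fun lG => (grad phi z + lG *m jac b z) *m - A').
    apply: (@Ck_post _ _ _ _ 0 (mulmxr (- A')) cL (fun lG => grad phi z + lG *m jac b z)).
    by apply: CkD; [exact: Ck_cst|exact: (Ck_linear _ (mulmxr (jac b z)))].
  by apply/funext => lG; rewrite /mult mulmxN.
have nS : nlp_multipliers phi a b z = (fun lG => (mult lG, lG)) @` S.
  apply/seteqP; split=> [[lH lG] /= [gl l0 lb]|_ [lG [l0 [lb lE]] <-]].
    move: gl; rewrite grad_nlp_lagr //= => gl.
    have multE : mult lG = lH.
      apply/eqP; rewrite /mult eq_sym -addr_eq0 -{1}[lH]mulmx1 -aA' mulmxA -mulmxDl.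
      by rewrite addrCA addrA gl mul0mx.
    exists lG; last by rewrite multE.
    by split=> //; split; [rewrite dotrC|move=> j; rewrite multE addrAC gl mxE].
  split=> //=; last by rewrite dotrC.
  by rewrite grad_nlp_lagr //= addrAC; apply/rowP => j; rewrite lE mxE.
rewrite nS; apply: continuous_compact.
  apply: continuous_subspaceT => x.
  apply: (@cvg_pair _ _ _ (nbhs x) (nbhs (mult x)) (nbhs x)); last exact: cvg_id.
  exact: (Ck_continuous (Cmult x)).
pose M := \sum_i `|(grad phi z *m d) 0 0 / (grad (fun x => b x 0 i) z *m d) 0 0|.
apply: (@compact_rV _ _ _ M).
  move=> lG SlG i; have [l0 [lb lE]] := SlG.
  have li0 j : b z 0 j != 0 -> lG 0 j = 0.
    have lble k : b z 0 k * lG 0 k <= 0 by rewrite mulr_le0_ge0.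
    move=> bj; have /eqP := dotr_terms_eq0 lble lb j.
    by rewrite mulf_eq0 (negbTE bj) => /eqP.
  have E : (grad phi z *m d) 0 0 + \sum_j lG 0 j * (grad (fun x => b x 0 j) z *m d) 0 0 = 0.
    have : ((grad phi z + lG *m jac b z + mult lG *m jac a z) *m d) 0 0 = 0.
      by rewrite (_ : _ + _ + _ = 0) ?mul0mx ?mxE //; apply/rowP => j; rewrite lE mxE.
    rewrite mulmxDl -mulmxA.
    have -> : jac a z *m d = 0.
      by apply/colP => j; rewrite [RHS]mxE -(ad j) -row_jac // -row_mul [RHS]mxE.
    rewrite mulmx0 addr0 mulmxDl -mulmxA mxE => E; rewrite -[RHS]E; congr (_ + _).
    rewrite mxE; apply: eq_bigr => j _; rewrite -row_jac // -row_mul [in RHS]mxE.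
    by rewrite [(row j _) 0 0]mxE mxE.
  rewrite ger0_norm // /M (bigD1 i) //=.
  rewrite -[leLHS]addr0 lerD //; last by apply: sumr_ge0.
  have [bi|/li0 ->//] := eqVneq (b z 0 i) 0.
  have Bi := bd i bi; set B := (grad _ z *m d) 0 0 in Bi *.
  have nB : 0 < - B by rewrite oppr_gt0.
  have BN : B != 0 by rewrite lt_eqF.
  rewrite normrM normfV (ltr0_norm Bi) ler_pdivlMr //.
  have : - (lG 0 i * B) <= (grad phi z *m d) 0 0.
    rewrite -subr_ge0 opprK.
    have /eqP := E; rewrite (bigD1 i) //= -/B addrA addr_eq0 => /eqP ->.
    rewrite oppr_ge0; apply: sumr_le0 => j _.
    have [bj|/li0 ->] := eqVneq (b z 0 j) 0; last by rewrite mul0r.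
    by apply: mulr_ge0_le0; [apply: l0|apply/ltW/bd].
  by rewrite mulrN => /le_trans; apply; apply: ler_norm.
apply: closedI; first by apply: closed_forall => i;
  apply: closed_preimage_ge0; apply: coord_continuous.
apply: closedI.
  by apply: closed_preimage_eq0; apply: rV_linear_continuous.
apply: closed_forall => j; apply: closed_preimage_eq0 => x.
have C0 : Ck 0 (fun lG => (grad phi z + lG *m jac b z + mult lG *m jac a z)) x.
  apply: CkD; first by apply: CkD; [exact: Ck_cst|exact: (Ck_linear _ (mulmxr (jac b z)))].
  apply: (@Ck_post _ _ _ _ 0 (mulmxr (jac a z)) _ mult) => //.
  exact: rV_linear_continuous.
exact: Ck_continuous (Ck_entry 0 j C0).
Qed.

End multiplier_set.

(** * Elimination of variables defined by an implicit equation *)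

Section second_derivative_of_composition.
Context {R : realType}.

Lemma derive_dotr2 (V : normedModType R) k (a b : V -> 'rV[R]_k) z v :
  differentiable a z -> differentiable b z ->
  'D_v (fun x => dotr (a x) (b x)) z = dotr ('D_v a z) (b z) + dotr (a z) ('D_v b z).
Proof.
move=> da db.
rewrite (_ : (fun x => _) = \sum_(i < k) (fun x => a x 0 i * b x 0 i)); last first.
  by apply/funext => x; rewrite fct_sumE.
have dai i : derivable (fun x => a x 0 i) z v.
  apply: diff_derivable; apply: (@differentiable_comp _ _ _ _ a (fun M : 'rV_k => M 0 i : R)) => //.
  exact: differentiable_coord.
have dbi i : derivable (fun x => b x 0 i) z v.
  apply: diff_derivable; apply: (@differentiable_comp _ _ _ _ b (fun M : 'rV_k => M 0 i : R)) => //.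
  exact: differentiable_coord.
rewrite derive_sum => [|i]; last exact: derivableM.
rewrite -big_split; apply: eq_bigr => i _ /=.
rewrite [LHS](deriveM (dai i) (dbi i)) !derive_entry //.
by rewrite addrC; congr (_ + _); rewrite [LHS]mulrC.
Qed.

Lemma derive_grad N (phi : 'rV[R]_N -> R) z v : differentiable phi z ->
  'D_v phi z = dotr v (grad phi z).
Proof.
move=> dphi; rewrite -[v in LHS]trmxK -grad_mulmx // dotrC dotrE.
by congr ((_ *m _) 0 0).
Qed.

(** The second derivative of [L \o c] has the additional term [dotr (grad L)
    c''], which vanishes at a critical point of [L]. *)
Lemma hess_comp n N (L : 'rV[R]_N -> R) (c : 'rV[R]_n -> 'rV[R]_N) x (d : 'cV[R]_n) :
  Ck 2 c x -> Ck 2 L (c x) -> grad L (c x) = 0 ->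
  (d^T *m hess (fun x => L (c x)) x *m d) 0 0 =
  ((jac c x *m d)^T *m hess L (c x) *m (jac c x *m d)) 0 0.
Proof.
move=> Cc CL gL.
have CLc : Ck 2 (fun x => L (c x)) x by exact: Ck_comp1.
rewrite (hess_mulmx _ CLc) (hess_mulmx _ CL) jac_mulmx; last exact: Ck_differentiable Cc.
rewrite trmxK; set v := d^T; set w := 'D_v c x.
have cc : c y @[y --> x] --> c x by exact: Ck_continuous Cc.
have dL : \forall y \near x, differentiable L (c y).
  exact: cc (Ck_near_differentiable CL).
have dc := Ck_near_differentiable Cc.
have dDc : differentiable ('D_v c) x := Ck_differentiable (Ck_derive v Cc).
have dcx : differentiable c x by exact: nbhs_singleton dc.
have dg : differentiable (grad L) (c x) := Ck_differentiable (Ck_grad CL).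
have dgc : differentiable (fun y => grad L (c y)) x.
  exact: (@differentiable_comp _ _ _ _ c (grad L)).
have -> : 'D_v ('D_v (fun x => L (c x))) x = 'D_v (fun y => dotr ('D_v c y) (grad L (c y))) x.
  apply: near_eq_derive; apply: filterS2 dc dL => y dcy dLy.
  by rewrite derive_comp // derive_grad.
rewrite derive_dotr2 // gL dotr0r add0r (derive_comp v dcx dg) -/w.
have -> : 'D_w ('D_w L) (c x) = 'D_w (fun u => dotr w (grad L u)) (c x).
  apply: near_eq_derive; apply: filterS (Ck_near_differentiable CL) => u du.
  by rewrite derive_grad.
by rewrite derive_dotr.
Qed.

Lemma jac_comp n N P (a : 'rV[R]_N -> 'rV[R]_P) (c : 'rV[R]_n -> 'rV[R]_N) x :
  differentiable c x -> differentiable a (c x) ->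
  jac (fun x => a (c x)) x = jac a (c x) *m jac c x.
Proof.
move=> dc da; apply/trmx_inj; rewrite trmx_mul !trmxK.
have dac : differentiable (fun x => a (c x)) x by exact: (@differentiable_comp _ _ _ _ c a).
apply/row_matrixP => i; rewrite [LHS]rowE [RHS]rowE.
apply: etrans (esym (deriveEjacobian _ dac)) _.
by rewrite derive_comp // !deriveEjacobian // mulmxA.
Qed.

Lemma grad_comp n N (a : 'rV[R]_N -> R) (c : 'rV[R]_n -> 'rV[R]_N) x :
  differentiable c x -> differentiable a (c x) ->
  grad (fun x => a (c x)) x = grad a (c x) *m jac c x.
Proof.
move=> dc da; apply/rowP => i; rewrite mxE derive_comp // derive_grad // dotrC dotrE.
by rewrite deriveEjacobian // trmx_mul trmx_delta mulmxA -colE [LHS]mxE.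
Qed.

End second_derivative_of_composition.

Section reduction.
Context {R : realType} {n N p q : nat}.
Variables (F : 'rV[R]_(n + N) -> R) (H : 'rV[R]_(n + N) -> 'rV[R]_p)
  (G : 'rV[R]_(n + N) -> 'rV[R]_q) (K : 'rV[R]_(n + N) -> 'rV[R]_N)
  (v : 'rV[R]_n -> 'rV[R]_N) (x0 : 'rV[R]_n).

Definition graph_map (x : 'rV[R]_n) : 'rV[R]_(n + N) := row_mx x (v x).
Local Notation c := graph_map.
Local Notation u0 := (c x0).

Definition full_eq u : 'rV[R]_(p + N) := row_mx (H u) (K u).

Local Notation Fc := (fun x => F (c x)).
Local Notation Hc := (fun x => H (c x)).
Local Notation Gc := (fun x => G (c x)).

Hypotheses (CF : Ck 2 F u0) (CH : Ck 2 H u0) (CG : Ck 2 G u0) (CK : Ck 2 K u0).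
Hypothesis Cv : Ck 2 v x0.
Hypothesis Kc : \forall x \near x0, K (c x) = 0.
Hypothesis Kunit : dsubmx ('J K u0) \in unitmx.

Lemma Ck_graph_map : Ck 2 c x0.
Proof. by apply: Ck_row_mx => //; apply: Ck_id. Qed.

Let dc : differentiable c x0 := Ck_differentiable Ck_graph_map.
Let dF : differentiable F u0 := Ck_differentiable CF.
Let dH : differentiable H u0 := Ck_differentiable CH.
Let dG : differentiable G u0 := Ck_differentiable CG.
Let dK : differentiable K u0 := Ck_differentiable CK.

Lemma Ck_full_eq : Ck 2 full_eq u0.
Proof. exact: Ck_row_mx. Qed.

Lemma jac_graph_map : jac c x0 = col_mx 1%:M (jac v x0).
Proof.
apply/trmx_inj; rewrite tr_col_mx !trmxK trmx1.
apply/row_matrixP => i; rewrite [LHS]rowE [RHS]rowE.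
apply: etrans (esym (deriveEjacobian _ dc)) _.
have dv : differentiable v x0 := Ck_differentiable Cv.
by rewrite derive_row_mx // derive_id mul_mx_row mulmx1 deriveEjacobian.
Qed.

Lemma jac_full_eq : jac full_eq u0 = col_mx (jac H u0) (jac K u0).
Proof.
have df : differentiable full_eq u0 := Ck_differentiable Ck_full_eq.
apply/trmx_inj; rewrite tr_col_mx !trmxK.
apply/row_matrixP => i; rewrite [LHS]rowE [RHS]rowE.
apply: etrans (esym (deriveEjacobian _ df)) _.
by rewrite derive_row_mx // mul_mx_row !deriveEjacobian.
Qed.

Lemma jac_K_graph : jac K u0 *m jac c x0 = 0.
Proof.
rewrite -jac_comp //; apply/trmx_inj; rewrite trmxK trmx0.
have dKc : differentiable (fun x => K (c x)) x0 by exact: (@differentiable_comp _ _ _ _ c K).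
apply/row_matrixP => i; rewrite [LHS]rowE [RHS]rowE mulmx0.
apply: etrans (esym (deriveEjacobian _ dKc)) _.
by rewrite (near_eq_derive _ Kc) derive_cst.
Qed.

Let Kv : 'M[R]_N := rsubmx (jac K u0).

Let uKv : Kv \in unitmx.
Proof. by rewrite /Kv /jac -trmx_dsub unitmx_tr. Qed.

(** The only multiplier of [K = 0] that cancels the last [N] entries of [rho]. *)
Definition adjoint_multiplier (rho : 'rV[R]_(n + N)) : 'rV[R]_N :=
  - (rsubmx rho *m invmx (rsubmx (jac K u0))).

(** The last [N] entries of [rho + lK *m jac K u0] determine [lK], and once
    they vanish the first [n] entries are tested by the tangent directions of
    the graph of [v]. *)
Lemma stationary_reduced (rho : 'rV[R]_(n + N)) (lK : 'rV[R]_N) :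
  rho + lK *m jac K u0 = 0 <->
  lK = adjoint_multiplier rho /\ rho *m jac c x0 = 0.
Proof.
split=> [E|[-> E]].
  split; last first.
    have := congr1 (mulmxr (jac c x0)) E; rewrite /= mul0mx mulmxDl -mulmxA.
    by rewrite jac_K_graph mulmx0 addr0.
  have := congr1 rsubmx E; rewrite linearD /= linear0 -mulmx_rsub -/Kv => /eqP.
  rewrite addrC addr_eq0 => /eqP E'.
  by rewrite /adjoint_multiplier -/Kv -mulNmx -E' mulmxK.
set s := rho + _.
have sv : rsubmx s = 0.
  by rewrite /s linearD /= -mulmx_rsub -/Kv mulNmx mulmxKV // subrr.
have sE : s = row_mx (lsubmx s) 0 by rewrite -sv hsubmxK.
have : s *m jac c x0 = 0.
  by rewrite /s mulmxDl -mulmxA jac_K_graph mulmx0 addr0.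
by rewrite sE jac_graph_map mul_row_col mulmx1 mul0mx addr0 => ->; rewrite row_mx0.
Qed.

(** The graph of [v] is locally the zero set of [K], and the first [n] entries
    of a kernel vector determine the others. *)
Lemma tangent_reduced (d : 'cV[R]_(n + N)) :
  jac K u0 *m d = 0 <-> d = jac c x0 *m usubmx d.
Proof.
split=> [E|->]; last by rewrite mulmxA jac_K_graph mul0mx.
have : jac K u0 *m (d - jac c x0 *m usubmx d) = 0.
  by rewrite mulmxBr E mulmxA jac_K_graph mul0mx subrr.
have -> : d - jac c x0 *m usubmx d = col_mx 0 (dsubmx d - jac v x0 *m usubmx d).
  rewrite -{1}[d]vsubmxK jac_graph_map mul_col_mx mul1mx.
  by rewrite opp_col_mx add_col_mx subrr.
rewrite -[jac K u0]hsubmxK mul_row_col mulmx0 add0r -/Kv => E'.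
have : dsubmx d - jac v x0 *m usubmx d = 0 by rewrite -[LHS](mulKmx uKv) E' mulmx0.
move/eqP; rewrite subr_eq0 => /eqP E2.
by rewrite jac_graph_map mul_col_mx mul1mx -E2 vsubmxK.
Qed.

(** A vanishing combination of the reduced equality gradients extends to one
    of the full gradients by the adjoint multiplier.  The direction of MFCQ is
    tangent to the graph, so it comes from its first [n] entries. *)
Lemma MFCQ_reduced : MFCQ full_eq G u0 -> MFCQ Hc Gc x0.
Proof.
have df : differentiable full_eq u0 := Ck_differentiable Ck_full_eq.
have dGi i : differentiable (fun u => G u 0 i) u0 := Ck_differentiable (Ck_entry 0 i CG).
have dHc : differentiable Hc x0 by exact: (@differentiable_comp _ _ _ _ c H).
move=> [fe [d [ed Gd]]]; split.
  apply: (@rows_free _ _ _ (jac Hc x0)) => [i|]; first exact: row_jac.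
  have rf : row_free (jac full_eq u0) by apply: free_rows fe => i; exact: row_jac.
  apply: inj_row_free => al; rewrite jac_comp // mulmxA => E.
  have := (stationary_reduced (al *m jac H u0) _).2 (conj erefl E).
  rewrite -mul_row_col -jac_full_eq -[RHS](mul0mx _ (jac full_eq u0)).
  by move/(row_free_inj rf); rewrite -row_mx0 => /eq_row_mx[].
have : jac full_eq u0 *m d = 0.
  by apply/colP => j; rewrite [RHS]mxE -(ed j) -row_jac // -row_mul [RHS]mxE.
rewrite jac_full_eq mul_col_mx -col_mx0 => /eq_col_mx[Hd /tangent_reduced dE].
exists (usubmx d); split=> [j|i Gi].
  rewrite -row_jac // jac_comp // -row_mul -mulmxA -dE Hd.
  by rewrite mxE mxE.
rewrite (grad_comp dc (dGi i)) -mulmxA -dE; exact: Gd.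
Qed.

Definition lift_multiplier (l : 'rV[R]_p * 'rV[R]_q) : 'rV[R]_(p + N) * 'rV[R]_q :=
  (row_mx l.1 (adjoint_multiplier
     (grad F u0 + l.1 *m jac H u0 + l.2 *m jac G u0)), l.2).

Definition drop_multiplier (l : 'rV[R]_(p + N) * 'rV[R]_q) : 'rV[R]_p * 'rV[R]_q :=
  (lsubmx l.1, l.2).

Lemma lift_multiplierP l :
  nlp_multipliers Fc Hc Gc x0 l <-> nlp_multipliers F full_eq G u0 (lift_multiplier l).
Proof.
have CFc : Ck 2 Fc x0 by apply: Ck_comp1 => //; exact: Ck_graph_map.
have CHc : Ck 2 Hc x0 by apply: Ck_comp => //; exact: Ck_graph_map.
have CGc : Ck 2 Gc x0 by apply: Ck_comp => //; exact: Ck_graph_map.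
set rho := grad F u0 + l.1 *m jac H u0 + l.2 *m jac G u0.
have gc : grad (nlp_lagr Fc Hc Gc l) x0 = rho *m jac c x0.
  rewrite (grad_nlp_lagr CFc CHc CGc) (grad_comp dc dF) (jac_comp dc dH) (jac_comp dc dG).
  by rewrite !mulmxA -!mulmxDl.
have gf : grad (nlp_lagr F full_eq G (lift_multiplier l)) u0 =
    rho + adjoint_multiplier rho *m jac K u0.
  rewrite (grad_nlp_lagr CF Ck_full_eq CG) jac_full_eq mul_row_col /= -/rho.
  by set A := adjoint_multiplier rho *m _; rewrite addrA [LHS]addrAC.
rewrite /nlp_multipliers /= gc gf.
split=> [[E ? ?]|[/stationary_reduced[_ E] ? ?]]; split => //.
exact/stationary_reduced.
Qed.

Lemma multiplier_lifts l : nlp_multipliers F full_eq G u0 l ->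
  l = lift_multiplier (drop_multiplier l).
Proof.
case: l => l1 lG [/= E _ _]; move: E; rewrite (grad_nlp_lagr CF Ck_full_eq CG).
rewrite /lift_multiplier /drop_multiplier /= jac_full_eq.
rewrite -{1}[l1]hsubmxK mul_row_col addrA [X in X = 0 -> _]addrAC => /stationary_reduced[E _].
by rewrite -E hsubmxK.
Qed.

(** [K] vanishes along the graph, so both Lagrangians agree there, and the
    full one is stationary at [u0]; hence [hess_comp] applies. *)
Lemma quadratic_reduced l (d : 'cV[R]_n) : nlp_multipliers Fc Hc Gc x0 l ->
  (d^T *m hess (nlp_lagr Fc Hc Gc l) x0 *m d) 0 0 =
  ((jac c x0 *m d)^T *m hess (nlp_lagr F full_eq G (lift_multiplier l)) u0 *m
     (jac c x0 *m d)) 0 0.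
Proof.
move=> /lift_multiplierP[gL _ _].
have CL := Ck_nlp_lagr CF Ck_full_eq CG (lift_multiplier l).
apply: etrans _ (hess_comp d Ck_graph_map CL gL).
have CFc : Ck 2 Fc x0 by apply: Ck_comp1 => //; exact: Ck_graph_map.
have CHc : Ck 2 Hc x0 by apply: Ck_comp => //; exact: Ck_graph_map.
have CGc : Ck 2 Gc x0 by apply: Ck_comp => //; exact: Ck_graph_map.
have CLc : Ck 2 (fun x => nlp_lagr F full_eq G (lift_multiplier l) (c x)) x0.
  exact: Ck_comp1 Ck_graph_map CL.
apply: etrans (hess_mulmx d (Ck_nlp_lagr CFc CHc CGc l)) _.
apply: etrans _ (esym (hess_mulmx d CLc)).
apply: near_eq_derive; apply: filterS (near_join Kc) => x Kcx.
apply: near_eq_derive; apply: filterS Kcx => y Kcy.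
rewrite /nlp_lagr /lift_multiplier /= /full_eq Kcy; congr (_ + _ + _).
by rewrite !dotrE tr_row_mx mul_row_col trmx0 mulmx0 addr0.
Qed.

End reduction.

(** * Euclidean balls, the projection on the orthant, and Finsler's lemma *)

Section euclidean_norm.
Context {R : realType} {k : nat}.
Implicit Types u v : 'rV[R]_k.

Lemma dotr_norm_le u v : `|dotr u v| <= k%:R * (`|u| * `|v|).
Proof.
rewrite (le_trans (ler_norm_sum _ _ _)) //.
have -> : k%:R * (`|u| * `|v|) = \sum_(i < k) `|u| * `|v|.
  by rewrite sumr_const card_ord -[RHS]mulr_natl.
by apply: ler_sum => i _; rewrite normrM ler_pM // mx_entry_le.
Qed.

Lemma enorm_le_enorm u v : (enorm u <= enorm v) = (dotr u u <= dotr v v).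
Proof. by rewrite /enorm ler_sqrt // dotr_ge0. Qed.

Lemma norm_le_enorm v : `|v| <= enorm v.
Proof.
apply: mx_norm_le => [|i j]; first exact: sqrtr_ge0.
rewrite ord1 -sqrtr_sqr ler_sqrt ?dotr_ge0 // /dotr (bigD1 j) //= expr2 lerDl.
by apply: sumr_ge0 => l _; rewrite -expr2 sqr_ge0.
Qed.

Lemma enorm_le_norm v : enorm v <= k.+1%:R * `|v|.
Proof.
rewrite -[leRHS]ger0_norm ?mulr_ge0 // -sqrtr_sqr ler_sqrt ?sqr_ge0 //.
rewrite (le_trans (ler_norm _)) // (le_trans (dotr_norm_le _ _)) //.
rewrite exprMn -[`|v| * _]expr2 ler_wpM2r ?sqr_ge0 //.
by rewrite expr2 -natrM ler_nat (leq_trans (leqnSn k)) // leq_pmulr.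
Qed.

Lemma near_eball (c : 'rV[R]_k) (e : R) : 0 < e -> \forall x \near c, eball c e x.
Proof.
move=> e0; apply/near_normP; exists (e / k.+1%:R); first by rewrite divr_gt0.
move=> x xc; rewrite /eball /= (le_trans (enorm_le_norm _)) //.
by rewrite mulrC -ler_pdivlMr // ltW.
Qed.

Lemma near_eballP (c : 'rV[R]_k) (P : 'rV[R]_k -> Prop) :
  (\forall x \near c, P x) -> exists2 d : R, 0 < d & forall x, eball c d x -> P x.
Proof.
move=> /near_normP[d d0 Pd]; exists (d / 2); first by rewrite divr_gt0.
move=> x xc; apply: Pd; rewrite (le_lt_trans (norm_le_enorm _)) //.
by rewrite (le_lt_trans xc) // ltr_pdivrMr // ltr_pMr // ltr1n.
Qed.

(** The componentwise minimum satisfies the obtuse angle inequality [key] with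
    every point of the orthant, which makes it the unique nearest point. *)
Lemma eproj_npos (z : 'rV[R]_k) : eproj (@npos R k) z = \row_i Num.min (z 0 i) 0.
Proof.
set w := \row_i _.
have wneg : npos w by move=> i; rewrite mxE ge_min lexx orbT.
have key w' : npos w' -> dotr (z - w) (z - w) + dotr (w - w') (w - w') <=
    dotr (z - w') (z - w').
  move=> w'neg; rewrite /dotr -big_split /=; apply: ler_sum => i _.
  have -> : (z - w) 0 i = z 0 i - Num.min (z 0 i) 0 by rewrite !mxE.
  have -> : (w - w') 0 i = Num.min (z 0 i) 0 - w' 0 i by rewrite !mxE.
  have -> : (z - w') 0 i = z 0 i - w' 0 i by rewrite !mxE.
  have := w'neg i; set a := z 0 i; set b := w' 0 i => b0.
  have [a0|a0] := leP a 0; first by rewrite subrr mul0r add0r.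
  rewrite subr0 sub0r mulrNN -subr_ge0.
  have -> : (a - b) * (a - b) - (a * a + b * b) = 2 * (a * - b) by ring.
  by rewrite !mulr_ge0 // ?oppr_ge0 // ltW.
have wmin : argmin (fun w' => enorm (z - w')) (@npos R k) w.
  split=> // w' /key H; rewrite enorm_le_enorm (le_trans _ H) // lerDl.
  exact: dotr_ge0.
have [e0 emin] : argmin (fun w' => enorm (z - w')) (@npos R k) (eproj (@npos R k) z).
  by apply: getPex; exists w.
have := emin w wneg; rewrite enorm_le_enorm => H.
have := le_trans (key _ e0) H; rewrite gerDl => H0.
have : w - eproj (@npos R k) z = 0.
  by apply: dotr_eq0; apply/eqP; rewrite eq_le H0 dotr_ge0.
by move/eqP; rewrite subr_eq0 => /eqP.
Qed.

End euclidean_norm.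

Section finsler.
Context {R : realType} {k : nat}.

(** On the unit sphere the points where the form of [Q] is nonpositive form a
    compact set, on which the form of [P] is bounded away from 0; a large [c]
    compensates the minimum of the form of [Q] there.  Homogeneity extends the
    bound to all [v]. *)
Lemma finsler (Q P : 'M[R]_k) :
  (forall v : 'rV[R]_k, 0 <= dotr (v *m P) v) ->
  (forall v : 'rV[R]_k, v != 0 -> dotr (v *m P) v = 0 -> 0 < dotr (v *m Q) v) ->
  exists (c al : R), [/\ 0 < c, 0 < al & forall v : 'rV[R]_k,
    al * `|v| ^+ 2 <= dotr (v *m Q) v + c * dotr (v *m P) v].
Proof.
move=> P0 QP.
have cq (M : 'M[R]_k) : continuous (fun v : 'rV[R]_k => dotr (v *m M) v).
  move=> x; have : Ck 0 (fun v : 'rV[R]_k => dotr (v *m M) v) x.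
    apply: Ck_sum => i _; apply: CkM; last exact: (Ck_linear _ (entry 0 i)).
    by apply: Ck_entry; exact: (Ck_linear _ (mulmxr M)).
  exact: Ck_continuous.
pose S : set 'rV[R]_k := [set v | `|v| - 1 = 0].
have SP v : S v -> `|v| = 1 by move/eqP; rewrite subr_eq0 => /eqP.
have clS : closed S.
  apply: closed_preimage_eq0 => x.
  apply: (@continuousB _ _ _ (fun v : 'rV[R]_k => `|v|) (fun=> 1)).
    exact: norm_continuous.
  exact: cst_continuous.
have cS : compact S.
  apply: (@compact_rV _ _ _ 1) clS => v /SP v1 i.
  by rewrite -v1 mx_entry_le.
have [c [c0 cpos]] : exists c : R, 0 < c /\ forall v, S v ->
    0 < dotr (v *m Q) v + c * dotr (v *m P) v.
  (* T is where the form of Q is not already positive. *)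
  pose T : set 'rV[R]_k := S `&` [set v | 0 <= - dotr (v *m Q) v].
  have cT : compact T.
    apply: (@compact_rV _ _ _ 1) => [v [/SP v1 _] i|].
      by rewrite -v1 mx_entry_le.
    apply: closedI => //; apply: closed_preimage_ge0 => x.
    by apply: (@continuousN _ _ _ (fun v : 'rV[R]_k => dotr (v *m Q) v)); apply: cq.
  have [T0|] := pselect (T !=set0); last first.
    move=> nT; exists 1; split=> // v Sv; rewrite mul1r.
    have : 0 < dotr (v *m Q) v.
      rewrite ltNge; apply/negP => qv; apply: nT; exists v; split=> //.
      by rewrite /= oppr_ge0.
    by move=> qv; rewrite ltr_pwDl.
  have [v0 /set_mem Tv0 v0min] := EVT_min_rV T0 cT
    (@continuous_subspaceT _ _ T _ (cq P)).
  have [v1 /set_mem Tv1 v1min] := EVT_min_rV T0 cT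
    (@continuous_subspaceT _ _ T _ (cq Q)).
  set p0 := dotr (v0 *m P) v0 in v0min.
  have p00 : 0 < p0.
    rewrite lt_neqAle P0 andbT eq_sym; apply/negP => /eqP p00.
    have [/SP S0 T1] := Tv0.
    have v00 : v0 != 0 by rewrite -normr_gt0 S0.
    by have := QP _ v00 p00; rewrite ltNge -oppr_ge0 => /negP; apply.
  set q1 := dotr (v1 *m Q) v1 in v1min.
  have q10 : q1 <= 0 by have [_] := Tv1; rewrite /= oppr_ge0.
  exists ((1 - q1) / p0); split; first by rewrite divr_gt0 //; lra.
  have c0 : 0 < (1 - q1) / p0 by rewrite divr_gt0 //; lra.
  move=> v Sv; have [qv|qv] := ltP 0 (dotr (v *m Q) v).
    by rewrite ltr_pwDl // mulr_ge0 // ltW.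
  have Tv : T v by split=> //=; rewrite oppr_ge0.
  have H1 := v0min _ (mem_set Tv); have H2 := v1min _ (mem_set Tv).
  have : (1 - q1) / p0 * p0 <= (1 - q1) / p0 * dotr (v *m P) v by rewrite ler_pM2l.
  by rewrite divfK ?gt_eqF // => ?; lra.
have [al [al0 alS]] : exists al : R, 0 < al /\ forall v, S v ->
    al <= dotr (v *m Q) v + c * dotr (v *m P) v.
  have [S0|nS] := pselect (S !=set0); last first.
    by exists 1; split=> // v Sv; exfalso; apply: nS; exists v.
  have cqp : continuous (fun v : 'rV[R]_k => dotr (v *m Q) v + c * dotr (v *m P) v).
    move=> x; apply: (@continuousD _ _ _ (fun v : 'rV[R]_k => dotr (v *m Q) v)
      (fun v => c * dotr (v *m P) v)); first exact: cq.
    by apply: continuousM; [exact: cst_continuous|exact: cq].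
  have [v0 /set_mem Sv0 v0min] := EVT_min_rV S0 cS (@continuous_subspaceT _ _ S _ cqp).
  exists (dotr (v0 *m Q) v0 + c * dotr (v0 *m P) v0); split; first exact: cpos.
  by move=> v Sv; apply: v0min; apply: mem_set.
exists c, al; split=> // v.
have [->|v0] := eqVneq v 0.
  by rewrite normr0 expr0n mulr0 !dotr0r mulr0 addr0.
have nv : 0 < `|v| by rewrite normr_gt0.
have := alS (`|v|^-1 *: v).
rewrite /S /= normrZ normfV normr_id mulVf ?gt_eqF // subrr => /(_ erefl).
rewrite -!scalemxAl !dotrZl !dotrZr => H.
have : al * `|v| ^+ 2 <= (`|v|^-1 * (`|v|^-1 * dotr (v *m Q) v) +
  c * (`|v|^-1 * (`|v|^-1 * dotr (v *m P) v))) * `|v| ^+ 2.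
  by rewrite ler_wpM2r // sqr_ge0.
move/le_trans; apply; rewrite le_eqVlt; apply/orP; left; apply/eqP.
by field; rewrite gt_eqF.
Qed.

End finsler.

Section partial_maps.
Context {R : realType} {V : normedModType R} {k : nat}.
Variables (L : {linear 'rV[R]_k -> V}) (w : V) (y : 'rV[R]_k).

Lemma differentiable_partial (W : normedModType R) (a : V -> W) :
  differentiable a (w + L y) -> differentiable (fun x => a (w + L x)) y.
Proof.
move=> da; apply: (@differentiable_comp _ _ _ _ (fun x => w + L x) a) => //.
apply: differentiableD; first exact: differentiable_cst.
exact/linear_differentiable/rV_linear_continuous.
Qed.

End partial_maps.

(** * Independence of two families, and partial derivatives *)

Section free_two_families.
Context {K : fieldType} {V : vectType K} {r s : nat}.

(** Coefficients are indexed by all of ['I_s] and supported on [act], so that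
    different active sets can be compared without reindexing. *)
Lemma free_catP (a : 'I_r -> V) (b : 'I_s -> V) (act : pred 'I_s) :
  free ([seq a j | j : 'I_r] ++ [seq b i | i <- enum 'I_s & act i]) <->
  forall (c : 'I_r -> K) (e : 'I_s -> K), (forall i, ~~ act i -> e i = 0) ->
    \sum_j c j *: a j + \sum_i e i *: b i = 0 ->
    (forall j, c j = 0) /\ (forall i, e i = 0).
Proof.
pose F (z : 'I_r + 'I_s) := match z with inl j => a j | inr i => b i end.
pose z := [seq inl j | j : 'I_r] ++ [seq inr i | i <- enum 'I_s & act i] :
  seq ('I_r + 'I_s).
have zE : [seq F i | i <- z] = [seq a j | j : 'I_r] ++ [seq b i | i <- enum 'I_s & act i].
  by rewrite map_cat /image_mem -!map_comp.
have uz : uniq z.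
  rewrite cat_uniq; apply/and3P; split.
  - by rewrite map_inj_uniq -?enumT ?enum_uniq // => ? ? [].
  - by apply/hasPn => _ /mapP[i _ ->]; apply/mapP => -[].
  - by rewrite map_inj_uniq ?filter_uniq -?enumT ?enum_uniq // => ? ? [].
have sumE (k : 'I_r + 'I_s -> K) : \sum_(i <- z) k i *: F i =
   \sum_j k (inl j) *: a j + \sum_(i | act i) k (inr i) *: b i.
  rewrite big_cat !big_map /=; congr (_ + _).
  by rewrite big_filter big_enum_cond.
rewrite -zE; split=> [/(free_mapP _ uz).1 fz c e e0 E|H].
  pose k (i : 'I_r + 'I_s) := match i with inl j => c j | inr i => e i end.
  have k0 : \sum_(i <- z) k i *: F i = 0.
    rewrite sumE -[RHS]E; congr (_ + _); rewrite [RHS](bigID act) /=.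
    by rewrite [X in _ = _ + X]big1 ?addr0 // => i /e0 ->; rewrite scale0r.
  split=> [j|i].
    by apply: (fz k k0 (inl j)); rewrite mem_cat map_f ?mem_enum.
  have [ai|/e0//] := boolP (act i).
  by apply: (fz k k0 (inr i)); rewrite mem_cat map_f ?orbT // mem_filter ai mem_enum.
apply/(free_mapP _ uz) => k E.
have [||c0 e0] := H (fun j => k (inl j)) (fun i => if act i then k (inr i) else 0).
- by move=> i /negbTE ->.
- rewrite -[RHS]E sumE; congr (_ + _); rewrite [LHS](bigID act) /= addrC.
  rewrite big1 ?add0r => [|i /negbTE ->]; last by rewrite scale0r.
  by apply: eq_bigr => i ->.
move=> [j _|i]; first exact: c0.
rewrite mem_cat => /orP[/mapP[]//|/mapP[i' + [->]]].
by rewrite mem_filter => /andP[ai _]; have := e0 i'; rewrite ai.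
Qed.

End free_two_families.

Section pairs.
Context {R : realType} {n m : nat} {W : normedModType R}.
Implicit Types (a : 'rV[R]_n * 'rV[R]_m -> W).

Lemma derive_pairl a x y v : 'D_v (fun x' => a (x', y)) x = 'D_((v, 0)) a (x, y).
Proof.
rewrite /derive; set k := (X in lim (X @ _)); set k' := (X in _ = lim (X @ _)).
rewrite (_ : k = k') //; apply/funext => t; rewrite /k /k' /=.
have -> : t *: (v, 0 : 'rV[R]_m) + (x, y) = (t *: v + x, y).
  by apply: injective_projections; rewrite /= ?scaler0 ?add0r.
by [].
Qed.

Lemma derive_pairr a x y v : 'D_v (fun y' => a (x, y')) y = 'D_((0, v)) a (x, y).
Proof.
rewrite /derive; set k := (X in lim (X @ _)); set k' := (X in _ = lim (X @ _)).
rewrite (_ : k = k') //; apply/funext => t; rewrite /k /k' /=.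
have -> : t *: (0 : 'rV[R]_n, v) + (x, y) = (x, t *: v + y).
  by apply: injective_projections; rewrite /= ?scaler0 ?add0r.
by [].
Qed.

Lemma differentiable_pairl a x y : differentiable a (x, y) ->
  differentiable (fun x' => a (x', y)) x.
Proof.
move=> da; apply: (@differentiable_comp _ _ _ _ (fun x' => (x', y)) a) => //.
Qed.

Lemma differentiable_pairr a x y : differentiable a (x, y) ->
  differentiable (fun y' => a (x, y')) y.
Proof.
move=> da; apply: (@differentiable_comp _ _ _ _ (fun y' => (x, y')) a) => //.
Qed.

Lemma derive_pair_split a x y u v : differentiable a (x, y) ->
  'D_((u, v)) a (x, y) = 'D_u (fun x' => a (x', y)) x + 'D_v (fun y' => a (x, y')) y.
Proof.
move=> da; rewrite derive_pairl derive_pairr -(derive_dirD _ _ da); congr (derive a (x, y) _).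
by apply: injective_projections; rewrite /= ?addr0 ?add0r.
Qed.

End pairs.

(** * The gradient of the lower-level Lagrangian *)

Section kkt_system.
Context {R : realType} {n m r s : nat}.
Variables (f : 'rV[R]_n * 'rV[R]_m -> R)
  (h : 'rV[R]_n * 'rV[R]_m -> 'rV[R]_r) (g : 'rV[R]_n * 'rV[R]_m -> 'rV[R]_s).
Variables (xs : 'rV[R]_n) (ys : 'rV[R]_m) (mus : 'rV[R]_r) (xis : 'rV[R]_s).

Local Notation U := 'rV[R]_(n + (m + (r + s))).
Local Notation ustar := (us xs ys mus xis).

Definition u_xy (u : U) : 'rV[R]_n * 'rV[R]_m := (u_x u, u_y u).

Fact u_xy_is_linear : linear u_xy.
Proof. by move=> k a b; apply: injective_projections; rewrite /= /u_x /u_y !linearP. Qed.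

HB.instance Definition _ := GRing.isLinear.Build R U _ _ u_xy u_xy_is_linear.

Lemma u_x_row (x : 'rV[R]_n) (y : 'rV[R]_m) (mu : 'rV[R]_r) (xi : 'rV[R]_s) :
  u_x (row_mx x (row_mx y (row_mx mu xi))) = x.
Proof. exact: row_mxKl. Qed.

Lemma u_y_row (x : 'rV[R]_n) (y : 'rV[R]_m) (mu : 'rV[R]_r) (xi : 'rV[R]_s) :
  u_y (row_mx x (row_mx y (row_mx mu xi))) = y.
Proof. by rewrite /u_y row_mxKr row_mxKl. Qed.

Lemma u_mu_row (x : 'rV[R]_n) (y : 'rV[R]_m) (mu : 'rV[R]_r) (xi : 'rV[R]_s) :
  u_mu (row_mx x (row_mx y (row_mx mu xi))) = mu.
Proof. by rewrite /u_mu !row_mxKr row_mxKl. Qed.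

Lemma u_xi_row (x : 'rV[R]_n) (y : 'rV[R]_m) (mu : 'rV[R]_r) (xi : 'rV[R]_s) :
  u_xi (row_mx x (row_mx y (row_mx mu xi))) = xi.
Proof. by rewrite /u_xi !row_mxKr. Qed.

Definition u_rowE := (u_x_row, u_y_row, u_mu_row, u_xi_row).

Lemma u_xy_row (x : 'rV[R]_n) (y : 'rV[R]_m) (mu : 'rV[R]_r) (xi : 'rV[R]_s) :
  u_xy (row_mx x (row_mx y (row_mx mu xi))) = (x, y).
Proof. by rewrite /u_xy u_x_row u_y_row. Qed.

Lemma u_rowK (u : U) : u = row_mx (u_x u) (row_mx (u_y u) (row_mx (u_mu u) (u_xi u))).
Proof. by rewrite /u_x /u_y /u_mu /u_xi !hsubmxK. Qed.

Lemma Ck_u_xy (W : normedModType R) k (a : 'rV[R]_n * 'rV[R]_m -> W) (u : U) :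
  Ck k a (u_xy u) -> Ck k (fun u => a (u_xy u)) u.
Proof. exact: (@Ck_pre _ _ _ _ k u_xy (@rV_linear_continuous _ _ _ _)). Qed.

Lemma derive_u_xy (W : normedModType R) (a : 'rV[R]_n * 'rV[R]_m -> W) (u v : U) :
  'D_v (fun u => a (u_xy u)) u = 'D_(u_xy v) a (u_xy u).
Proof. exact: (derive_pre u_xy). Qed.

Lemma Ck_u_mu k (u : U) : Ck k (fun u : U => u_mu u) u.
Proof.
have L : linear (fun u : U => u_mu u) by move=> c a b; rewrite /u_mu !linearP.
pose sL := GRing.isLinear.Build _ _ _ _ _ L.
pose l : {linear U -> 'rV[R]_r} := HB.pack (fun u : U => u_mu u) sL.
exact: (Ck_linear _ l).
Qed.

Lemma Ck_u_xi k (u : U) : Ck k (fun u : U => u_xi u) u.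
Proof.
have L : linear (fun u : U => u_xi u) by move=> c a b; rewrite /u_xi !linearP.
pose sL := GRing.isLinear.Build _ _ _ _ _ L.
pose l : {linear U -> 'rV[R]_s} := HB.pack (fun u : U => u_xi u) sL.
exact: (Ck_linear _ l).
Qed.

Definition gradL (u : U) : 'rV[R]_m :=
  grad_y_lagr f h g (u_x u) (u_y u) (u_mu u) (u_xi u).

Lemma lagr_nlp x mu xi :
  (fun y => lagr f h g x y mu xi) =
  nlp_lagr (fun y => f (x, y)) (fun y => h (x, y)) (fun y => g (x, y)) (mu, xi).
Proof. by []. Qed.

Lemma grad_y_lagrE x y mu xi : differentiable f (x, y) ->
  differentiable h (x, y) -> differentiable g (x, y) ->
  grad_y_lagr f h g x y mu xi = grad (fun y => f (x, y)) y +
    mu *m jac (fun y => h (x, y)) y + xi *m jac (fun y => g (x, y)) y.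
Proof.
move=> df dh dg; rewrite /grad_y_lagr lagr_nlp.
have df' := differentiable_pairr df; have dh' := differentiable_pairr dh.
have dg' := differentiable_pairr dg.
exact: (grad_nlp_lagr_at (mu, xi) df' dh' dg').
Qed.

Lemma grad_y_lagr_entry x y mu xi j : differentiable f (x, y) ->
  differentiable h (x, y) -> differentiable g (x, y) ->
  grad_y_lagr f h g x y mu xi 0 j = 'D_((0, delta_mx 0 j)) f (x, y) +
    dotr mu ('D_((0, delta_mx 0 j)) h (x, y)) + dotr xi ('D_((0, delta_mx 0 j)) g (x, y)).
Proof.
move=> df dh dg; rewrite /grad_y_lagr mxE lagr_nlp.
have df' := differentiable_pairr df; have dh' := differentiable_pairr dh.
have dg' := differentiable_pairr dg.
by rewrite (derive_nlp_lagr (mu, xi) _ df' dh' dg') /= !derive_pairr.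
Qed.

Hypotheses (f_smooth : C2_C3y f (xs, ys)) (g_smooth : C2_C3y g (xs, ys))
  (h_smooth : C2_C3y h (xs, ys)).

Lemma u_xy_star : u_xy ustar = (xs, ys).
Proof. exact: u_xy_row. Qed.

Lemma Ck_star (W : normedModType R) k (a : 'rV[R]_n * 'rV[R]_m -> W) :
  Ck k a (xs, ys) -> Ck k (fun u => a (u_xy u)) ustar.
Proof. by move=> Ca; apply: Ck_u_xy; rewrite u_xy_star. Qed.

Lemma near_star (P : 'rV[R]_n * 'rV[R]_m -> Prop) :
  (\forall z \near (xs, ys), P z) -> \forall u \near ustar, P (u_xy u).
Proof.
move=> nP; have cxy : continuous u_xy by exact: rV_linear_continuous.
by have := cxy ustar; rewrite /continuous_at u_xy_star => /(_ _ nP).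
Qed.

Lemma near_smooth : \forall z \near (xs, ys),
  [/\ differentiable f z, differentiable h z & differentiable g z].
Proof.
have [[df _] _] := f_smooth; have [[dh _] _] := h_smooth; have [[dg _] _] := g_smooth.
by apply: filterS2 df (filterI dh dg) => z ? [? ?].
Qed.

Lemma Ck_dotr2 (V : normedModType R) k j (a b : V -> 'rV[R]_k) z :
  Ck j a z -> Ck j b z -> Ck j (fun x => dotr (a x) (b x)) z.
Proof. by move=> Ca Cb; apply: Ck_sum => i _; apply: CkM; apply: Ck_entry. Qed.

(** Entries of the gradient combine derivatives of [f], [h] and [g] in
    directions of [y], which are C^2 by the hypothesis on third derivatives. *)
Lemma Ck_gradL : Ck 2 gradL ustar.
Proof.
apply: Ck_rV => j; pose e : 'rV[R]_n * 'rV[R]_m := (0, delta_mx 0 j).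
apply: (@Ck_near_eq _ _ _ 2 (fun u => 'D_e f (u_xy u) +
    dotr (u_mu u) ('D_e h (u_xy u)) + dotr (u_xi u) ('D_e g (u_xy u)))).
  apply: filterS (near_star near_smooth) => u [df dh dg].
  by rewrite /gradL grad_y_lagr_entry.
have [_ Cf] := f_smooth; have [_ Ch] := h_smooth; have [_ Cg] := g_smooth.
apply: CkD; first apply: CkD.
- exact: Ck_star (Cf _).
- by apply: Ck_dotr2; [exact: Ck_u_mu|exact: Ck_star (Ch _)].
- by apply: Ck_dotr2; [exact: Ck_u_xi|exact: Ck_star (Cg _)].
Qed.

Let dgradL : differentiable gradL ustar := Ck_differentiable Ck_gradL.

Let dstar : [/\ differentiable f (xs, ys), differentiable h (xs, ys) &
  differentiable g (xs, ys)].
Proof. exact: nbhs_singleton near_smooth. Qed.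

Lemma gradL_partial_x (u : U) dx : differentiable gradL u ->
  differentiable (fun x => grad_y_lagr f h g x (u_y u) (u_mu u) (u_xi u)) (u_x u) /\
  'D_(row_mx dx 0) gradL u =
  'D_dx (fun x => grad_y_lagr f h g x (u_y u) (u_mu u) (u_xi u)) (u_x u).
Proof.
pose L : {linear 'rV[R]_n -> U} := mulmxr (row_mx 1%:M 0).
have LE x : L x = row_mx x 0 by rewrite /L /= mul_mx_row mulmx1 mulmx0.
pose w : U := row_mx 0 (row_mx (u_y u) (row_mx (u_mu u) (u_xi u))).
have wE x : w + L x = row_mx x (row_mx (u_y u) (row_mx (u_mu u) (u_xi u))).
  by rewrite LE add_row_mx add0r addr0.
have wu : w + L (u_x u) = u by rewrite wE -u_rowK.
have fE : (fun x => grad_y_lagr f h g x (u_y u) (u_mu u) (u_xi u)) =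
    (fun x => gradL (w + L x)) by apply/funext => x; rewrite wE /gradL !u_rowE.
move=> du; rewrite fE; split; first by apply: differentiable_partial; rewrite wu.
by rewrite derive_affine_pre wu LE.
Qed.

Lemma gradL_partial_y (u : U) dy : differentiable gradL u ->
  differentiable (fun y => grad_y_lagr f h g (u_x u) y (u_mu u) (u_xi u)) (u_y u) /\
  'D_(row_mx 0 (row_mx dy 0)) gradL u =
  'D_dy (fun y => grad_y_lagr f h g (u_x u) y (u_mu u) (u_xi u)) (u_y u).
Proof.
pose L : {linear 'rV[R]_m -> U} := mulmxr (row_mx 0 (row_mx 1%:M 0)).
have LE y : L y = row_mx 0 (row_mx y 0).
  by rewrite /L /= mul_mx_row mul_mx_row mulmx1 !mulmx0.
pose w : U := row_mx (u_x u) (row_mx 0 (row_mx (u_mu u) (u_xi u))).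
have wE y : w + L y = row_mx (u_x u) (row_mx y (row_mx (u_mu u) (u_xi u))).
  by rewrite LE !add_row_mx add0r !addr0.
have wu : w + L (u_y u) = u by rewrite wE -u_rowK.
have fE : (fun y => grad_y_lagr f h g (u_x u) y (u_mu u) (u_xi u)) =
    (fun y => gradL (w + L y)) by apply/funext => y; rewrite wE /gradL !u_rowE.
move=> du; rewrite fE; split; first by apply: differentiable_partial; rewrite wu.
by rewrite derive_affine_pre wu LE.
Qed.

Lemma hess_yy_gradL (u : U) (dy : 'cV[R]_m) : differentiable gradL u ->
  hess_yy_lagr f h g (u_x u) (u_y u) (u_mu u) (u_xi u) *m dy =
  ('D_(row_mx 0 (row_mx dy^T 0)) gradL u)^T.
Proof.
move=> du; have [d1 ->] := gradL_partial_y dy^T du.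
exact: (jac_mulmx dy d1).
Qed.

Lemma derive_gradL_mult (u : U) dmu dxi : differentiable f (u_xy u) ->
  differentiable h (u_xy u) -> differentiable g (u_xy u) ->
  'D_(row_mx 0 (row_mx 0 (row_mx dmu dxi))) gradL u =
  dmu *m jac (fun y => h (u_x u, y)) (u_y u) + dxi *m jac (fun y => g (u_x u, y)) (u_y u).
Proof.
move=> df dh dg; apply: derive_of_line => t.
have -> : u + t *: row_mx 0 (row_mx 0 (row_mx dmu dxi)) =
   row_mx (u_x u) (row_mx (u_y u) (row_mx (u_mu u + t *: dmu) (u_xi u + t *: dxi))).
  by rewrite {1}(u_rowK u) !scale_row_mx !add_row_mx !scaler0 !addr0.
rewrite /gradL !u_rowE !grad_y_lagrE // !mulmxDl -!scalemxAl.
rewrite scalerDr !addrA; congr (_ + _).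
by rewrite -!addrA; congr (_ + (_ + _)); rewrite addrC.
Qed.

Lemma derive_gradL (dx : 'cV[R]_n) (dy : 'cV[R]_m) (dmu : 'cV[R]_r) (dxi : 'cV[R]_s) :
  'D_(row_mx dx^T (row_mx dy^T (row_mx dmu^T dxi^T))) gradL ustar =
  (hess_yx_lagr f h g xs ys mus xis *m dx + hess_yy_lagr f h g xs ys mus xis *m dy
   + (jac (fun y => h (xs, y)) ys)^T *m dmu + (jac (fun y => g (xs, y)) ys)^T *m dxi)^T.
Proof.
have split_dir : row_mx dx^T (row_mx dy^T (row_mx dmu^T dxi^T)) =
   row_mx dx^T 0 + row_mx 0 (row_mx dy^T 0) + row_mx 0 (row_mx 0 (row_mx dmu^T dxi^T)).
  by rewrite !add_row_mx !addr0 add0r add_row_mx addr0 add0r.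
have [df dh dg] := dstar.
rewrite split_dir (derive_dirD _ _ dgradL) (derive_dirD _ _ dgradL).
have := derive_gradL_mult (u := ustar) dmu^T dxi^T.
rewrite u_xy_star /us !u_rowE => /(_ df dh dg) ->.
have [d1 ->] := gradL_partial_x dx^T dgradL.
have Ey := hess_yy_gradL dy dgradL.
rewrite /us !u_rowE in d1 Ey *.
rewrite Ey (jac_mulmx dx d1).
move: (derive _ _ _) (derive _ _ _) (jac _ _) (jac _ _) => a b A B.
by apply: trmx_inj; rewrite trmxK !raddfD /= !trmx_mul !trmxK addrA.
Qed.

End kkt_system.

(** * The KKT system of the lower level *)

Section jacobian_uniqueness_theory.
Context {R : realType} {n m r s : nat}.
Variables (f : 'rV[R]_n * 'rV[R]_m -> R)
  (h : 'rV[R]_n * 'rV[R]_m -> 'rV[R]_r) (g : 'rV[R]_n * 'rV[R]_m -> 'rV[R]_s).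
Variables (xs : 'rV[R]_n) (ys : 'rV[R]_m) (mus : 'rV[R]_r) (xis : 'rV[R]_s).

Local Notation U := 'rV[R]_(n + (m + (r + s))).
Local Notation ustar := (us xs ys mus xis).

Hypotheses (f_smooth : C2_C3y f (xs, ys)) (g_smooth : C2_C3y g (xs, ys))
  (h_smooth : C2_C3y h (xs, ys)).
Hypothesis juc : jacobian_uniqueness f h g xs ys mus xis.

Definition active (i : 'I_s) : bool := g (xs, ys) 0 i == 0.

(** The derivative of the projection at [g (xs, ys) + xis]. *)
Definition inactive_mx : 'M[R]_s := \matrix_(i, j) ((i == j) && ~~ active i)%:R.

Lemma mul_inactive_mx (z : 'rV[R]_s) i :
  (z *m inactive_mx) 0 i = if active i then 0 else z 0 i.
Proof.
rewrite mxE (bigD1 i) //= mxE eqxx /= big1 => [|j ji]; last first.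
  by rewrite mxE (negbTE ji) mulr0.
by case: (active i); rewrite /= ?mulr0 ?mulr1 addr0.
Qed.

Lemma mul_active_mx (z : 'rV[R]_s) i :
  (z *m (1%:M - inactive_mx)) 0 i = if active i then z 0 i else 0.
Proof.
rewrite mulmxBr mulmx1 mxE [X in _ + X]mxE mul_inactive_mx.
by case: (active i); rewrite ?subr0 ?subrr.
Qed.

Lemma tr_inactive_mx : inactive_mx^T = inactive_mx.
Proof.
by apply/matrixP => i j; rewrite !mxE eq_sym; case: eqP => // ->.
Qed.

Let kkt : [/\ grad_y_lagr f h g xs ys mus xis = 0, h (xs, ys) = 0, nneg xis,
  npos (g (xs, ys)) & dotr xis (g (xs, ys)) = 0].
Proof. by have [] := juc. Qed.

Let strict : forall i, 0 < xis 0 i - g (xs, ys) 0 i.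
Proof. by have [] := juc. Qed.

Lemma multiplier_inactive i : ~~ active i -> xis 0 i = 0.
Proof.
have [_ _ xi0 g0 xig] := kkt => /negbTE ai.
have xigle j : xis 0 j * g (xs, ys) 0 j <= 0 by rewrite mulr_ge0_le0.
have /eqP := dotr_terms_eq0 xigle xig i.
by rewrite mulf_eq0 [g _ 0 i == 0]ai orbF => /eqP.
Qed.

Lemma complementarity_sign i :
  if active i then 0 < g (xs, ys) 0 i + xis 0 i else g (xs, ys) 0 i + xis 0 i < 0.
Proof.
case: ifPn => [/eqP ai|ai].
  by have := strict i; rewrite ai subr0 add0r.
rewrite multiplier_inactive // addr0.
by have := strict i; rewrite multiplier_inactive // sub0r oppr_gt0.
Qed.

Lemma near_complementarity_sign : \forall z \near g (xs, ys) + xis, forall i,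
  if active i then 0 < (z : 'rV[R]_s) 0 i else (z : 'rV[R]_s) 0 i < 0.
Proof.
apply: (@filter_forall _ _ (fun i (z : 'rV[R]_s) => if active i then 0 < z 0 i else z 0 i < 0)
  (nbhs (g (xs, ys) + xis))) => i.
have := complementarity_sign i.
have -> : g (xs, ys) 0 i + xis 0 i = (g (xs, ys) + xis) 0 i by rewrite mxE.
move: (g (xs, ys) + xis) => z.
have cz : (fun z : 'rV[R]_s => z 0 i) x @[x --> z] --> z 0 i by exact: coord_continuous.
case: (active i) => zi.
  by apply: (cz [set t | 0 < t]); apply: lt_nbhsr.
by apply: (cz [set t | t < 0]); apply: lt_nbhsl.
Qed.

Lemma near_eproj : \forall z \near g (xs, ys) + xis, eproj (@npos R s) z = z *m inactive_mx.
Proof.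
apply: filterS near_complementarity_sign => z zi; rewrite eproj_npos.
apply/rowP => i; rewrite mul_inactive_mx mxE; have := zi i.
by case: (active i) => [/ltW/min_r|/ltW/min_l].
Qed.

Lemma jac_eproj : jac (eproj (@npos R s)) (g (xs, ys) + xis) = inactive_mx.
Proof.
set z := g (xs, ys) + xis.
have nz : \forall z' \near z, mulmxr inactive_mx z' = eproj (@npos R s) z'.
  by apply: filterS near_eproj => z' ->.
have dl : differentiable (mulmxr inactive_mx : 'rV[R]_s -> 'rV[R]_s) z.
  exact/linear_differentiable/rV_linear_continuous.
have de := differentiable_near_eq nz dl.
apply: trmx_inj; rewrite trmxK tr_inactive_mx.
apply/row_matrixP => i; rewrite !rowE -deriveEjacobian //.
rewrite -(near_eq_derive _ nz) deriveE // diff_lin //.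
exact: rV_linear_continuous.
Qed.

Definition comp_res (u : U) : 'rV[R]_s := comp_residual g (u_x u) (u_y u) (u_xi u).

Lemma g_star_continuous : g (u_xy u) + u_xi u @[u --> ustar] --> g (xs, ys) + xis.
Proof.
have [Cg _] := g_smooth.
have Cs : Ck 0 (fun u : U => g (u_xy u) + u_xi u) ustar.
  by apply: CkD; [exact: Ck_star (Ck_le (leq0n 2) Cg)|exact: Ck_u_xi].
have := Ck_continuous Cs; rewrite /prop_for /continuous_at.
by rewrite u_xy_star /us u_xi_row.
Qed.

(** Near [u*] the projection is linear, and the residual is [g] on the active
    indices and [- xi] on the inactive ones. *)
Lemma near_comp_res : \forall u \near ustar,
  (forall i, if active i then 0 < g (u_xy u) 0 i + u_xi u 0 i
             else g (u_xy u) 0 i + u_xi u 0 i < 0) /\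
  comp_res u = g (u_xy u) *m (1%:M - inactive_mx) - u_xi u *m inactive_mx.
Proof.
have H1 : \forall u \near ustar, forall i, if active i
    then 0 < (g (u_xy u) + u_xi u) 0 i else (g (u_xy u) + u_xi u) 0 i < 0.
  exact: g_star_continuous near_complementarity_sign.
have H2 : \forall u \near ustar, eproj (@npos R s) (g (u_xy u) + u_xi u) =
    (g (u_xy u) + u_xi u) *m inactive_mx.
  exact: g_star_continuous near_eproj.
apply: filterS2 H1 H2 => u H1 H2; split.
  by move=> i; have := H1 i; rewrite mxE.
rewrite /comp_res /comp_residual -/(u_xy u) H2.
by rewrite mulmxDl mulmxBr mulmx1 opprD addrA.
Qed.

(** The equality constraints of (FP) that concern the lower level. *)
Definition kkt_res (u : U) : 'rV[R]_(m + (r + s)) :=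
  row_mx (gradL f h g u) (row_mx (h (u_xy u)) (comp_res u)).

Lemma Ck_comp_res : Ck 2 comp_res ustar.
Proof.
have [Cg _] := g_smooth.
apply: (@Ck_near_eq _ _ _ 2 (fun u => mulmxr (1%:M - inactive_mx) (g (u_xy u)) +
   mulmxr (- inactive_mx) (u_xi u))).
  by apply: filterS near_comp_res => u [_ ->] /=; rewrite mulmxN.
apply: CkD.
  apply: (@Ck_post _ _ _ _ 2 (mulmxr (1%:M - inactive_mx)) _ (fun u => g (u_xy u))).
    exact: rV_linear_continuous.
  exact: Ck_star Cg.
apply: (@Ck_post _ _ _ _ 2 (mulmxr (- inactive_mx)) _ (fun u : U => u_xi u)).
  exact: rV_linear_continuous.
exact: Ck_u_xi.
Qed.

Lemma Ck_kkt_res : Ck 2 kkt_res ustar.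
Proof.
have [Ch _] := h_smooth.
apply: Ck_row_mx; first exact: Ck_gradL.
by apply: Ck_row_mx; [exact: Ck_star Ch|exact: Ck_comp_res].
Qed.

Lemma kkt_res_star : kkt_res ustar = 0.
Proof.
have [gL h0 _ _ _] := kkt.
rewrite /kkt_res (nbhs_singleton near_comp_res).2 /gradL /us u_xy_row !u_rowE gL h0.
have -> : g (xs, ys) *m (1%:M - inactive_mx) - xis *m inactive_mx = 0.
  apply/rowP => i; rewrite mxE mul_active_mx [X in _ + X]mxE mul_inactive_mx mxE.
  by case: ifPn => [/eqP ->|/multiplier_inactive ->]; rewrite subr0.
by rewrite !row_mx0.
Qed.

Lemma derive_comp_res (w : U) : 'D_w comp_res ustar =
  'D_(u_xy w) g (xs, ys) *m (1%:M - inactive_mx) - u_xi w *m inactive_mx.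
Proof.
have [Cg _] := g_smooth.
rewrite (near_eq_derive w (_ : \forall u \near ustar, comp_res u =
   mulmxr (1%:M - inactive_mx) (g (u_xy u)) + mulmxr (- inactive_mx) (u_xi u))); last first.
  by apply: filterS near_comp_res => u [_ ->] /=; rewrite mulmxN.
have dg : differentiable (fun u : U => g (u_xy u)) ustar.
  have C2 : Ck 2 (fun u : U => g (u_xy u)) ustar by exact: Ck_star Cg.
  exact: Ck_differentiable C2.
have dxi : differentiable (fun u : U => u_xi u) ustar.
  exact: (@Ck_differentiable _ _ _ 0 _ _ (Ck_u_xi 1 ustar)).
have c1 : continuous (mulmxr (1%:M - inactive_mx) : 'rV[R]_s -> 'rV[R]_s).
  exact: rV_linear_continuous.
have c2 : continuous (mulmxr (- inactive_mx) : 'rV[R]_s -> 'rV[R]_s).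
  exact: rV_linear_continuous.
have d1 : derivable (fun u : U => mulmxr (1%:M - inactive_mx) (g (u_xy u))) ustar w.
  apply: diff_derivable; apply: (@differentiable_comp _ _ _ _ (fun u : U => g (u_xy u)) (mulmxr (1%:M - inactive_mx))) dg _.
  exact: linear_differentiable.
have d2 : derivable (fun u : U => mulmxr (- inactive_mx) (u_xi u)) ustar w.
  apply: diff_derivable; apply: (@differentiable_comp _ _ _ _ (fun u : U => u_xi u) (mulmxr (- inactive_mx))) dxi _.
  exact: linear_differentiable.
rewrite [LHS](deriveD d1 d2) (derive_post w c1 dg) (derive_post w c2 dxi).
rewrite derive_u_xy u_xy_star /= mulmxN; congr (_ - _ *m _).
apply: derive_of_line => t; rewrite /u_xi.
by rewrite [ustar + _]addrC !linearP [RHS]addrC.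
Qed.

Lemma derive_kkt_res (w : U) : 'D_w kkt_res ustar =
  row_mx ('D_w (gradL f h g) ustar) (row_mx ('D_(u_xy w) h (xs, ys))
    ('D_(u_xy w) g (xs, ys) *m (1%:M - inactive_mx) - u_xi w *m inactive_mx)).
Proof.
have [Ch _] := h_smooth.
have dh : differentiable (fun u : U => h (u_xy u)) ustar.
  have C2 : Ck 2 (fun u : U => h (u_xy u)) ustar by exact: Ck_star Ch.
  exact: Ck_differentiable C2.
have dc := Ck_differentiable Ck_comp_res.
have dL := Ck_differentiable (Ck_gradL mus xis f_smooth g_smooth h_smooth).
rewrite (derive_row_mx _ dL) ?derive_row_mx //; last exact: differentiable_row_mx.
by rewrite derive_u_xy u_xy_star derive_comp_res.
Qed.

(** Let [(dy, dmu, dxi)] be in the kernel.  Then [dy] annihilates the active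
    gradients and [dxi] vanishes on inactive indices, so pairing the first
    block with [dy] leaves only the Hessian term; second-order sufficiency
    gives [dy = 0], and LICQ then gives [dmu = 0] and [dxi = 0]. *)
Lemma kkt_res_unit : dsubmx ('J kkt_res ustar) \in unitmx.
Proof.
rewrite -row_free_unit; apply: inj_row_free => v.
have dK := Ck_differentiable Ck_kkt_res.
rewrite -(derive_partial v dK) derive_kkt_res.
have [df dh dg] := nbhs_singleton (near_smooth f_smooth g_smooth h_smooth).
set dy := lsubmx v; set dmu := lsubmx (rsubmx v); set dxi := rsubmx (rsubmx v).
have vE : v = row_mx dy (row_mx dmu dxi) by rewrite /dy /dmu /dxi !hsubmxK.
rewrite vE u_xy_row u_xi_row.
set Jh := jac (fun y => h (xs, y)) ys; set Jg := jac (fun y => g (xs, y)) ys.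
have dh' := differentiable_pairr dh; have dg' := differentiable_pairr dg.
have Dh : 'D_((0, dy)) h (xs, ys) = (Jh *m dy^T)^T.
  by rewrite -derive_pairr jac_mulmx // !trmxK.
have Dg : 'D_((0, dy)) g (xs, ys) = (Jg *m dy^T)^T.
  by rewrite -derive_pairr jac_mulmx // !trmxK.
have := derive_gradL mus xis f_smooth g_smooth h_smooth 0 dy^T dmu^T dxi^T.
rewrite (trmxK dy) (trmxK dmu) (trmxK dxi) trmx0 mulmx0 add0r -/Jh -/Jg => ->.
rewrite -!row_mx0 => /eq_row_mx[E1 /eq_row_mx[E2 E3]].
rewrite Dg in E3; rewrite Dh in E2.
have E3i i : ((Jg *m dy^T)^T *m (1%:M - inactive_mx)) 0 i = (dxi *m inactive_mx) 0 i.
  by move/eqP: E3; rewrite subr_eq0 => /eqP ->.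
have gact i : active i -> (Jg *m dy^T) i 0 = 0.
  by move=> ai; have := E3i i; rewrite mul_active_mx mul_inactive_mx ai [X in X = _ -> _]mxE.
have xin i : ~~ active i -> dxi 0 i = 0.
  by move=> ai; have := E3i i; rewrite mul_active_mx mul_inactive_mx (negbTE ai).
have hdy : Jh *m dy^T = 0 by rewrite -[LHS]trmxK E2 trmx0.
(* Active entries of Jg dy and inactive entries of dxi vanish. *)
have sum0 : dotr dxi (Jg *m dy^T)^T = 0.
  rewrite /dotr big1 // => i _; rewrite [X in _ * X]mxE; have [ai|ai] := boolP (active i).
    by rewrite gact // mulr0.
  by rewrite xin // mul0r.
have [licq sosc] : free ([seq grad (fun y' => h (xs, y') 0 j) ys | j : 'I_r] ++
            [seq grad (fun y' => g (xs, y') 0 i) ys | i <- enum 'I_s & g (xs, ys) 0 i == 0])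
   /\ forall d, lower_critical_cone f h g xs ys d -> d != 0 ->
        0 < (d^T *m hess_yy_lagr f h g xs ys mus xis *m d) 0 0.
  by have [] := juc.
set Q := hess_yy_lagr f h g xs ys mus xis in E1 sosc.
have E1' := congr1 trmx E1; rewrite [in LHS]trmxK trmx0 in E1'.
have grow i : (grad (fun y => g (xs, y) 0 i) ys *m dy^T) 0 0 = (Jg *m dy^T) i 0.
  by rewrite -row_jac // -row_mul mxE.
have dy0 : dy = 0.
  apply/eqP/negPn/negP => dyn.
  suff cone : lower_critical_cone f h g xs ys dy^T.
    have := sosc dy^T cone; rewrite trmxK -trmx0 (inj_eq trmx_inj) dyn => /(_ isT).
    have := congr1 (fun M : 'cV_m => (dy *m M) 0 0) E1'; rewrite /=.
    have -> : dy *m (Q *m dy^T + Jh^T *m dmu^T + Jg^T *m dxi^T) =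
        dy *m Q *m dy^T + (Jh *m dy^T)^T *m dmu^T + (Jg *m dy^T)^T *m dxi^T.
      by rewrite !mulmxDr !trmx_mul (trmxK dy) !mulmxA.
    rewrite hdy trmx0 mul0mx addr0 mulmx0 [RHS]mxE mxE.
    by rewrite -[X in _ + X]dotrE dotrC sum0 addr0 => ->; rewrite ltxx.
  split=> [//|i /eqP ai|]; first by rewrite grow gact.
  have [gL _ _ _ _] := kkt.
  have := congr1 (fun M : 'rV_m => (M *m dy^T) 0 0) gL.
  rewrite /= (grad_y_lagrE _ _ df dh dg) !mulmxDl -!mulmxA -/Jh -/Jg hdy mulmx0 addr0.
  rewrite mul0mx [RHS]mxE mxE => /eqP; rewrite addr_eq0 => /eqP ->.
  have -> : (xis *m (Jg *m dy^T)) 0 0 = 0; last by rewrite oppr0.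
  rewrite mxE big1 // => i _; have [/gact ->|/multiplier_inactive ->] := boolP (active i).
    by rewrite mulr0.
  by rewrite mul0r.
have Hfree := (free_catP _ _ _).1 licq.
have [||c0 e0] := Hfree (dmu 0) (dxi 0).
- exact: xin.
- have -> : \sum_j dmu 0 j *: grad (fun y => h (xs, y) 0 j) ys = dmu *m Jh.
    by rewrite mulmx_sum_row; apply: eq_bigr => j _; rewrite -row_jac.
  have -> : \sum_i dxi 0 i *: grad (fun y => g (xs, y) 0 i) ys = dxi *m Jg.
    by rewrite mulmx_sum_row; apply: eq_bigr => j _; rewrite -row_jac.
  move: E1; rewrite dy0 trmx0 mulmx0 add0r => E1.
  by rewrite -E1 linearD /= !trmx_mul (trmxK Jh) (trmxK Jg) (trmxK dmu) (trmxK dxi).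
rewrite dy0; have -> : dmu = 0 by apply/rowP => j; rewrite c0 mxE.
by have -> : dxi = 0 by apply/rowP => j; rewrite e0 mxE.
Qed.

End jacobian_uniqueness_theory.

(** * Local optimality of KKT points of the lower level *)

Section lower_level_stability.
Context {R : realType} {n m r s : nat}.
Variables (f : 'rV[R]_n * 'rV[R]_m -> R)
  (h : 'rV[R]_n * 'rV[R]_m -> 'rV[R]_r) (g : 'rV[R]_n * 'rV[R]_m -> 'rV[R]_s).
Variables (xs : 'rV[R]_n) (ys : 'rV[R]_m) (mus : 'rV[R]_r) (xis : 'rV[R]_s).

Local Notation U := 'rV[R]_(n + (m + (r + s))).
Local Notation ustar := (us xs ys mus xis).

Hypotheses (f_smooth : C2_C3y f (xs, ys)) (g_smooth : C2_C3y g (xs, ys))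
  (h_smooth : C2_C3y h (xs, ys)).
Hypothesis juc : jacobian_uniqueness f h g xs ys mus xis.

Local Notation W0 := (inactive_mx g xs ys).
Local Notation act := (active g xs ys).
Local Notation dL := (gradL f h g).

Definition y_dir (v : 'rV[R]_m) : U := row_mx 0 (row_mx v 0).

Lemma y_dir_norm v : `|y_dir v| <= `|v|.
Proof.
apply: norm_row_mx_le; first by rewrite normr0.
by apply: norm_row_mx_le => //; rewrite normr0.
Qed.

Lemma u_xy_y_dir v : u_xy (y_dir v) = (0, v).
Proof. by rewrite /y_dir -[X in row_mx v X]row_mx0 u_xy_row. Qed.

(** Inactive components are masked rather than removed, so that the index set
    is the same at all points. *)
Definition active_constraints (u : U) : 'rV[R]_(r + s) :=
  row_mx (h (u_xy u)) (g (u_xy u) *m (1%:M - W0)).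
Local Notation ac := active_constraints.

Let smooth_star := nbhs_singleton (near_smooth f_smooth g_smooth h_smooth).

Lemma Ck_active_constraints : Ck 2 ac ustar.
Proof.
have [Ch _] := h_smooth; have [Cg _] := g_smooth.
apply: Ck_row_mx; first exact: Ck_star Ch.
apply: (@Ck_post _ _ _ _ 2 (mulmxr (1%:M - W0)) _ (fun u => g (u_xy u))).
  exact: rV_linear_continuous.
exact: Ck_star Cg.
Qed.

Lemma derive_active_constraints (u w : U) :
  differentiable h (u_xy u) -> differentiable g (u_xy u) ->
  'D_w ac u = row_mx ('D_(u_xy w) h (u_xy u)) ('D_(u_xy w) g (u_xy u) *m (1%:M - W0)).
Proof.
move=> dh dg; have cxy : continuous (u_xy : U -> _) by exact: rV_linear_continuous.
have lxy : differentiable (u_xy : U -> 'rV[R]_n * 'rV[R]_m) u by exact: linear_differentiable.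
have dh' : differentiable (fun u : U => h (u_xy u)) u.
  exact: (@differentiable_comp _ _ _ _ u_xy h).
have dg' : differentiable (fun u : U => g (u_xy u)) u.
  exact: (@differentiable_comp _ _ _ _ u_xy g).
have c1 : continuous (mulmxr (1%:M - W0) : 'rV[R]_s -> 'rV[R]_s).
  exact: rV_linear_continuous.
have dg2 : differentiable (fun u : U => mulmxr (1%:M - W0) (g (u_xy u))) u.
  apply: (@differentiable_comp _ _ _ _ (fun u : U => g (u_xy u)) (mulmxr (1%:M - W0))) => //.
  exact: linear_differentiable.
rewrite (derive_row_mx _ dh' dg2) derive_u_xy; congr row_mx.
by rewrite (derive_post _ c1 dg') derive_u_xy.
Qed.

Lemma mulmx_trr a b c (u : 'M[R]_(a, b)) (M : 'M[R]_(c, b)) :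
  u *m M^T = (M *m u^T)^T.
Proof. by rewrite trmx_mul trmxK. Qed.

(** Stationarity expresses the derivative of the objective by those of the
    constraints, which eliminates it from the critical cone. *)
Lemma stationary_grad_f x y mu xi (d : 'cV[R]_m) :
  differentiable f (x, y) -> differentiable h (x, y) -> differentiable g (x, y) ->
  grad_y_lagr f h g x y mu xi = 0 ->
  (grad (fun y => f (x, y)) y *m d) 0 0 =
  - (dotr mu (jac (fun y => h (x, y)) y *m d)^T +
     dotr xi (jac (fun y => g (x, y)) y *m d)^T).
Proof.
move=> df dh dg; rewrite (grad_y_lagrE _ _ df dh dg).
move: (jac _ _) (jac _ _) (grad _ _) => A B c /eqP.
rewrite -addrA addr_eq0 => /eqP ->.
by rewrite mulNmx mxE mulmxDl -!mulmxA mxE !dotrE !trmxK.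
Qed.

Lemma jac_pairr k (a : 'rV[R]_n * 'rV[R]_m -> 'rV[R]_k) x y (d : 'cV[R]_m) :
  differentiable a (x, y) ->
  jac (fun y => a (x, y)) y *m d = ('D_((0, d^T)) a (x, y))^T.
Proof.
move=> da; have da' := differentiable_pairr da.
by rewrite (jac_mulmx d da') derive_pairr.
Qed.

Lemma grad_pairr k (a : 'rV[R]_n * 'rV[R]_m -> 'rV[R]_k) x y i (d : 'cV[R]_m) :
  differentiable a (x, y) ->
  (grad (fun y => a (x, y) 0 i) y *m d) 0 0 = 'D_((0, d^T)) a (x, y) 0 i.
Proof.
move=> da; have da' := differentiable_pairr da.
by rewrite -(row_jac i da') -row_mul jac_pairr // mxE mxE.
Qed.

(** Second-order sufficiency is positivity on the common kernel of the active
    gradients; [finsler] makes it an inequality in all directions, which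
    survives perturbation. *)
Lemma lower_coercive : exists c al : R, [/\ 0 < c, 0 < al & forall v,
  al * `|v| ^+ 2 <= dotr ('D_(y_dir v) dL ustar) v +
    c * dotr ('D_(y_dir v) ac ustar) ('D_(y_dir v) ac ustar)].
Proof.
have [df dh dg] := smooth_star.
have dh' := differentiable_pairr dh; have dg' := differentiable_pairr dg.
set Jh := jac (fun y => h (xs, y)) ys; set Jg := jac (fun y => g (xs, y)) ys.
set Q := hess_yy_lagr f h g xs ys mus xis.
pose A : 'M[R]_(m, r + s) := row_mx Jh^T (Jg^T *m (1%:M - W0)).
have dgL := Ck_differentiable (Ck_gradL mus xis f_smooth g_smooth h_smooth).
have QE v : 'D_(y_dir v) dL ustar = v *m Q^T.
  have := hess_yy_gradL v^T dgL; rewrite /us !u_rowE -/Q trmxK => E.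
  by rewrite -[LHS]trmxK -E trmx_mul trmxK.
have AE v : 'D_(y_dir v) ac ustar = v *m A.
  rewrite derive_active_constraints u_xy_star // u_xy_y_dir /A mul_mx_row mulmxA.
  have Jh' : v *m Jh^T = 'D_((0, v)) h (xs, ys).
    by rewrite mulmx_trr /Jh jac_pairr // !trmxK.
  have Jg' : v *m Jg^T = 'D_((0, v)) g (xs, ys).
    by rewrite mulmx_trr /Jg jac_pairr // !trmxK.
  by rewrite Jh' Jg'.
have PE v : dotr (v *m (A *m A^T)) v = dotr (v *m A) (v *m A).
  by rewrite !dotrE trmx_mul !mulmxA.
have [|v v0|c [al [c0 al0 H]]] := @finsler R m Q^T (A *m A^T).
- by move=> v; rewrite PE dotr_ge0.
- rewrite PE => /dotr_eq0; rewrite -AE derive_active_constraints u_xy_star // u_xy_y_dir.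
  rewrite -row_mx0 => /eq_row_mx[Dh Dg].
  have sosc : forall d, lower_critical_cone f h g xs ys d -> d != 0 ->
        0 < (d^T *m Q *m d) 0 0 by have [] := juc.
  have -> : dotr (v *m Q^T) v = (v *m Q *m v^T) 0 0.
    by rewrite dotrC dotrE trmx_mul (trmxK Q) mulmxA.
  have := sosc v^T; rewrite [v^T^T]trmxK; apply; last first.
    by rewrite -trmx0 (inj_eq trmx_inj).
  have gact i : act i -> 'D_((0, v)) g (xs, ys) 0 i = 0.
    by move=> ai; have := mul_active_mx g xs ys ('D_((0, v)) g (xs, ys)) i; rewrite Dg ai mxE.
  split.
  - by rewrite jac_pairr // trmxK Dh trmx0.
  - by move=> i /eqP ai; rewrite grad_pairr // trmxK gact.
  - have gL : grad_y_lagr f h g xs ys mus xis = 0 by have [[]] := juc.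
    rewrite (stationary_grad_f _ df dh dg gL) !jac_pairr // !trmxK Dh dotr0r add0r.
    rewrite [dotr _ _]big1 ?oppr0 // => i _.
    have [/gact ->|/(multiplier_inactive juc) ->] := boolP (act i); first by rewrite mulr0.
    by rewrite mul0r.
exists c, al; split=> // v; by rewrite QE AE -PE; apply: H.
Qed.

Lemma differentiable_lagr x y mu xi : differentiable f (x, y) ->
  differentiable h (x, y) -> differentiable g (x, y) ->
  differentiable (fun y => lagr f h g x y mu xi) y.
Proof.
move=> df dh dg.
have df' := differentiable_pairr df; have dh' := differentiable_pairr dh.
have dg' := differentiable_pairr dg.
have dh2 : differentiable (fun y => dotr mu (h (x, y))) y.
  apply: (@differentiable_comp _ _ _ _ (fun y => h (x, y)) (dotr mu)) dh' _.
  exact/linear_differentiable/rV_linear_continuous.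
have dg2 : differentiable (fun y => dotr xi (g (x, y))) y.
  apply: (@differentiable_comp _ _ _ _ (fun y => g (x, y)) (dotr xi)) dg' _.
  exact/linear_differentiable/rV_linear_continuous.
exact: differentiableD (differentiableD df' dh2) dg2.
Qed.

Lemma y_dirZ t v : t *: y_dir v = y_dir (t *: v).
Proof. by rewrite /y_dir !scale_row_mx !scaler0. Qed.

Lemma dotr_sqr_le k (a b : 'rV[R]_k) (e : R) : `|a - b| <= e ->
  dotr a a <= 2 * dotr b b + 2 * (k%:R * e ^+ 2).
Proof.
move=> abe.
have -> : 2 * dotr b b + 2 * (k%:R * e ^+ 2) =
    \sum_(i < k) (2 * (b 0 i * b 0 i) + 2 * e ^+ 2).
  rewrite big_split /= -mulr_sumr sumr_const card_ord; congr (_ + _).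
  by rewrite -[RHS]mulr_natl mulrCA.
apply: ler_sum => i _.
have : `|a 0 i - b 0 i| <= e.
  by apply: le_trans abe; have := mx_entry_le (a - b) 0 i; rewrite !mxE.
set x := a 0 i; set y := b 0 i => xye.
have xy2 : (x - y) ^+ 2 <= e ^+ 2.
  by rewrite -(real_normK (num_real (x - y))) lerXn2r // nnegrE (le_trans _ xye).
have : 0 <= (x - 2 * y) ^+ 2 by rewrite sqr_ge0.
rewrite !expr2 in xy2 *; move=> H; lra.
Qed.

(** [e] is the error allowed in the derivatives of the gradient and of the
    active constraints: it costs at most half of the coercivity constant [al]. *)
Lemma lower_constants : exists (c al e : R), [/\ 0 < c, 0 < e,
  (m%:R * e + 2 * c * ((r + s)%:R * e ^+ 2)) <= al / 2, 0 < al & forall v,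
  al * `|v| ^+ 2 <= dotr ('D_(y_dir v) dL ustar) v +
    c * dotr ('D_(y_dir v) ac ustar) ('D_(y_dir v) ac ustar)].
Proof.
have [c [al [c0 al0 H]]] := lower_coercive.
pose M : R := m%:R + 2 * c * (r + s)%:R + 1.
have M0 : 0 < M.
  by rewrite ltr_pwDr // addr_ge0 // mulr_ge0 // mulr_ge0 // ltW.
pose e := Num.min 1 (al / 2 / M).
have e0 : 0 < e by rewrite lt_min ltr01 !divr_gt0.
have e1 : e <= 1 by rewrite ge_min lexx.
exists c, al, e; split=> //.
have ee : e ^+ 2 <= e by rewrite expr2 ler_piMr // ltW.
have eM : e * M <= al / 2 by rewrite -ler_pdivlMr // ge_min lexx orbT.
have ck : 0 <= 2 * c * (r + s)%:R by rewrite mulr_ge0 // mulr_ge0 // ltW.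
have : 2 * c * (r + s)%:R * e ^+ 2 <= 2 * c * (r + s)%:R * e by rewrite ler_wpM2l.
move: eM; rewrite /M mulrDr mulrDr mulr1 !mulrA [e * m%:R]mulrC.
rewrite [e * 2]mulrC -![_ * e * c]mulrA [e * c]mulrC !mulrA.
rewrite -[2 * c * e * _]mulrA [e * _%:R]mulrC !mulrA => H1 H2.
by move: H2; rewrite -!mulrA => H2; rewrite -!mulrA in H1 *; lra.
Qed.

(** Let [psi] be the Lagrangian with the multipliers of [y1].  By coercivity,
    [psi y2 - psi y1] is at least a positive multiple of [`|y2 - y1| ^+ 2]
    minus [c] times the square of the active constraints at [y2], up to small
    errors.  The latter is absorbed by the multiplier term in [f (x, y2) - f
    (x, y1) = psi y2 - psi y1 - dotr xi (g (x, y2))], because near [u*] one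
    has [c * - g_i < xi_i] for active [i]. *)
Lemma lower_growth : exists2 rho : R, 0 < rho & forall x y1 y2 mu xi,
  `|row_mx x (row_mx y1 (row_mx mu xi)) - ustar| < rho ->
  `|row_mx x (row_mx y2 (row_mx mu xi)) - ustar| < rho ->
  [/\ grad_y_lagr f h g x y1 mu xi = 0, h (x, y1) = 0, nneg xi,
      npos (g (x, y1)) & dotr xi (g (x, y1)) = 0] ->
  lower_feasible h g x y2 -> f (x, y1) <= f (x, y2).
Proof.
have [c [al [e [c0 e0 eal al0 H]]]] := lower_constants.
have CL := CkS (Ck_gradL mus xis f_smooth g_smooth h_smooth).
have Cac := CkS Ck_active_constraints.
have dLs := Ck_differentiable CL; have dacs := Ck_differentiable Cac.
have [r1 r10 sL] := Ck1_strict_diff CL e0.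
have [r2 r20 sA] := Ck1_strict_diff Cac e0.
have nsm := near_star mus xis (near_smooth f_smooth g_smooth h_smooth).
have [Cg _] := g_smooth.
(* xis is positive and g vanishes at u* on the active indices. *)
have nact : \forall u \near ustar, forall i, act i -> c * - g (u_xy u) 0 i < u_xi u 0 i.
  apply: (@filter_forall _ _ (fun i (u : U) => act i -> c * - g (u_xy u) 0 i < u_xi u 0 i)
    (nbhs ustar)) => i.
  have [ai|nai] := boolP (act i); last by apply: nearW.
  pose q (u : U) := u_xi u 0 i + c * g (u_xy u) 0 i.
  have Cq : Ck 0 q ustar.
    apply: CkD; first exact: Ck_entry (Ck_u_xi 0 ustar).
    apply: CkM; first exact: Ck_cst.
    by apply: Ck_entry; exact: Ck_star (Ck_le (leq0n 2) Cg).
  have q0 : 0 < q ustar.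
    rewrite /q /us u_xi_row u_xy_row (eqP ai) mulr0 addr0.
    by have := complementarity_sign juc i; rewrite ai (eqP ai) add0r.
  have nq : \forall u \near ustar, 0 < q u by exact: (Ck_continuous Cq (lt_nbhsr q0)).
  apply: filterS nq => u; rewrite /q => qu _.
  by rewrite mulrN ltrNl -subr_gt0 opprK addrC.
have [r3 r30 Hr3] := (near_normP _ _).1 (filterI nsm nact).
exists (Num.min r1 (Num.min r2 r3)); first by rewrite !lt_min r10 r20.
move=> x y1 y2 mu xi; set u1 := row_mx x _; set u2 := row_mx x _.
move=> u1r u2r [gL1 h1 xi0 g1 cs1] [h2 g2].
pose v := y2 - y1.
have u21 : u2 - u1 = y_dir v.
  by rewrite /u2 /u1 /y_dir !(opp_row_mx, add_row_mx) !subrr row_mx0.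
have seg (t : R) : 0 <= t <= 1 -> `|u1 + t *: y_dir v - ustar| < Num.min r1 (Num.min r2 r3).
  by move=> t01; rewrite -u21; apply: segment_norm_lt.
have segE (t : R) : u1 + t *: y_dir v = row_mx x (row_mx (y1 + t *: v) (row_mx mu xi)).
  by rewrite y_dirZ /u1 /y_dir !add_row_mx !addr0.
set DL := 'D_(y_dir v) dL ustar in H; set DA := 'D_(y_dir v) ac ustar in H.
have {}H := H v; rewrite -/DL -/DA in H.
have dL1 : dL u1 = 0 by rewrite /gradL /u1 !u_rowE.
pose nv := `|v|; have nv0 : 0 <= nv by exact: normr_ge0.
(* Strict differentiability of the gradient bounds its growth along the
   segment from y1 to y2; it vanishes at y1. *)
have LB (t : R) : 0 <= t <= 1 ->
    t * (dotr DL v - m%:R * e * nv ^+ 2) <= dotr v (dL (u1 + t *: y_dir v)).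
  move=> t01; have := seg t t01; rewrite !lt_min => /andP[ut _].
  have := u1r; rewrite !lt_min => /andP[u1r1 _].
  have := sL _ _ ut u1r1; rewrite dL1 subr0 addrAC subrr add0r -scalemxAl.
  rewrite -deriveEjacobian // -/DL => HL.
  have /andP[t0 _] := t01.
  have HL' : `|dL (u1 + t *: y_dir v) - t *: DL| <= t * (e * nv).
    rewrite (le_trans HL) // normrZ (ger0_norm t0) mulrCA ler_wpM2l //.
    by apply: ler_wpM2l (y_dir_norm v); rewrite ltW.
  have := dotr_norm_le v (dL (u1 + t *: y_dir v) - t *: DL).
  rewrite dotrDr dotrNr dotrZr => HD.
  have : `|dotr v (dL (u1 + t *: y_dir v)) - t * dotr v DL| <= m%:R * (nv * (t * (e * nv))).
    by rewrite (le_trans HD) // ler_wpM2l // ler_wpM2l.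
  rewrite ler_norml => /andP[HH _]; rewrite dotrC in HH *.
  move: HH; rewrite [dotr v DL]dotrC mulrBr expr2.
  have -> : t * (m%:R * e * (nv * nv)) = m%:R * (nv * (t * (e * nv))) by ring.
  by set a := dotr _ v; set b := dotr _ v => HH; lra.
set kap := dotr DL v - m%:R * e * nv ^+ 2 in LB.
pose psi y := lagr f h g x y mu xi.
have dpsi (t : R) : 0 <= t <= 1 ->
    is_derive t 1 (fun t : R => psi (y1 + t *: v)) (dotr v (dL (u1 + t *: y_dir v))).
  move=> t01; have := seg t t01; rewrite !lt_min => /and3P[_ _ /Hr3[+ _]].
  rewrite segE u_xy_row => -[df dh dg].
  have dp := differentiable_lagr mu xi df dh dg.
  have := is_derive_line dp; rewrite (derive_grad _ dp).
  by rewrite /gradL !u_rowE.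
(* The mean value theorem applied to psi minus a quadratic integrates LB. *)
pose k (t : R) := psi (y1 + t *: v) - (t * 0 + t ^+ 2 / 2 * kap).
have dk (t : R) : 0 <= t <= 1 ->
    is_derive t 1 k (dotr v (dL (u1 + t *: y_dir v)) - (0 + t * kap)).
  by move=> t01; exact: is_deriveB (dpsi t t01) (is_derive_quadratic _ _ _).
have [||t] := @MVT R k (fun t : R => dotr v (dL (u1 + t *: y_dir v)) - (0 + t * kap)) 0 1 ltr01.
- by move=> t; rewrite in_itv /= => /andP[t0 t1]; apply: dk; rewrite !ltW.
- apply: derivable_within_continuous => t; rewrite in_itv /= => t01.
  by have [] := dk t t01.
rewrite in_itv /= => /andP[t0 t1].
have -> : k 1 = psi (y1 + v) - kap / 2.
  by rewrite /k scale1r; lra.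
have -> : k 0 = psi y1.
  by rewrite /k scale0r addr0; lra.
rewrite subr0 mulr1 add0r => E.
have t01 : 0 <= t <= 1 by rewrite !ltW.
have psiE : kap / 2 <= psi y2 - psi y1.
  have := LB t t01; rewrite -subr_ge0 -E /v [y1 + _]addrC subrK.
  by move=> Hk; lra.
have fE : psi y2 - psi y1 = f (x, y2) - f (x, y1) + dotr xi (g (x, y2)).
  by rewrite /psi /lagr h1 h2 cs1 !dotr0r !addr0 addrAC.
have acE : ac u2 = row_mx 0 (g (x, y2) *m (1%:M - W0)) by rewrite /ac /u2 u_xy_row h2.
have /and3P[u2r1 u2r2 u2r3] : [&& `|u2 - ustar| < r1, `|u2 - ustar| < r2 & `|u2 - ustar| < r3].
  by rewrite -!lt_min.
have /and3P[u1r1 u1r2 u1r3] : [&& `|u1 - ustar| < r1, `|u1 - ustar| < r2 & `|u1 - ustar| < r3].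
  by rewrite -!lt_min.
have [_ act2] := Hr3 _ u2r3; rewrite /u2 u_xy_row u_xi_row in act2.
have ac1 : ac u1 = 0.
  rewrite /ac /u1 u_xy_row h1.
  have -> : g (x, y1) *m (1%:M - W0) = 0; last by rewrite row_mx0.
  apply/rowP => i; rewrite mul_active_mx mxE; case: ifPn => // ai.
  have xip : 0 < xi 0 i.
    apply: le_lt_trans (act2 i ai); apply: mulr_ge0 (ltW c0) _; rewrite oppr_ge0; exact: g2.
  have csle j : xi 0 j * g (x, y1) 0 j <= 0 by rewrite mulr_ge0_le0.
  have /eqP := dotr_terms_eq0 csle cs1 i.
  by rewrite mulf_eq0 gt_eqF //= => /eqP.
have HA : dotr DA DA <= 2 * dotr (ac u2) (ac u2) + 2 * ((r + s)%:R * (e * nv) ^+ 2).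
  apply: dotr_sqr_le; rewrite distrC.
  have := sA _ _ u2r2 u1r2; rewrite ac1 subr0 u21 -deriveEjacobian // -/DA => HH.
  rewrite (le_trans HH) //.
  by apply: ler_wpM2l (y_dir_norm v); rewrite ltW.
(* The feasible point y2 has nonpositive active constraints, dominated by
   the multipliers. *)
have HG : c * dotr (ac u2) (ac u2) <= - dotr xi (g (x, y2)).
  rewrite acE dotrE tr_row_mx mul_row_col trmx0 mulmx0 add0r -dotrE -dotrNr.
  rewrite /dotr mulr_sumr; apply: ler_sum => i _; rewrite mul_active_mx [X in _ <= _ * X]mxE.
  have gi := g2 i; case: ifPn => ai; last first.
    by rewrite !mulr0 mulr_ge0 // oppr_ge0.
  have := act2 i ai; set gg := g (x, y2) 0 i in gi * => Hc.
  have -> : c * (gg * gg) = (c * - gg) * - gg by ring.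
  by rewrite ler_wpM2r ?oppr_ge0 // ltW.
have n2 : 0 <= nv ^+ 2 by rewrite sqr_ge0.
have Hal : (m%:R * e + 2 * c * ((r + s)%:R * e ^+ 2)) * nv ^+ 2 <= al / 2 * nv ^+ 2.
  by rewrite ler_wpM2r.
have Han : 0 <= al * nv ^+ 2 by rewrite mulr_ge0 // ltW.
have HA' : c * dotr DA DA <= c * (2 * dotr (ac u2) (ac u2)) +
    2 * c * ((r + s)%:R * e ^+ 2) * nv ^+ 2.
  have -> : c * (2 * dotr (ac u2) (ac u2)) + 2 * c * ((r + s)%:R * e ^+ 2) * nv ^+ 2 =
     c * (2 * dotr (ac u2) (ac u2) + 2 * ((r + s)%:R * (e * nv) ^+ 2)) by ring.
  by rewrite ler_pM2l.
rewrite -subr_ge0.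
have -> : f (x, y2) - f (x, y1) = psi y2 - psi y1 - dotr xi (g (x, y2)).
  by rewrite fE addrK.
rewrite mulrDl in Hal; move: psiE H HA' HG Hal Han; rewrite /kap -/nv mulrDl.
have -> : al / 2 * nv ^+ 2 = al * nv ^+ 2 / 2 by ring.
set A1 := dotr DA DA; set A2 := dotr (ac u2) _; set A3 := dotr DL v; set A4 := dotr xi _.
set A5 := m%:R * e * nv ^+ 2; set A6 := 2 * c * _ * nv ^+ 2; set A7 := al * nv ^+ 2.
have -> : c * (2 * A2) = 2 * (c * A2) by ring.
by move=> ? ? ? ? ? ?; lra.
Qed.

End lower_level_stability.

(** * Persistence of the Jacobian uniqueness conditions *)

(** The arithmetic of [near_sosc]: [t5] is the coercivity bound, [t6] the
    error in the Hessian and [t4] the error in the active gradients. *)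
Lemma perturbed_coercivity (R : realFieldType) (t1 t2 t3 t4 t5 t6 : R) :
  0 < t5 -> t5 <= t2 + t3 -> t2 - t1 <= t6 -> t3 <= t4 -> t6 + t4 <= t5 / 2 -> 0 < t1.
Proof. by move=> *; lra. Qed.

Section persistence.
Context {R : realType} {n m r s : nat}.
Variables (f : 'rV[R]_n * 'rV[R]_m -> R)
  (h : 'rV[R]_n * 'rV[R]_m -> 'rV[R]_r) (g : 'rV[R]_n * 'rV[R]_m -> 'rV[R]_s).
Variables (xs : 'rV[R]_n) (ys : 'rV[R]_m) (mus : 'rV[R]_r) (xis : 'rV[R]_s).

Local Notation U := 'rV[R]_(n + (m + (r + s))).
Local Notation ustar := (us xs ys mus xis).

Hypotheses (f_smooth : C2_C3y f (xs, ys)) (g_smooth : C2_C3y g (xs, ys))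
  (h_smooth : C2_C3y h (xs, ys)).
Hypothesis juc : jacobian_uniqueness f h g xs ys mus xis.

Local Notation W0 := (inactive_mx g xs ys).
Local Notation act := (active g xs ys).
Local Notation dL := (gradL f h g).
Local Notation ac := (active_constraints h g xs ys).
Local Notation yd := (@y_dir R n m r s).
Local Notation kkt := (kkt_res f h g).

Lemma kkt_res_signs : \forall u \near ustar, kkt u = 0 ->
  forall i, if act i then g (u_xy u) 0 i = 0 /\ 0 < u_xi u 0 i
            else g (u_xy u) 0 i < 0 /\ u_xi u 0 i = 0.
Proof.
have nc := near_comp_res g_smooth juc.
apply: filterS nc => u [sgn cE] + i.
rewrite /kkt_res cE -!row_mx0 => /eq_row_mx[_ /eq_row_mx[_ /eqP]].
rewrite subr_eq0 => /eqP/(congr1 (fun z : 'rV_s => z 0 i)).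
rewrite /= mul_active_mx mul_inactive_mx.
by have := sgn i; case: ifPn => ai + E0; rewrite E0 ?add0r // -E0 addr0.
Qed.

(** A linear relation between the active gradients at [u] is a multiplier
    direction in which the derivative of the gradient of the Lagrangian
    vanishes at [u], hence almost vanishes at [u*]; but there the derivative
    of [kkt_res] is invertible, which bounds the direction by this small
    derivative. *)
Lemma near_licq : \forall u \near ustar, kkt u = 0 ->
  free ([seq grad (fun y' => h (u_x u, y') 0 j) (u_y u) | j : 'I_r] ++
        [seq grad (fun y' => g (u_x u, y') 0 i) (u_y u) |
              i <- enum 'I_s & g (u_x u, u_y u) 0 i == 0]).
Proof.
have CL := CkS (Ck_gradL mus xis f_smooth g_smooth h_smooth).
have dK := Ck_differentiable (Ck_kkt_res f_smooth g_smooth h_smooth juc).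
set B := dsubmx ('J kkt ustar).
have uB : B \in unitmx by exact: kkt_res_unit.
pose b : R := (m + (r + s))%:R * `|invmx B| + 1.
have b0 : 0 < b by rewrite ltr_wpDl // mulr_ge0.
have e0 : 0 < (2 * b)^-1 by rewrite invr_gt0 mulr_gt0.
have [d d0 Hd] := Ck1_derive_close CL e0.
have nd : \forall u \near ustar, `|u - ustar| < d by apply/near_normP; exists d.
have nsm := near_star mus xis (near_smooth f_smooth g_smooth h_smooth).
apply: filterS3 nd nsm kkt_res_signs => u ud [df dh dg] sgn ku.
have {}sgn := sgn ku; have [_ {}Hd] := Hd u ud.
apply/free_catP => cc ee esupp E.
pose dmu : 'rV[R]_r := \row_j cc j; pose dxi : 'rV[R]_s := \row_i ee i.
pose w' : 'rV[R]_(m + (r + s)) := row_mx 0 (row_mx dmu dxi).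
have dh' := differentiable_pairr dh; have dg' := differentiable_pairr dg.
have Du0 : 'D_(row_mx 0 w') dL u = 0.
  rewrite derive_gradL_mult // !mulmx_sum_row; apply: etrans E.
  by congr (_ + _); apply: eq_bigr => j _; rewrite row_jac // ?[dmu _ _]mxE ?[dxi _ _]mxE.
have Dk : 'D_(row_mx 0 w') kkt ustar = row_mx ('D_(row_mx 0 w') dL ustar) 0.
  rewrite (derive_kkt_res f_smooth g_smooth h_smooth juc) u_xy_row u_xi_row.
  congr row_mx.
  rewrite !derive0 mul0mx sub0r.
  have -> : dxi *m W0 = 0; last by rewrite oppr0 row_mx0.
  apply/rowP => i; rewrite mul_inactive_mx [RHS]mxE; case: ifPn => // ai; rewrite mxE.
  apply: esupp; have := sgn i; rewrite (negbTE ai) => -[gi _].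
  by rewrite lt_eqF.
(* The inactive entries of dxi vanish, so only the first block of the
   derivative of kkt_res at u* remains. *)
have w'E : w' = row_mx ('D_(row_mx 0 w') dL ustar) 0 *m invmx B.
  by rewrite -Dk derive_partial // mulmxK.
have wn : `|row_mx (0 : 'rV[R]_n) w'| <= `|w'|.
  by apply: norm_row_mx_le; rewrite ?normr0.
have Dn : `|'D_(row_mx 0 w') dL ustar| <= (2 * b)^-1 * `|w'|.
  have := Hd (row_mx 0 w'); rewrite Du0 sub0r normrN => H.
  by rewrite (le_trans H) // ler_wpM2l // ltW.
have w'n : `|w'| <= b * ((2 * b)^-1 * `|w'|).
  rewrite {1}w'E (le_trans (mulmx_norm_le _ _)) // mulrAC ler_pM //.
  - by rewrite /b lerDl.
  - by apply: norm_row_mx_le => //; rewrite normr0 mulr_ge0 // ltW.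
have w'0 : w' = 0.
  apply/eqP; rewrite -normr_eq0; apply/eqP/le_anti; rewrite normr_ge0 andbT.
  have bE : b * ((2 * b)^-1 * `|w'|) = `|w'| / 2.
    by field; rewrite gt_eqF.
  by rewrite bE in w'n; have := normr_ge0 w'; lra.
move: w'0; rewrite /w' -!row_mx0 => /eq_row_mx[_ /eq_row_mx[m0 x0]].
by split=> [j|i]; [have := congr1 (fun z : 'rV_r => z 0 j) m0|
  have := congr1 (fun z : 'rV_s => z 0 i) x0]; rewrite /= !mxE.
Qed.

(** Active multipliers are positive, so a critical direction at [u]
    annihilates all active gradients at [u], and almost annihilates those at
    [u*]; the inequality of [lower_coercive] then gives positivity. *)
Lemma near_sosc : \forall u \near ustar, kkt u = 0 ->
  forall d, lower_critical_cone f h g (u_x u) (u_y u) d -> d != 0 ->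
    0 < (d^T *m hess_yy_lagr f h g (u_x u) (u_y u) (u_mu u) (u_xi u) *m d) 0 0.
Proof.
have [c [al [e [c0 e0 eal al0 H]]]] := lower_constants f_smooth g_smooth h_smooth juc.
have CL := CkS (Ck_gradL mus xis f_smooth g_smooth h_smooth).
have Cac := CkS (Ck_active_constraints mus xis g_smooth h_smooth).
have [d1 d10 HL] := Ck1_derive_close CL e0.
have [d2 d20 HA] := Ck1_derive_close Cac e0.
have nd1 : \forall u \near ustar, `|u - ustar| < d1 by apply/near_normP; exists d1.
have nd2 : \forall u \near ustar, `|u - ustar| < d2 by apply/near_normP; exists d2.
have nsm := near_star mus xis (near_smooth f_smooth g_smooth h_smooth).
apply: filterS2 (filterI nd1 nd2) (filterI nsm kkt_res_signs).
move=> u [/HL[du {}HL] /HA[_ {}HA]] [[df dh dg] sgn] ku d [hd gd fd] dn0.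
have {}sgn := sgn ku; pose v := d^T.
have gL : grad_y_lagr f h g (u_x u) (u_y u) (u_mu u) (u_xi u) = 0.
  by move: ku; rewrite /kkt_res -!row_mx0 => /eq_row_mx[].
have Dh : 'D_((0, v)) h (u_xy u) = 0.
  by apply: trmx_inj; rewrite trmx0 -jac_pairr.
have Dgle i : act i -> 'D_((0, v)) g (u_xy u) 0 i <= 0.
  move=> ai; rewrite /v -grad_pairr //; apply: gd.
  by have := sgn i; rewrite ai => -[].
(* Stationarity makes the nonpositive terms xi_i <grad g_i, d> sum to a
   nonnegative number. *)
have termle i : u_xi u 0 i * 'D_((0, v)) g (u_xy u) 0 i <= 0.
  have := sgn i; case: ifPn => ai [g0 x0]; last by rewrite x0 mul0r.
  by rewrite pmulr_rle0 //; apply: Dgle.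
have Dg : dotr (u_xi u) ('D_((0, v)) g (u_xy u)) = 0.
  apply/le_anti/andP; split; first by apply: sumr_le0 => i _; apply: termle.
  move: fd; rewrite (stationary_grad_f _ df dh dg gL) hd trmx0 dotr0r add0r jac_pairr //.
  by rewrite trmxK oppr_le0.
have Dact i : act i -> 'D_((0, v)) g (u_xy u) 0 i = 0.
  move=> ai; have := sgn i; rewrite ai => -[_ xi0].
  have /eqP := dotr_terms_eq0 termle Dg i.
  by rewrite mulf_eq0 gt_eqF //= => /eqP.
have acu : 'D_(yd v) ac u = 0.
  rewrite derive_active_constraints // u_xy_y_dir Dh.
  have -> : 'D_((0, v)) g (u_xy u) *m (1%:M - W0) = 0; last by rewrite row_mx0.
  by apply/rowP => i; rewrite mul_active_mx [RHS]mxE; case: ifPn => // /Dact.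
have vn0 : v != 0 by rewrite -[0]trmx0 (inj_eq trmx_inj).
pose nv := `|v|; have nv0 : 0 < nv by rewrite normr_gt0.
have hE : (d^T *m hess_yy_lagr f h g (u_x u) (u_y u) (u_mu u) (u_xi u) *m d) 0 0 =
    dotr ('D_(yd v) dL u) v.
  by rewrite -mulmxA hess_yy_gradL // dotrC dotrE.
rewrite hE; have {}H := H v.
have HA' : dotr ('D_(yd v) ac ustar) ('D_(yd v) ac ustar) <=
    2 * 0 + 2 * ((r + s)%:R * (e * nv) ^+ 2).
  have <- : dotr (0 : 'rV[R]_(r + s)) 0 = 0 by rewrite dotr0r.
  apply: dotr_sqr_le; rewrite subr0.
  have := HA (yd v); rewrite acu sub0r normrN => HH.
  rewrite (le_trans HH) //.
  by apply: ler_wpM2l (y_dir_norm v); rewrite ltW.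
have HL' : dotr ('D_(yd v) dL ustar) v - dotr ('D_(yd v) dL u) v <=
    m%:R * (nv * (e * nv)).
  rewrite -dotrNl -dotrDl dotrC; apply: le_trans (ler_norm _) _.
  apply: le_trans (dotr_norm_le _ _) _; rewrite ler_wpM2l // ler_wpM2l //.
  have HH : e * `|yd v| <= e * nv by apply: ler_wpM2l (y_dir_norm v); rewrite ltW.
  apply: le_trans HH; move: (HL (yd v)).
  move: ('D_(yd v) dL u) ('D_(yd v) dL ustar) `|yd v| => a b t.
  by rewrite distrC.
have n2 : 0 < nv ^+ 2 by rewrite exprn_gt0.
have Hal : (m%:R * e + 2 * c * ((r + s)%:R * e ^+ 2)) * nv ^+ 2 <= al / 2 * nv ^+ 2.
  by rewrite ler_pM2r.
have Han : 0 < al * nv ^+ 2 by rewrite mulr_gt0.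
have HA2 : c * dotr ('D_(yd v) ac ustar) ('D_(yd v) ac ustar) <=
    2 * c * ((r + s)%:R * e ^+ 2) * nv ^+ 2.
  have -> : 2 * c * ((r + s)%:R * e ^+ 2) * nv ^+ 2 =
     c * (2 * 0 + 2 * ((r + s)%:R * (e * nv) ^+ 2)) by ring.
  by rewrite ler_pM2l.
rewrite [X in X <= _]mulrDl in Hal.
apply: perturbed_coercivity Han H _ HA2 _; first exact: HL'.
have -> : m%:R * (nv * (e * nv)) = m%:R * e * nv ^+ 2 by ring.
by move: Hal; rewrite [al / 2 * _]mulrAC.
Qed.

Lemma near_jacobian_uniqueness : \forall u \near ustar, kkt u = 0 ->
  jacobian_uniqueness f h g (u_x u) (u_y u) (u_mu u) (u_xi u).
Proof.
apply: filterS3 kkt_res_signs near_licq near_sosc => u sgn licq sosc ku.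
have {}sgn := sgn ku; have {}licq := licq ku; have {}sosc := sosc ku.
have /eq_row_mx[gL /eq_row_mx[h0 _]] : kkt u = row_mx 0 (row_mx 0 0) by rewrite ku !row_mx0.
split=> //; last first.
  by move=> i; have := sgn i; case: ifPn => _ [g0 x0]; rewrite ?g0 ?x0 ?subr0 ?sub0r ?oppr_gt0.
split=> //.
- by move=> i; have := sgn i; case: ifPn => _ [g0 x0]; [rewrite ltW|rewrite x0].
- by move=> i; have := sgn i; case: ifPn => _ [g0 x0]; [rewrite [X in X <= _]g0|rewrite ltW].
- rewrite /dotr big1 // => i _.
  by have := sgn i; case: ifPn => _ [g0 x0]; [rewrite [X in _ * X]g0 mulr0|rewrite x0 mul0r].
Qed.

End persistence.

(** * The branch of lower-level KKT points *)

Section solution_map.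
Context {R : realType} {n m r s : nat}.
Variables (f : 'rV[R]_n * 'rV[R]_m -> R)
  (h : 'rV[R]_n * 'rV[R]_m -> 'rV[R]_r) (g : 'rV[R]_n * 'rV[R]_m -> 'rV[R]_s).
Variables (xs : 'rV[R]_n) (ys : 'rV[R]_m) (mus : 'rV[R]_r) (xis : 'rV[R]_s).

Local Notation U := 'rV[R]_(n + (m + (r + s))).
Local Notation ustar := (us xs ys mus xis).

Hypotheses (f_smooth : C2_C3y f (xs, ys)) (g_smooth : C2_C3y g (xs, ys))
  (h_smooth : C2_C3y h (xs, ys)).
Hypothesis juc : jacobian_uniqueness f h g xs ys mus xis.

Local Notation kkt := (kkt_res f h g).

Lemma kkt_map_exists : exists (d1 e1 : R) y mu xi, kkt_map f h g xs ys mus xis d1 e1 y mu xi.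
Proof.
have CK := Ck_kkt_res f_smooth g_smooth h_smooth juc.
have uK := kkt_res_unit f_smooth g_smooth h_smooth juc.
have K0 := kkt_res_star g_smooth juc.
have [v [v0 Kv cv]] := implicit_function_exists (Ck1_strict_diff (CkS CK)) uK K0.
have gE : graph_map v xs = ustar by rewrite /graph_map v0.
have Cv : Ck 2 v xs.
  have CK' : Ck 2 kkt (row_mx xs (v xs)) by rewrite v0; exact: CK.
  have uK' : dsubmx ('J kkt (row_mx xs (v xs))) \in unitmx by rewrite v0; exact: uK.
  exact: (Ck_implicit CK' uK' Kv cv).
have cg := Ck_continuous (Ck_graph_map Cv).
rewrite /prop_for /continuous_at gE in cg.
have nj : \forall x \near xs, kkt (graph_map v x) = 0 ->
   jacobian_uniqueness f h g (u_x (graph_map v x)) (u_y (graph_map v x))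
     (u_mu (graph_map v x)) (u_xi (graph_map v x)).
  exact: cg (near_jacobian_uniqueness f_smooth g_smooth h_smooth juc).
pose y x := lsubmx (v x); pose mu x := lsubmx (rsubmx (v x)).
pose xi x := rsubmx (rsubmx (v x)).
have Cl (N P : nat) (V : normedModType R) k (a : V -> 'rV[R]_(N + P)) z :
    Ck k a z -> Ck k (fun x => lsubmx (a x)) z.
  move=> Ca; apply: (@Ck_post _ _ _ _ k lsubmx _ a z Ca).
  exact: rV_linear_continuous.
have Cr (N P : nat) (V : normedModType R) k (a : V -> 'rV[R]_(N + P)) z :
    Ck k a z -> Ck k (fun x => rsubmx (a x)) z.
  move=> Ca; apply: (@Ck_post _ _ _ _ k rsubmx _ a z Ca).
  exact: rV_linear_continuous.
have C2 x : Ck 2 v x -> [/\ Ck 2 y x, Ck 2 mu x & Ck 2 xi x].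
  by move=> Cvx; split; [exact: Cl|exact/Cl/Cr|exact/Cr/Cr].
have [Cy Cmu Cxi] := C2 xs Cv.
have y0 : y xs = ys by rewrite /y v0 row_mxKl.
have mu0 : mu xs = mus by rewrite /mu v0 row_mxKr row_mxKl.
have xi0 : xi xs = xis by rewrite /xi v0 !row_mxKr.
have ny : \forall x \near xs, eball ys 1 (y x).
  by have := Ck_continuous Cy; apply; rewrite y0; exact: near_eball.
have nmu : \forall x \near xs, eball mus 1 (mu x).
  by have := Ck_continuous Cmu; apply; rewrite mu0; exact: near_eball.
have nxi : \forall x \near xs, eball xis 1 (xi x).
  by have := Ck_continuous Cxi; apply; rewrite xi0; exact: near_eball.
have nC := Ck_near Cv.
have [d d0 Hd] : exists2 d : R, 0 < d & forall x, eball xs d x ->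
  (eball ys 1 (y x) /\ eball mus 1 (mu x) /\ eball xis 1 (xi x)) /\
  (Ck 2 v x /\ kkt (row_mx x (v x)) = 0) /\ (kkt (graph_map v x) = 0 ->
   jacobian_uniqueness f h g (u_x (graph_map v x)) (u_y (graph_map v x))
     (u_mu (graph_map v x)) (u_xi (graph_map v x))).
  apply: near_eballP.
  exact: (filterI (filterI ny (filterI nmu nxi)) (filterI (filterI nC Kv) nj)).
exists d, 1, y, mu, xi; split=> // x /Hd[[? [? ?]] [[Cvx Kx] Jx]].
split; [by split|exact: C2|].
have := Jx Kx; rewrite /graph_map.
have -> : v x = row_mx (y x) (row_mx (mu x) (xi x)) by rewrite /y /mu /xi !hsubmxK.
by rewrite !u_rowE.
Qed.

Section given_map.
Variables (d1 e1 : R) (y : 'rV[R]_n -> 'rV[R]_m) (mu : 'rV[R]_n -> 'rV[R]_r)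
  (xi : 'rV[R]_n -> 'rV[R]_s).
Hypothesis kmap : kkt_map f h g xs ys mus xis d1 e1 y mu xi.

Definition kkt_point (x : 'rV[R]_n) : 'rV[R]_(m + (r + s)) :=
  row_mx (y x) (row_mx (mu x) (xi x)).

Lemma kkt_point_star : graph_map kkt_point xs = ustar.
Proof. by have [_ _ [y0 mu0 xi0] _] := kmap; rewrite /graph_map /kkt_point y0 mu0 xi0. Qed.

Lemma kkt_map_star : [/\ Ck 2 y xs, Ck 2 mu xs & Ck 2 xi xs].
Proof.
have [d0 _ _ H] := kmap; have [|_ C2 _] := H xs; last exact: C2.
by rewrite /eball /= subrr /enorm dotr0r sqrtr0 ltW.
Qed.

Lemma Ck_kkt_point : Ck 2 kkt_point xs.
Proof.
by have [? ? ?] := kkt_map_star; do 2![apply: Ck_row_mx => //].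
Qed.

Lemma near_kkt : \forall x \near xs, jacobian_uniqueness f h g x (y x) (mu x) (xi x).
Proof.
have [d0 _ _ H] := kmap.
by apply: filterS (near_eball xs d0) => x /H[].
Qed.

(** In each component one of [g] and [xi] vanishes, and [min (g + xi) 0 = g]
    in both cases. *)
Lemma kkt_comp_residual x y' xi' : nneg xi' -> npos (g (x, y')) ->
  dotr xi' (g (x, y')) = 0 -> comp_residual g x y' xi' = 0.
Proof.
move=> xi0 g0 cs; apply/rowP => i; rewrite /comp_residual eproj_npos !mxE.
have t0 : xi' 0 i * g (x, y') 0 i = 0.
  by apply: (dotr_terms_eq0 _ cs) => j; rewrite mulr_ge0_le0.
have := xi0 i; have := g0 i; move: (g _ 0 i) (xi' 0 i) t0 => a b /eqP.
rewrite mulf_eq0 => /orP[] /eqP -> a0 b0.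
  by rewrite addr0 min_l // subrr.
by rewrite sub0r add0r min_r // oppr0.
Qed.

Lemma near_kkt_res : \forall x \near xs, kkt (graph_map kkt_point x) = 0.
Proof.
apply: filterS near_kkt => x [[gL h0 xi0 g0 cs] _ _ _].
rewrite /kkt_res /comp_res /gradL /graph_map /kkt_point u_xy_row !u_rowE gL h0.
by rewrite kkt_comp_residual // !row_mx0.
Qed.

End given_map.
End solution_map.

(** * The reduced problem and its critical directions *)

Section bilevel.
Context {R : realType} {n m p q r s : nat}.
Variables (F f : 'rV[R]_n * 'rV[R]_m -> R)
  (H : 'rV[R]_n * 'rV[R]_m -> 'rV[R]_p) (G : 'rV[R]_n * 'rV[R]_m -> 'rV[R]_q)
  (h : 'rV[R]_n * 'rV[R]_m -> 'rV[R]_r) (g : 'rV[R]_n * 'rV[R]_m -> 'rV[R]_s).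
Variables (xs : 'rV[R]_n) (ys : 'rV[R]_m) (mus : 'rV[R]_r) (xis : 'rV[R]_s).

Local Notation U := 'rV[R]_(n + (m + (r + s))).
Local Notation ustar := (us xs ys mus xis).

Hypotheses (f_smooth : C2_C3y f (xs, ys)) (g_smooth : C2_C3y g (xs, ys))
  (h_smooth : C2_C3y h (xs, ys)).
Hypotheses (F_smooth : Ck 2 F (xs, ys)) (G_smooth : Ck 2 G (xs, ys))
  (H_smooth : Ck 2 H (xs, ys)).
Hypothesis juc : jacobian_uniqueness f h g xs ys mus xis.

Local Notation kkt := (kkt_res f h g).

Lemma jac_pair k (a : 'rV[R]_n * 'rV[R]_m -> 'rV[R]_k) x y (dx : 'cV[R]_n) (dy : 'cV[R]_m) :
  differentiable a (x, y) ->
  jac (fun x' => a (x', y)) x *m dx + jac (fun y' => a (x, y')) y *m dy =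
  ('D_((dx^T, dy^T)) a (x, y))^T.
Proof.
move=> da; have dl := differentiable_pairl da; have dr := differentiable_pairr da.
by rewrite (jac_mulmx dx dl) (jac_mulmx dy dr) (derive_pair_split _ _ da) linearD.
Qed.

Lemma grad_pair (a : 'rV[R]_n * 'rV[R]_m -> R) x y (dx : 'cV[R]_n) (dy : 'cV[R]_m) :
  differentiable a (x, y) ->
  (grad (fun x' => a (x', y)) x *m dx + grad (fun y' => a (x, y')) y *m dy) 0 0 =
  'D_((dx^T, dy^T)) a (x, y).
Proof.
move=> da; have dl := differentiable_pairl da; have dr := differentiable_pairr da.
by rewrite mxE (grad_mulmx dx dl) (grad_mulmx dy dr) (derive_pair_split _ _ da).
Qed.

(** The lower blocks of the matrix of the critical cone form the Jacobian of
    [kkt_res]. *)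
Lemma FP_matrix_mulmx (d : 'cV[R]_(n + (m + (r + s)))) :
  FP_matrix f H h g xs ys mus xis *m d =
  col_mx (jac (fun x' => H (x', ys)) xs *m usubmx d +
          jac (fun y' => H (xs, y')) ys *m usubmx (dsubmx d))
    (jac kkt ustar *m d).
Proof.
have dK := Ck_differentiable (Ck_kkt_res f_smooth g_smooth h_smooth juc).
have [df dh dg] := nbhs_singleton (near_smooth f_smooth g_smooth h_smooth).
rewrite (jac_mulmx d dK) (derive_kkt_res f_smooth g_smooth h_smooth juc).
pose dx := usubmx d; pose dy := usubmx (dsubmx d).
pose dmu := usubmx (dsubmx (dsubmx d)); pose dxi := dsubmx (dsubmx (dsubmx d)).
have dE : d = col_mx dx (col_mx dy (col_mx dmu dxi)) by rewrite !vsubmxK.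
have dtE : d^T = row_mx dx^T (row_mx dy^T (row_mx dmu^T dxi^T)) by rewrite {1}dE !tr_col_mx.
rewrite -/dx -/dy dtE (derive_gradL mus xis f_smooth g_smooth h_smooth) u_xy_row u_xi_row.
rewrite /FP_matrix (jac_eproj juc) !tr_row_mx (trmxK (_ + _)) -(jac_pair _ _ dh).
have trE (a : 'rV[R]_s) (b : 'cV[R]_s) (W := inactive_mx g xs ys) :
    (a *m (1%:M - W) - b^T *m W)^T = (1%:M - W) *m a^T - W *m b.
  by rewrite raddfB /= !trmx_mul trmxK raddfB /= trmx1 tr_inactive_mx.
rewrite trE -(jac_pair _ _ dg).
rewrite {1}dE !mul_col_mx !mul_row_col !mul0mx !addr0 mulmxDr !mulmxA mulNmx.
by rewrite sub0r -!addrA.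
Qed.


Section given_map.
Variables (d1 e1 : R) (y : 'rV[R]_n -> 'rV[R]_m) (mu : 'rV[R]_n -> 'rV[R]_r)
  (xi : 'rV[R]_n -> 'rV[R]_s).
Hypothesis kmap : kkt_map f h g xs ys mus xis d1 e1 y mu xi.

Local Notation v := (kkt_point y mu xi).
Local Notation c := (graph_map v).

Let y0 : y xs = ys. Proof. by have [_ _ []] := kmap. Qed.
Let mu0 : mu xs = mus. Proof. by have [_ _ []] := kmap. Qed.
Let xi0 : xi xs = xis. Proof. by have [_ _ []] := kmap. Qed.

(** One [d] is enough, chosen so that [eta d] is below the radius of
    [lower_growth].  For [x] near [xs] the point [y x] lies in the ball of
    radius [eta d] and minimises [f (x, .)] over it. *)
Lemma reduced_local_min : bilocal_solution F f H G h g xs ys ->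
  \forall x \near xs, H (x, y x) = 0 -> npos (G (x, y x)) -> F (xs, y xs) <= F (x, y x).
Proof.
rewrite y0 => -[_ _ [d0 [eta [d00 eta0 eta_cvg loc]]]].
have [rho rho0 grow] := lower_growth f_smooth g_smooth h_smooth juc.
have rho2 : 0 < rho / 2 by rewrite divr_gt0.
have [d [[d_gt0 dd0] ed]] : exists d : R, (0 < d /\ d <= d0) /\ eta d < rho / 2.
  have n1 : \forall d \near 0^'+, eta d < rho / 2 by exact: eta_cvg (lt_nbhsl rho2).
  have n2 : \forall d \near 0^'+, d <= d0 by exact: nbhs_right_le.
  have n3 : \forall d \near 0^'+, (0 : R) < d by exact: nbhs_right_gt.
  exact: filter_ex (filterI (filterI n3 n2) n1).
have dI : 0 < d <= d0 by rewrite d_gt0.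
have [_ locb] := loc d dI; have edgt0 := eta0 d dI.
have [Cy Cmu Cxi] := kkt_map_star kmap.
have nx : \forall x \near xs, `|x - xs| < rho / 2 by apply/near_normP; exists (rho / 2).
have nmu : \forall x \near xs, `|mu x - mus| < rho / 2.
  have nb : \forall z \near mu xs, `|z - mus| < rho / 2.
    by rewrite mu0; apply/near_normP; exists (rho / 2).
  exact: (Ck_continuous Cmu nb).
have nxi : \forall x \near xs, `|xi x - xis| < rho / 2.
  have nb : \forall z \near xi xs, `|z - xis| < rho / 2.
    by rewrite xi0; apply/near_normP; exists (rho / 2).
  exact: (Ck_continuous Cxi nb).
have nyb : \forall x \near xs, eball ys (eta d) (y x).
  by have := Ck_continuous Cy; apply; rewrite y0; exact: near_eball.
have nxb := near_eball xs d_gt0.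
have nk := near_kkt kmap.
apply: filterS3 (filterI nx nxb) (filterI nmu nxi) (filterI nyb nk).
move=> x [xr xb] [mur xir] [yb [kktx _ _ _]] Hx Gx.
have close z : eball ys (eta d) z ->
    `|row_mx x (row_mx z (row_mx (mu x) (xi x))) - ustar| < rho.
  move=> zb; rewrite /us !(opp_row_mx, add_row_mx).
  apply: (@le_lt_trans _ _ (rho / 2)); last by rewrite ltr_pdivrMr // ltr_pMr // ltr1n.
  apply: norm_row_mx_le; first exact: ltW.
  apply: norm_row_mx_le.
    by apply: le_trans (norm_le_enorm _) _; apply: le_trans zb (ltW ed).
  by apply: norm_row_mx_le; exact: ltW.
apply: locb => //; split.
  by split=> //; have [_ ? _ ? _] := kktx; split.
by move=> z [zfeas zb]; apply: grow zfeas; [exact: close|exact: close|exact: kktx].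
Qed.

Let Cv : Ck 2 v xs := Ck_kkt_point kmap.
Let Kc := near_kkt_res kmap.
Let CK : Ck 2 kkt (c xs).
Proof. by rewrite (kkt_point_star kmap); exact: Ck_kkt_res. Qed.
Let uK : dsubmx ('J kkt (c xs)) \in unitmx.
Proof. by rewrite (kkt_point_star kmap); exact: kkt_res_unit. Qed.

Lemma jac_kkt_graph (d : 'cV[R]_n) : jac c xs *m d =
  col_mx d (col_mx (jac y xs *m d) (col_mx (jac mu xs *m d) (jac xi xs *m d))).
Proof.
have [/Ck_differentiable dy /Ck_differentiable dmu /Ck_differentiable dxi] := kkt_map_star kmap.
rewrite (jac_graph_map Cv) mul_col_mx mul1mx (jac_mulmx d (Ck_differentiable Cv)).
have dd : differentiable (fun x => row_mx (mu x) (xi x)) xs by exact: differentiable_row_mx.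
rewrite (derive_row_mx _ dy dd) (derive_row_mx _ dmu dxi).
by rewrite !tr_row_mx (jac_mulmx d dy) (jac_mulmx d dmu) (jac_mulmx d dxi).
Qed.

Lemma kkt_tangent (d : 'cV[R]_(n + (m + (r + s)))) :
  jac kkt ustar *m d = 0 <-> d = jac c xs *m usubmx d.
Proof. by have := tangent_reduced CK Cv Kc uK d; rewrite (kkt_point_star kmap). Qed.

Local Notation SPcone := (SP_critical_cone F H G xs ys y).
Local Notation FPcone := (FP_critical_cone F f H G h g xs ys mus xis).

Lemma critical_cone_lift (d : 'cV[R]_n) : SPcone d <-> FPcone (jac c xs *m d).
Proof.
rewrite /SP_critical_cone /FP_critical_cone /= FP_matrix_mulmx.
have -> : jac kkt ustar *m (jac c xs *m d) = 0.
  by apply/kkt_tangent; rewrite jac_kkt_graph col_mxKu -jac_kkt_graph.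
rewrite jac_kkt_graph col_mxKu col_mxKd col_mxKu.
have E k (A : 'M[R]_(k, n)) (B : 'M[R]_(k, m)) :
    (A + B *m jac y xs) *m d = A *m d + B *m (jac y xs *m d).
  by rewrite mulmxDl mulmxA.
rewrite !E; split=> -[h1 h2 h3]; (split; last exact: h3).
- by rewrite h1 !col_mx0.
- by move=> i /h2; rewrite E.
- by have := congr1 usubmx h1; rewrite col_mxKu linear0.
- by move=> i /h2; rewrite E.
Qed.

(** The lower rows of the matrix force a critical direction of (FP) to be
    tangent to the branch. *)
Lemma critical_cone_drop (d : 'cV[R]_(n + (m + (r + s)))) : FPcone d ->
  d = jac c xs *m usubmx d /\ SPcone (usubmx d).
Proof.
move=> Cd; have [] := Cd; rewrite FP_matrix_mulmx -col_mx0 => /eq_col_mx[_ /kkt_tangent dE] _ _.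
by split=> //; apply/critical_cone_lift; rewrite -dE.
Qed.

End given_map.
End bilevel.

(** * Multipliers of the two problems *)

Lemma max_ge0_image {R : realType} (T T' : Type) (A : set T) (t : T -> T')
    (phi : T -> R) (psi : T' -> R) :
  (forall x, A x -> phi x = psi (t x)) -> max_ge0 A phi <-> max_ge0 (t @` A) psi.
Proof.
move=> tE; split=> [[z Az [zmax z0]]|[_ [z Az <-] [zmax z0]]].
  exists (t z); first by exists z.
  by split=> [_ [x Ax <-]|]; rewrite -!tE //; apply: zmax.
exists z => //; split=> [x Ax|]; rewrite !tE //; apply: zmax.
by exists x.
Qed.

Lemma affine_pair_continuous {R : realType} (p q k : nat) (C0 : 'rV[R]_k)
    (C1 : 'M[R]_(p, k)) (C2 : 'M[R]_(q, k)) :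
  continuous (fun l : 'rV[R]_p * 'rV[R]_q => C0 + l.1 *m C1 + l.2 *m C2).
Proof.
move=> l; apply: cvgD; first apply: cvgD; first exact: cvg_cst.
  apply: (@continuous_comp _ _ _ (fun l : 'rV[R]_p * 'rV[R]_q => l.1) (mulmxr C1)).
    exact: cvg_fst.
  exact: rV_linear_continuous.
apply: (@continuous_comp _ _ _ (fun l : 'rV[R]_p * 'rV[R]_q => l.2) (mulmxr C2)).
  exact: cvg_snd.
exact: rV_linear_continuous.
Qed.

Lemma continuous_pair (T V W : topologicalType) (a : T -> V) (b : T -> W) :
  continuous a -> continuous b -> continuous (fun x => (a x, b x)).
Proof. by move=> ca cb x; exact: cvg_pair (ca x) (cb x). Qed.

Section multiplier_nesting.
Context {R : realType} {p q m r s : nat}.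

Local Notation flat_multiplier :=
  ('rV[R]_p * 'rV[R]_q * 'rV[R]_m * 'rV[R]_r * 'rV[R]_s)%type.
Local Notation nested_multiplier := ('rV[R]_(p + (m + (r + s))) * 'rV[R]_q)%type.

(** (FP) has a single vector of equality multipliers when it is read as a
    nonlinear program. *)
Definition nest (l : flat_multiplier) : nested_multiplier :=
  let: (lH, lG, lL, lh, lg) := l in (row_mx lH (row_mx lL (row_mx lh lg)), lG).

Definition unnest (l : nested_multiplier) : flat_multiplier :=
  (lsubmx l.1, l.2, lsubmx (rsubmx l.1), lsubmx (rsubmx (rsubmx l.1)),
   rsubmx (rsubmx (rsubmx l.1))).

Lemma nestK : cancel nest unnest.
Proof. by case=> [[[[lH lG] lL] lh] lg]; rewrite /unnest /= !row_mxKr !row_mxKl. Qed.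

Lemma unnestK : cancel unnest nest.
Proof. by case=> l lG; rewrite /unnest /nest /= !hsubmxK. Qed.

Definition upper_multiplier (l : flat_multiplier) : 'rV[R]_p * 'rV[R]_q := l.1.1.1.

Lemma upper_multiplier_continuous : continuous upper_multiplier.
Proof.
move=> l; rewrite /upper_multiplier.
apply: (@continuous_comp _ _ _ (fun l : flat_multiplier => l.1) (fun l => l.1.1)).
  exact: cvg_fst.
apply: (@continuous_comp _ _ _ (fun l : 'rV[R]_p * 'rV[R]_q * 'rV[R]_m * 'rV[R]_r => l.1) (fun l => l.1)).
  exact: cvg_fst.
exact: cvg_fst.
Qed.

Lemma upper_multiplier_affine : affine_map upper_multiplier.
Proof. by []. Qed.

Lemma unnest_affine : affine_map unnest.
Proof.
by move=> x y t; rewrite /unnest /= !linearD /= !linearZ.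
Qed.

Lemma unnest_continuous (C0 : 'rV[R]_(p + (m + (r + s)))) C1 C2 :
  continuous (fun l : 'rV[R]_p * 'rV[R]_q => unnest (C0 + l.1 *m C1 + l.2 *m C2, l.2)).
Proof.
have cA := @affine_pair_continuous R _ _ _ C0 C1 C2.
have cL k (L : {linear 'rV[R]_(p + (m + (r + s))) -> 'rV[R]_k}) :
    continuous (fun l : 'rV[R]_p * 'rV[R]_q => L (C0 + l.1 *m C1 + l.2 *m C2)).
  move=> l; apply: (@continuous_comp _ _ _ (fun l : 'rV[R]_p * 'rV[R]_q => C0 + l.1 *m C1 + l.2 *m C2) L).
    exact: cA.
  exact: rV_linear_continuous.
apply: continuous_pair; last exact: (cL _ (rsubmx \o (rsubmx \o rsubmx))).
apply: continuous_pair; last exact: (cL _ (lsubmx \o (rsubmx \o rsubmx))).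
apply: continuous_pair; last exact: (cL _ (lsubmx \o rsubmx)).
apply: continuous_pair; first exact: (cL _ lsubmx).
by move=> l; exact: cvg_snd.
Qed.

End multiplier_nesting.

Section equivalence.
Context {R : realType} {n m p q r s : nat}.
Variables (F f : 'rV[R]_n * 'rV[R]_m -> R)
  (H : 'rV[R]_n * 'rV[R]_m -> 'rV[R]_p) (G : 'rV[R]_n * 'rV[R]_m -> 'rV[R]_q)
  (h : 'rV[R]_n * 'rV[R]_m -> 'rV[R]_r) (g : 'rV[R]_n * 'rV[R]_m -> 'rV[R]_s).
Variables (xs : 'rV[R]_n) (ys : 'rV[R]_m) (mus : 'rV[R]_r) (xis : 'rV[R]_s).

Local Notation U := 'rV[R]_(n + (m + (r + s))).
Local Notation ustar := (us xs ys mus xis).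

Hypotheses (f_smooth : C2_C3y f (xs, ys)) (g_smooth : C2_C3y g (xs, ys))
  (h_smooth : C2_C3y h (xs, ys)).
Hypotheses (F_smooth : Ck 2 F (xs, ys)) (G_smooth : Ck 2 G (xs, ys))
  (H_smooth : Ck 2 H (xs, ys)).
Hypothesis juc : jacobian_uniqueness f h g xs ys mus xis.
Hypotheses (H0 : H (xs, ys) = 0) (G0 : npos (G (xs, ys))).

Variables (d1 e1 : R) (y : 'rV[R]_n -> 'rV[R]_m) (mu : 'rV[R]_n -> 'rV[R]_r)
  (xi : 'rV[R]_n -> 'rV[R]_s).
Hypothesis kmap : kkt_map f h g xs ys mus xis d1 e1 y mu xi.

Local Notation kkt := (kkt_res f h g).
Local Notation v := (kkt_point y mu xi).
Local Notation c := (graph_map v).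
Local Notation Fu := (fun u : U => F (u_xy u)).
Local Notation Hu := (fun u : U => H (u_xy u)).
Local Notation Gu := (fun u : U => G (u_xy u)).
Local Notation Fx := (fun x => F (x, y x)).
Local Notation Hx := (fun x => H (x, y x)).
Local Notation Gx := (fun x => G (x, y x)).

Let y0 : y xs = ys. Proof. by have [_ _ []] := kmap. Qed.
Let c0 : c xs = ustar := kkt_point_star kmap.
Let Cv : Ck 2 v xs := Ck_kkt_point kmap.
Let Kc := near_kkt_res kmap.
Let CF : Ck 2 Fu (c xs). Proof. by rewrite c0; exact: Ck_star. Qed.
Let CH : Ck 2 Hu (c xs). Proof. by rewrite c0; exact: Ck_star. Qed.
Let CG : Ck 2 Gu (c xs). Proof. by rewrite c0; exact: Ck_star. Qed.
Let CK : Ck 2 kkt (c xs). Proof. by rewrite c0; exact: Ck_kkt_res. Qed.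
Let uK : dsubmx ('J kkt (c xs)) \in unitmx.
Proof. by rewrite c0; exact: kkt_res_unit. Qed.

Lemma graph_compE (T : Type) (a : 'rV[R]_n * 'rV[R]_m -> T) :
  (fun x => a (u_xy (c x))) = (fun x => a (x, y x)).
Proof. by apply/funext => x; rewrite u_xy_row. Qed.

Lemma Ck_Fx : Ck 2 Fx xs.
Proof. by rewrite -graph_compE; apply: Ck_comp1 CF; exact: Ck_graph_map. Qed.

Lemma Ck_Hx : Ck 2 Hx xs.
Proof. by rewrite -(graph_compE H); apply: Ck_comp CH; exact: Ck_graph_map. Qed.

Lemma Ck_Gx : Ck 2 Gx xs.
Proof. by rewrite -(graph_compE G); apply: Ck_comp CG; exact: Ck_graph_map. Qed.

Lemma derive_graph (W : normedModType R) (a : 'rV[R]_n * 'rV[R]_m -> W) (d : 'cV[R]_n) :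
  differentiable a (xs, ys) ->
  'D_(d^T) (fun x => a (x, y x)) xs = 'D_((d^T, (jac y xs *m d)^T)) a (xs, ys).
Proof.
move=> da; rewrite -(graph_compE a).
have dc : differentiable c xs := Ck_differentiable (Ck_graph_map Cv).
have cxy : continuous (u_xy : U -> 'rV[R]_n * 'rV[R]_m) by exact: rV_linear_continuous.
have dau : differentiable (fun u : U => a (u_xy u)) (c xs).
  apply: (@differentiable_comp _ _ _ _ (u_xy : U -> _) a).
    exact: linear_differentiable.
  by rewrite c0 u_xy_star.
rewrite (derive_comp _ dc dau) derive_u_xy c0 u_xy_star; congr (derive a _ _).
have -> : 'D_(d^T) c xs = (jac c xs *m d)^T by rewrite (jac_mulmx d dc) trmxK.
by rewrite (jac_kkt_graph kmap) !tr_col_mx u_xy_row.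
Qed.

Lemma SP_multipliersE :
  SP_multipliers F H G xs ys y = nlp_multipliers Fx Hx Gx xs.
Proof.
apply/seteqP; split=> l; rewrite /SP_multipliers /nlp_multipliers /= y0.
  by case.
by case.
Qed.

Lemma FP_lagrE l : FP_lagr F f H G h g l = nlp_lagr Fu (full_eq Hu kkt) Gu (nest l).
Proof.
case: l => [[[[lH lG] lL] lh] lg]; apply/funext => u.
have dr k1 k2 (a : 'rV[R]_k1) (b : 'rV[R]_k2) a' b' :
    dotr (row_mx a b) (row_mx a' b') = dotr a a' + dotr b b'.
  by rewrite !dotrE tr_row_mx mul_row_col mxE.
rewrite /nlp_lagr /nest /full_eq /kkt_res !dr /comp_res /gradL /= -/(u_xy u).
rewrite -!addrA; congr (_ + (_ + _)); rewrite addrC -!addrA.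
by congr (_ + (_ + _)).
Qed.

Lemma FP_multipliersE l : FP_multipliers F f H G h g xs ys mus xis l <->
  nlp_multipliers Fu (full_eq Hu kkt) Gu ustar (nest l).
Proof.
case: l => [[[[lH lG] lL] lh] lg].
have [[gL h0 xi0 g0 cs] _ _ _] := juc.
split=> [[E1 _ [E2 E3 _] _ _]|[E1 E2 E3]].
  by split; [rewrite -FP_lagrE|exact: E2|rewrite u_xy_star].
rewrite u_xy_star in E3; split; [by rewrite FP_lagrE|exact: H0|by split|exact: gL|].
by split; [exact: h0|exact: kkt_comp_residual].
Qed.

Local Notation SPmult := (SP_multipliers F H G xs ys y).
Local Notation FPmult := (FP_multipliers F f H G h g xs ys mus xis).

Definition raise_multiplier (l : 'rV[R]_p * 'rV[R]_q) :=
  unnest (lift_multiplier Fu Hu Gu kkt v xs l).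

Lemma raise_multiplierP l : SPmult l <-> FPmult (raise_multiplier l).
Proof.
rewrite SP_multipliersE FP_multipliersE /raise_multiplier unnestK.
have := lift_multiplierP CF CH CG CK Cv Kc uK l; rewrite c0.
by rewrite !graph_compE.
Qed.

Lemma FP_multiplier_raised l : FPmult l -> l = raise_multiplier (upper_multiplier l).
Proof.
move=> /FP_multipliersE; rewrite -c0 => /(multiplier_lifts CF CH CG CK Cv Kc uK) E.
rewrite -[LHS]nestK E /raise_multiplier; congr (unnest (lift_multiplier _ _ _ _ _ _ _)).
by case: l {E} => [[[[lH lG] lL] lh] lg]; rewrite /drop_multiplier /= row_mxKl.
Qed.

Lemma upper_raised l : upper_multiplier (raise_multiplier l) = l.
Proof. by case: l => lH lG; rewrite /upper_multiplier /= row_mxKl. Qed.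

Lemma FP_multipliers_image : FPmult = raise_multiplier @` SPmult.
Proof.
apply/seteqP; split=> [l Fl|_ [l Sl <-]]; last exact/raise_multiplierP.
have E := FP_multiplier_raised Fl; exists (upper_multiplier l); last by rewrite -E.
by apply/raise_multiplierP; rewrite -E.
Qed.

Lemma SP_multipliers_image : SPmult = upper_multiplier @` FPmult.
Proof.
apply/seteqP; split=> [l Sl|_ [l Fl <-]].
  by exists (raise_multiplier l); [exact/raise_multiplierP|exact: upper_raised].
by apply/raise_multiplierP; rewrite -FP_multiplier_raised.
Qed.

(** The map is affine in the multiplier, hence preserves compactness and
    convexity. *)
Lemma raise_multiplier_form : exists C0 C1 C2, raise_multiplier =
  fun l : 'rV[R]_p * 'rV[R]_q => unnest (C0 + l.1 *m C1 + l.2 *m C2, l.2).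
Proof.
pose D : 'M[R]_(n + (m + (r + s)), m + (r + s)) :=
  - (col_mx 0 1%:M *m invmx (rsubmx (jac kkt (c xs)))).
exists (row_mx 0 (grad Fu (c xs) *m D)), (row_mx 1%:M (jac Hu (c xs) *m D)),
  (row_mx 0 (jac Gu (c xs) *m D)).
apply/funext => l; rewrite /raise_multiplier /lift_multiplier; congr (unnest (_, _)).
have -> rho : adjoint_multiplier kkt v xs rho = rho *m D.
  rewrite /adjoint_multiplier /D mulmxN mulmxA; congr (- (_ *m _)).
  by rewrite -{2}[rho]hsubmxK mul_row_col mulmx0 add0r mulmx1.
rewrite !mul_mx_row !add_row_mx mulmx1 mulmx0 add0r addr0.
by rewrite !mulmxDl !mulmxA.
Qed.

Lemma multiplier_condition_equiv : SP_multiplier_condition F H G xs ys y <->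
  FP_multiplier_condition F f H G h g xs ys mus xis.
Proof.
have [C0 [C1 [C2 rE]]] := raise_multiplier_form.
split=> -[ne cp cv].
  split; rewrite FP_multipliers_image.
  - by have [l Sl] := ne; exists (raise_multiplier l), l.
  - apply: continuous_compact cp; apply: continuous_subspaceT.
    by rewrite rE; exact: unnest_continuous.
  - apply: convex_image cv => a b t; rewrite rE -unnest_affine; congr unnest.
    apply: injective_projections => //=; rewrite !mulmxDl -!scalemxAl.
    rewrite !scalerDr; apply/rowP => i.
    move: (a.1 *m C1) (b.1 *m C1) (a.2 *m C2) (b.2 *m C2) => a1 b1 a2 b2.
    by rewrite !mxE; ring.
split; rewrite SP_multipliers_image.
- by have [l Fl] := ne; exists (upper_multiplier l), l.
- apply: continuous_compact cp; apply: continuous_subspaceT.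
  exact: upper_multiplier_continuous.
- exact: convex_image upper_multiplier_affine cv.
Qed.

(** Both maxima run over corresponding multipliers with equal values. *)
Lemma second_order_transfer (d : 'cV[R]_n) :
  max_ge0 SPmult (fun l => (d^T *m hess (SP_lagr F H G y l) xs *m d) 0 0) <->
  max_ge0 FPmult (fun l => ((jac c xs *m d)^T *m hess (FP_lagr F f H G h g l) ustar *m
     (jac c xs *m d)) 0 0).
Proof.
rewrite FP_multipliers_image; apply: max_ge0_image => l; rewrite SP_multipliersE => Sl.
rewrite FP_lagrE /raise_multiplier unnestK.
have := quadratic_reduced CF CH CG CK Cv Kc uK (l := l) d.
by rewrite !graph_compE c0 => /(_ Sl).
Qed.

Lemma second_order_condition_equiv : SP_second_order_condition F H G xs ys y <->
  FP_second_order_condition F f H G h g xs ys mus xis.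
Proof.
split=> [SP d|FP d Sd].
  move=> /(critical_cone_drop f_smooth g_smooth h_smooth juc kmap)[dE /SP Sd].
  by rewrite dE; apply/second_order_transfer.
apply/second_order_transfer; apply: FP.
exact: (critical_cone_lift F H G f_smooth g_smooth h_smooth juc kmap d).1 Sd.
Qed.

Lemma FP_MFCQ_SP : FP_MFCQ f H G h g xs ys mus xis -> SP_MFCQ H G xs y.
Proof.
have := MFCQ_reduced CH CG CK Cv Kc uK; rewrite c0 !graph_compE.
exact.
Qed.

Lemma SP_necessary : bilocal_solution F f H G h g xs ys -> SP_MFCQ H G xs y ->
  SP_multiplier_condition F H G xs ys y /\ SP_second_order_condition F H G xs ys y.
Proof.
move=> bl mfcq.
have [dF dG dH] : [/\ differentiable F (xs, ys), differentiable G (xs, ys)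
  & differentiable H (xs, ys)].
  by split; [exact: Ck_differentiable F_smooth|exact: Ck_differentiable G_smooth|
    exact: Ck_differentiable H_smooth].
have lm := reduced_local_min f_smooth g_smooth h_smooth juc kmap bl.
have dGi i : differentiable (fun z => G z 0 i) (xs, ys).
  exact: Ck_differentiable (Ck_entry 0 i G_smooth).
have exists_mult d : SP_critical_cone F H G xs ys y d ->
    exists2 l, SPmult l & 0 <= (d^T *m hess (SP_lagr F H G y l) xs *m d) 0 0.
  move=> [Hd Gd Fd]; rewrite SP_multipliersE.
  have E k1 (A : 'M[R]_(k1, n)) (B : 'M[R]_(k1, m)) :
    (A + B *m jac y xs) *m d = A *m d + B *m (jac y xs *m d).
    by rewrite mulmxDl mulmxA.
  apply: (second_order_multiplier Ck_Fx Ck_Hx Ck_Gx mfcq) lm _ _ _.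
  - by rewrite y0.
  - by rewrite y0.
  - rewrite (jac_mulmx d (Ck_differentiable Ck_Hx)) (derive_graph d dH).
    by rewrite -(jac_pair _ _ dH) -E.
  - rewrite y0 => i Gi; rewrite (grad_mulmx d (Ck_differentiable (Ck_entry 0 i Ck_Gx))).
    rewrite (derive_graph d (dGi i)) -(grad_pair _ _ (dGi i)) -E; exact: Gd.
  - rewrite (grad_mulmx d (Ck_differentiable Ck_Fx)).
    by rewrite (derive_graph d dF) -(grad_pair _ _ dF) -E.
have cpt : compact SPmult.
  by rewrite SP_multipliersE; apply: nlp_multipliers_compact Ck_Fx Ck_Hx Ck_Gx mfcq _; rewrite y0.
split; last first.
  move=> d /exists_mult; apply: compact_max_ge0 cpt _.
  exact: (quadratic_nlp_lagr_continuous Ck_Fx Ck_Hx Ck_Gx).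
split=> //.
- have [|l Sl _] := exists_mult 0; last by exists l.
  by split=> [|i _|]; rewrite mulmx0 // mxE.
- by rewrite SP_multipliersE; exact: nlp_multipliers_convex Ck_Fx Ck_Hx Ck_Gx.
Qed.

End equivalence.

Theorem theorem4p5 (R : realType) (n m p q r s : nat)
    (F f : 'rV[R]_n * 'rV[R]_m -> R)
    (H : 'rV[R]_n * 'rV[R]_m -> 'rV[R]_p)
    (G : 'rV[R]_n * 'rV[R]_m -> 'rV[R]_q)
    (h : 'rV[R]_n * 'rV[R]_m -> 'rV[R]_r)
    (g : 'rV[R]_n * 'rV[R]_m -> 'rV[R]_s)
    (xs : 'rV[R]_n) (ys : 'rV[R]_m) (mus : 'rV[R]_r) (xis : 'rV[R]_s)
    (f_smooth : C2_C3y f (xs, ys))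
    (g_smooth : C2_C3y g (xs, ys))
    (h_smooth : C2_C3y h (xs, ys))
    (F_smooth : Ck 2 F (xs, ys))
    (G_smooth : Ck 2 G (xs, ys))
    (H_smooth : Ck 2 H (xs, ys))
    (juc : jacobian_uniqueness f h g xs ys mus xis)
    (bilocal : bilocal_solution F f H G h g xs ys) :
  (exists d1 e1 y mu xi, kkt_map f h g xs ys mus xis d1 e1 y mu xi) /\
  (forall d1 e1 y mu xi, kkt_map f h g xs ys mus xis d1 e1 y mu xi ->
     (SP_MFCQ H G xs y ->
        SP_multiplier_condition F H G xs ys y /\
        SP_second_order_condition F H G xs ys y) /\
     (FP_MFCQ f H G h g xs ys mus xis ->
        FP_multiplier_condition F f H G h g xs ys mus xis /\
        FP_second_order_condition F f H G h g xs ys mus xis) /\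
     ((SP_multiplier_condition F H G xs ys y <->
         FP_multiplier_condition F f H G h g xs ys mus xis) /\
      (SP_second_order_condition F H G xs ys y <->
         FP_second_order_condition F f H G h g xs ys mus xis))).
Proof.
split; first exact: kkt_map_exists.
move=> d1 e1 y mu xi kmap.
have [[H0 G0] _ _] := bilocal.
have mult_eq := multiplier_condition_equiv f_smooth g_smooth h_smooth F_smooth G_smooth
  H_smooth juc H0 G0 kmap.
have so_eq := second_order_condition_equiv f_smooth g_smooth h_smooth F_smooth G_smooth
  H_smooth juc H0 G0 kmap.
have SPn := SP_necessary f_smooth g_smooth h_smooth F_smooth G_smooth
  H_smooth juc H0 G0 kmap bilocal.
split=> //; split; last by split.
move=> /(FP_MFCQ_SP f_smooth g_smooth h_smooth G_smooth H_smooth juc kmap)/SPn[? ?].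
by split; [apply/mult_eq|apply/so_eq].
Qed.
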